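(* (i) Let $s >\frac{d_h}{2d_w}$. Then the Gaussian random field defined by \[ X_s(f)=\int_K f(x) \tilde{X}_s(x)\, d\mu (x), \qquad f \in \mathcal{S}(K), \] has the law of a FGF with parameter $s$. (ii) Let $s\ge 0$. If there exists a (measurable) Gaussian field $(\tilde{Y}_s(x))_{x\in K}$ on $K$ with \[ \mathbb{E}\left( \int_K \tilde{Y}_s(x)^2\, d\mu(x)\right)<+\infty \] such that the Gaussian random field defined by \[ Y_s(f)=\int_K f(x) \tilde{Y}_s(x)\, d\mu (x), \qquad f \in \mathcal{S}(K), \] has the law of a FGF with parameter $s$, then $s>\frac{d_h}{2d_w}$.
   Context: Let $p_1,p_2,p_3\in\mathbb C$ be the vertices of an equilateral triangle of side $1$, $V_0=\{p_1,p_2,p_3\}$, $\mathfrak f_i(z)=\frac{z-p_i}{2}+p_i$ ($i=1,2,3$). $K$ is the Sierpinski gasket: the unique non-empty compact set with $K=\bigcup_{i=1}^3\mathfrak f_i(K)$; its boundary is $\partial K=V_0$. $d_h=\frac{\ln3}{\ln2}$, $d_w=\frac{\ln5}{\ln2}$. $\mu$ is the Borel measure on $K$ with $\mu(\mathfrak f_{i_1}\circ\cdots\circ\mathfrak f_{i_n}(K))=3^{-n}$ for all $n$ and all $i_1,\dots,i_n\in\{1,2,3\}$. Put $V_{m+1}=\bigcup_{i}\mathfrak f_i(V_m)$; $x\sim y$ in the graph $G_m$ on $V_m$ means that $x\neq y$ both belong to a common set $\mathfrak f_{i_1}\circ\cdots\circ\mathfrak f_{i_m}(V_0)$ (edges have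 length $2^{-m}$). Let $a_m=\frac{3^{m+1}}2$, $\mathcal E_m(f,f)=\frac{5^m}{a_m}\sum_{x,y\in V_m,\,x\sim y}(f(x)-f(y))^2$ (each edge counted once), $\mathcal E(f,f)=\lim_m\mathcal E_m(f,f)$ (a non-decreasing limit), $\mathcal F_0=\{f\in C(K):\mathcal E(f,f)<\infty,\ f=0\text{ on }\partial K\}$. $(\mathcal E,\mathcal F_0)$ is a local regular Dirichlet form on $L^2(K,\mu)$; the Dirichlet Laplacian $\Delta$ is its (self-adjoint, nonpositive) generator: $\mathcal E(f,g)=-\int_K\Delta f\,g\,d\mu$. Let $0<\lambda_1\le\lambda_2\le\cdots$ be the eigenvalues of $-\Delta$ (with multiplicity) and $(\Phi_j)_{j\ge1}$ an orthonormal basis of $L^2(K,\mu)$ of continuous eigenfunctions, $\Delta\Phi_j=-\lambda_j\Phi_j$. For $s\ge0$, $f\in L^2(K,\mu)$: $(-\Delta)^{-s}f=\sum_j\lambda_j^{-s}\Phi_j\int_K\Phi_jf\,d\mu$. $\mathcal S(K)$ is the set of $f\in C(K)$ vanishing on $\partial K$ with $\lim_{n\to\infty}n^k|\int_K\Phi_nf\,d\mu|=0$ for all $k\ge0$. FGF: a fractional Gaussian field with parameter $s\ge0$ is a centered Gaussian field $\{X_s(f)\}_{f\in\mathcal S(K)}$ with $\mathbb E(X_s(f)X_s(g))=\int_K(-\Delta)^{-s}f\,(-\Delta)^{-s}g\,d\mu$ for all $f,g\in\mathcal S(K)$. The semigroup $P_t=e^{t\Delta}$ has a continuous kernel $p_t(x,y)$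 with respect to $\mu$ (Dirichlet heat kernel), and $G_s(x,y)=\frac1{\Gamma(s)}\int_0^\infty t^{s-1}p_t(x,y)\,dt$ for $x\ne y$. For $s>\frac{d_h}{2d_w}$, $G_s(x,\cdot)\in L^2(K,\mu)$ for every $x\in K$. Let $W$ be white noise on $L^2(K,\mu)$: a centered Gaussian family $\{W(f)=\int_KfdW\}_{f\in L^2(K,\mu)}$, linear in $f$, with $\mathbb E(W(f)W(g))=\int_Kfg\,d\mu$. For $s>\frac{d_h}{2d_w}$ set $\tilde X_s(x)=\int_KG_s(x,y)\,W(dy)$, $x\in K$; equivalently $\tilde X_s(x)=\sum_{i\ge1}\lambda_i^{-s}\Phi_i(x)W_i$ with $W_i=W(\Phi_i)$ i.i.d. standard normal. A jointly measurable version is used so that the integrals against $\mu$ make sense. *)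

(* Defs.v *)
From HB Require Import structures.
From mathcomp Require Import all_boot all_order all_algebra.
From mathcomp Require Import all_classical all_reals all_analysis.

Set Implicit Arguments.
Unset Strict Implicit.
Unset Printing Implicit Defensive.
Import Order.TTheory GRing.Theory Num.Theory.
Import numFieldNormedType.Exports.

Local Open Scope classical_set_scope.
Local Open Scope ring_scope.

(** The plane ℂ is represented by [R * R] with its product topology and product
    sigma-algebra (the Borel sets of the plane). Functions on the gasket K are
    functions on the plane of which only the values on K matter; accordingly,
    continuity is taken within K and every integral is taken over K. *)

Section gasket.
Context {R : realType}.
Implicit Types (p : 'I_3 -> R * R) (K : set (R * R)) (f g : R * R -> R).

Definition hausdorff_dim : R := ln 3 / ln 2.
Definition walk_dim : R := ln 5 / ln 2.

(* The norm of [R * R] is the sup norm, hence the explicit Euclidean distance. *)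
Definition unit_equilateral p :=
  forall i j, i != j ->
    ((p i).1 - (p j).1) ^+ 2 + ((p i).2 - (p j).2) ^+ 2 = 1.

Definition gasket_map p (i : 'I_3) (z : R * R) : R * R :=
  2^-1 *: (z - p i) + p i.

Definition word_map p (w : seq 'I_3) : R * R -> R * R :=
  foldr (fun i h => gasket_map p i \o h) id w.

Definition sierpinski_gasket p K :=
  [/\ K !=set0, compact K & K = \bigcup_(i in setT) (gasket_map p i @` K)].

(* A measure on K is encoded as a measure on the plane that does not charge the
   complement of K. *)
Definition selfsimilar_measure p K (mu : {measure set (R * R) -> \bar R}) :=
  mu (~` K) = 0%E /\
  forall w : seq 'I_3, mu (word_map p w @` K) = ((3^-1) ^+ size w)%:E.

Fixpoint vertices p (m : nat) : set (R * R) :=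
  if m is m'.+1 then \bigcup_(i in setT) (gasket_map p i @` vertices p m')
  else range p.

Definition joined p (m : nat) (x y : R * R) :=
  x <> y /\ exists w : m.-tuple 'I_3,
    (word_map p w @` range p) x /\ (word_map p w @` range p) y.

Definition oriented_edges p (m : nat) : set ((R * R) * (R * R)) :=
  [set e | [/\ vertices p m e.1, vertices p m e.2 & joined p m e.1 e.2]].

(* Every unoriented edge occurs twice in [oriented_edges], hence the factor
   1/2; the sum has finite support because the vertex sets are finite. *)
Definition graph_energy p (m : nat) f g : R :=
  5 ^+ m / (3 ^+ m.+1 / 2) *
  (2^-1 * \sum_(e \in oriented_edges p m)
            (f e.1 - f e.2) * (g e.1 - g e.2)).

Definition energy p f : \bar R := limn (fun m => (graph_energy p m f f)%:E).

Definition energy_form p f g : R := limn (fun m => graph_energy p m f g).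

Definition dirichlet_domain p K : set (R * R -> R) :=
  [set f : R * R -> R | [/\ {within K, continuous f}, (energy p f < +oo)%E
             & forall i, f (p i) = 0]].

Definition L2 K (mu : {measure set (R * R) -> \bar R}) : set (R * R -> R) :=
  [set f : R * R -> R | measurable_fun K f /\
           (\int[mu]_(x in K) ((f x) ^+ 2)%:E < +oo)%E].

Definition inner K (mu : {measure set (R * R) -> \bar R}) f g : R :=
  \int[mu]_(x in K) (f x * g x).

(* The graph of the generator of the Dirichlet form: [h] is Δu. Only
   representatives [u] that are continuous on K are considered. *)
Definition dirichlet_laplacian p K (mu : {measure set (R * R) -> \bar R})
    (u h : R * R -> R) :=
  [/\ dirichlet_domain p K u, L2 K mu h
    & forall g, dirichlet_domain p K g -> energy_form p u g = - inner K mu h g].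

Definition L2_sum K (mu : {measure set (R * R) -> \bar R})
    (u : nat -> R * R -> R) (h : R * R -> R) :=
  L2 K mu h /\
  (fun n => \int[mu]_(x in K) ((h x - \sum_(j < n) u j x) ^+ 2)%:E)%E @ \oo
    --> 0%E.

(* The pair (lam j, Phi j), for j = 0, 1, ..., is the (j+1)-st eigenpair. *)
Definition dirichlet_eigenbasis p K (mu : {measure set (R * R) -> \bar R})
    (lam : nat -> R) (Phi : nat -> R * R -> R) :=
  [/\ 0 < lam 0%N,
      {homo lam : i j / (i <= j)%N >-> i <= j},
      forall j, dirichlet_laplacian p K mu (Phi j) (fun x => - lam j * Phi j x),
      forall i j, inner K mu (Phi i) (Phi j) = (i == j)%:R
    & forall f, L2 K mu f ->
        L2_sum K mu (fun j x => inner K mu (Phi j) f * Phi j x) f].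

Section spectral.
Context (p : 'I_3 -> R * R) (K : set (R * R))
        (mu : {measure set (R * R) -> \bar R})
        (lam : nat -> R) (Phi : nat -> R * R -> R).

(* [spectral_calculus phi f] is a representative of phi(-Δ) f, that is, of the L2 sum of
   the series of general term phi(lam j) <Phi j, f> Phi j. *)
Definition spectral_calculus (phi : R -> R) f : R * R -> R :=
  xget (cst 0)
    [set h | L2_sum K mu
               (fun j x => phi (lam j) * inner K mu (Phi j) f * Phi j x) h].

Definition neg_power (s : R) : (R * R -> R) -> R * R -> R :=
  spectral_calculus (fun l => l `^ (- s)).

Definition heat_semigroup (t : R) : (R * R -> R) -> R * R -> R :=
  spectral_calculus (fun l => expR (- (t * l))).

Definition test_functions : set (R * R -> R) :=
  [set f : R * R -> R | [/\ {within K, continuous f}, forall i, f (p i) = 0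
     & forall k : nat,
         (fun n => n.+1%:R ^+ k * `|inner K mu (Phi n) f|) @ \oo --> (0 : R)]].

Definition heat_kernel (pt : R -> R * R -> R * R -> R) :=
  forall t, 0 < t ->
    {within K `*` K, continuous (fun z => pt t z.1 z.2)} /\
    forall f, L2 K mu f ->
      {ae mu, forall x, K x ->
        \int[mu]_(y in K) (pt t x y * f y) = heat_semigroup t f x}.

End spectral.

Definition euler_gamma (s : R) : R :=
  \int[lebesgue_measure]_(t in `]0, +oo[) (t `^ (s - 1) * expR (- t)).

(* The value on the diagonal, where the integral may diverge, is irrelevant. *)
Definition green (pt : R -> R * R -> R * R -> R) (s : R) (x y : R * R) : R :=
  (euler_gamma s)^-1 *
  \int[lebesgue_measure]_(t in `]0, +oo[) (t `^ (s - 1) * pt t x y).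

End gasket.

Section fields.
Context {R : realType} d (Omega : measurableType d) (P : probability Omega R).

(* Degenerate laws are covered by [dirac], since [normal_prob m 0] is not one. *)
Definition gaussian_rv (X : Omega -> R) :=
  measurable_fun setT X /\
  exists m : R,
    (forall A, measurable A -> P (X @^-1` A) = dirac m A) \/
    exists2 s : R, 0 < s &
      forall A, measurable A -> P (X @^-1` A) = normal_prob m s A.

Definition gaussian_field (I : Type) (D : set I) (X : I -> Omega -> R) :=
  forall (n : nat) (t : 'I_n -> I) (c : 'I_n -> R), (forall k, D (t k)) ->
    gaussian_rv (fun w => \sum_(k < n) c k * X (t k) w).

Definition centered_gaussian_field (I : Type) (D : set I)
    (X : I -> Omega -> R) :=
  gaussian_field D X /\ forall i, D i -> ('E_P[X i] = 0)%E.

Definition white_noise K (mu : {measure set (R * R) -> \bar R})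
    (W : (R * R -> R) -> Omega -> R) :=
  [/\ centered_gaussian_field (L2 K mu) W,
      forall (a b : R) f g, L2 K mu f -> L2 K mu g ->
        {ae P, forall w,
          W (fun x => a * f x + b * g x) w = a * W f w + b * W g w}
    & forall f g, L2 K mu f -> L2 K mu g ->
        ('E_P[(fun w => W f w * W g w)%R] = (inner K mu f g)%:E)%E].

Definition fractional_gaussian_field p K
    (mu : {measure set (R * R) -> \bar R})
    (lam : nat -> R) (Phi : nat -> R * R -> R) (s : R)
    (X : (R * R -> R) -> Omega -> R) :=
  centered_gaussian_field (test_functions p K mu Phi) X /\
  forall f g, test_functions p K mu Phi f -> test_functions p K mu Phi g ->
    ('E_P[(fun w => X f w * X g w)%R] =
     (inner K mu (neg_power K mu lam Phi s f)
                 (neg_power K mu lam Phi s g))%:E)%E.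

Definition jointly_measurable (K : set (R * R)) (X : R * R -> Omega -> R) :=
  measurable_fun (K `*` [set: Omega]) (fun z => X z.1 z.2).

(* [X] is a jointly measurable version of x |-> \int_K G_s(x, y) W(dy). *)
Definition green_field_version K (pt : R -> R * R -> R * R -> R) (s : R)
    (W : (R * R -> R) -> Omega -> R) (X : R * R -> Omega -> R) :=
  jointly_measurable K X /\
  forall x, K x -> {ae P, forall w, X x w = W (green pt s x) w}.

Definition integrated_field K (mu : {measure set (R * R) -> \bar R})
    (X : R * R -> Omega -> R) (f : R * R -> R) (w : Omega) : R :=
  \int[mu]_(x in K) (f x * X x w).

End fields.

(* Main.v *)
(* Since each map f_i contracts distances by 2, mass by 3 and energy by 3/5, the
   oscillation of a function on a cell of generation n is controlled by its
   energy there, which gives a Poincare inequality with constant 5^-n for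
   functions vanishing at one vertex of each of the 3^n cells; conversely the
   first eigenfunction can be copied into each cell. By min-max, lam_(3^n) is
   comparable to 5^n, and sum_j lam_j^(-2s) is finite iff 3 < 5^(2s), that is iff
   s > d_h / (2 d_w).

   (ii) Testing the field against Phi_j shows that E(<Y, Phi_j>^2) = lam_j^(-2s), so by
   Bessel's inequality the sum over j is at most E(int Y^2), hence finite.

   (i) For almost every x, G_s(x, .) is square integrable with coefficients
   lam_j^(-s) Phi_j(x). The partial sums of sum_j lam_j^(-s) Phi_j(x) W(Phi_j) thus converge
   to X_s in L2(P x mu), with squared error the tail of sum_j lam_j^(-2s);
   integrating against f gives X_s(f) = W((-Delta)^(-s) f) almost surely, and the
   law of the right-hand side is the one of the FGF. *)

Require Import Defs.
From HB Require Import structures.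
From mathcomp Require Import all_boot all_order all_algebra.
From mathcomp Require Import all_classical all_reals all_analysis.
From mathcomp Require Import measurable_realfun ring lra.

Set Implicit Arguments.
Unset Strict Implicit.
Unset Printing Implicit Defensive.
Import Order.TTheory GRing.Theory Num.Theory.
Import numFieldNormedType.Exports.
Local Open Scope classical_set_scope.
Local Open Scope ring_scope.

Local Notation o0 := (ord0 : 'I_3).
Local Notation o1 := (lift ord0 ord0 : 'I_3).
Local Notation o2 := (lift ord0 (lift ord0 ord0) : 'I_3).

(** What shapes the treatment of the Green function is that the available sup bound, Phi_j(x)^2 at
    most 24 lam_j, costs a full power of the eigenvalue: used pointwise on lam_j^(-2s) Phi_j(x)^2,
    it would give convergence only for s above the critical value plus 1/2. Integration in x costs
    nothing, since the eigenfunctions are normalized; hence the sharp condition gives finiteness for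
    almost every x. The sup bound serves where coefficients decay fast enough to absorb powers of
    lam_j, as in the heat kernel. That kernel is given only as a continuous kernel of the semigroup,
    so its eigenfunction expansion has to be proved; the terms have no fixed sign, and absolute
    convergence of the time integral comes from a weighted Cauchy-Schwarz inequality that spends the
    gap between s and the critical exponent. Copying a function into cells is consistent because
    distinct cells of one generation meet only at vertices, where the function vanishes. The measure
    is known through the masses of cells, so norms are compared with sums of indicators of cells. *)

Lemma ord3P (P : 'I_3 -> Prop) : P o0 -> P o1 -> P o2 -> forall i, P i.
Proof.
move=> P0 P1 P2 [[|[|[|//]]] h].
- by rewrite (_ : Ordinal h = o0) //; apply: val_inj.
- by rewrite (_ : Ordinal h = o1) //; apply: val_inj.
- by rewrite (_ : Ordinal h = o2) //; apply: val_inj.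
Qed.

Lemma big_ord3 (V : nmodType) (F : 'I_3 -> V) :
  \sum_(i < 3) F i = F o0 + F o1 + F o2.
Proof. by rewrite !big_ord_recl big_ord0 addr0 addrA. Qed.

(** * Geometry of the gasket *)

Section geometry.
Context {R : realType}.
Implicit Types (p : 'I_3 -> R * R) (K : set (R * R)) (z : R * R).

(** With [c] the centroid of a triangle of side 1, the vectors p_i - c have squared length 1/3 and
    mutual inner products -1/6; the affine function 1/3 + 2 <z - c, p_i - c> is therefore 1 at p_i
    and 0 at the other two vertices. *)
Definition barycentric p (i : 'I_3) z : R :=
  let c := (3^-1 * (\sum_j (p j).1), 3^-1 * (\sum_j (p j).2)) in
  3^-1 + 2 * ((z.1 - c.1) * ((p i).1 - c.1) + (z.2 - c.2) * ((p i).2 - c.2)).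

Lemma gasket_mapE p i z :
  gasket_map p i z = (2^-1 * (z.1 + (p i).1), 2^-1 * (z.2 + (p i).2)).
Proof.
rewrite /gasket_map; case: z => x y; case: (p i) => a b /=.
congr pair.
  by rewrite (_ : (2^-1 *: ((x, y) - (a, b))).1 = 2^-1 * (x - a)) //=; lra.
by rewrite (_ : (2^-1 *: ((x, y) - (a, b))).2 = 2^-1 * (y - b)) //=; lra.
Qed.

Lemma gasket_map_inj p i : injective (gasket_map p i).
Proof.
move=> [x y] [x' y']; rewrite !gasket_mapE /= => -[h1 h2].
by congr pair; lra.
Qed.

Lemma gasket_mapC p i j : gasket_map p i (p j) = gasket_map p j (p i).
Proof. by rewrite !gasket_mapE [(p j).1 + _]addrC [(p j).2 + _]addrC. Qed.

Lemma gasket_map_fix p i : gasket_map p i (p i) = p i.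
Proof. by rewrite gasket_mapE; case: (p i) => a b /=; congr pair; lra. Qed.

Lemma word_map_inj p w : injective (word_map p w).
Proof.
by elim: w => [//|i w IH] x y /= /gasket_map_inj /IH.
Qed.

Lemma word_map_cat p v w z :
  word_map p (v ++ w) z = word_map p v (word_map p w z).
Proof. by elim: v => //= j v ->. Qed.

Lemma word_map_dist p w z z' :
  word_map p w z - word_map p w z' = (2^-1) ^+ size w *: (z - z').
Proof.
elim: w => [|i w IH] /=; first by rewrite expr0 scale1r.
by rewrite /gasket_map opprD addrACA subrr addr0 -scalerBr opprB addrA subrK
  IH scalerA -exprS.
Qed.

Lemma continuous_gasket_map p i : continuous (gasket_map p i).
Proof.
move=> z; apply: cvgD; last exact: cvg_cst.
by apply: cvgZr; apply: cvgB; [exact: cvg_id|exact: cvg_cst].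
Qed.

Lemma continuous_word_map p w : continuous (word_map p w).
Proof.
elim: w => [|i w IH] z /=; first exact: cvg_id.
by apply: continuous_comp; [exact: IH|exact: continuous_gasket_map].
Qed.

Section barycentric_coordinates.
Context (p : 'I_3 -> R * R).
Hypothesis eqp : unit_equilateral p.
Local Notation b := (barycentric p).

Lemma barycentric_map i j z :
  b i (gasket_map p j z) = 2^-1 * (b i z + b i (p j)).
Proof. by rewrite /barycentric gasket_mapE /= !big_ord3 /=; field. Qed.

Lemma barycentric_vertex i j : b i (p j) = (i == j)%:R.
Proof.
have e01 := eqp (isT : o0 != o1); have e02 := eqp (isT : o0 != o2).
have e12 := eqp (isT : o1 != o2); rewrite /barycentric !big_ord3 /=.
by elim/ord3P: i; elim/ord3P: j => /=; nra.
Qed.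

Lemma barycentric_mapE i j z :
  b i (gasket_map p j z) = 2^-1 * (b i z + (i == j)%:R).
Proof. by rewrite barycentric_map barycentric_vertex. Qed.

Lemma sum_barycentric z : b o0 z + b o1 z + b o2 z = 1.
Proof. by rewrite /barycentric !big_ord3 /=; field. Qed.

Lemma barycentric_inj z z' : (forall i, b i z = b i z') -> z = z'.
Proof.
move=> h; have := h o0; have := h o1; have := h o2.
rewrite /barycentric /=; set c1 := 3^-1 * _; set c2 := 3^-1 * _ => h2 h1 h0.
pose a1 := (p o1).1 - (p o0).1; pose a2 := (p o1).2 - (p o0).2.
pose b1 := (p o2).1 - (p o0).1; pose b2 := (p o2).2 - (p o0).2.
pose v1 := z.1 - z'.1; pose v2 := z.2 - z'.2.
have ha : v1 * a1 + v2 * a2 = 0 by rewrite /v1 /v2 /a1 /a2; nra.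
have hb : v1 * b1 + v2 * b2 = 0 by rewrite /v1 /v2 /b1 /b2; nra.
have e01 := eqp (isT : o1 != o0); have e02 := eqp (isT : o2 != o0).
have e12 := eqp (isT : o1 != o2).
have ab : a1 * b1 + a2 * b2 = 2^-1 by rewrite /a1 /a2 /b1 /b2; nra.
(* By Lagrange's identity this is the Gram determinant 1 * 1 - (1/2)^2 of two edge vectors; being
   nonzero, it makes the linear system for z - z' invertible. *)
have d : (a1 * b2 - a2 * b1) ^+ 2 = 3 / 4.
  have -> : (a1 * b2 - a2 * b1) ^+ 2 =
      (a1 ^+ 2 + a2 ^+ 2) * (b1 ^+ 2 + b2 ^+ 2) - (a1 * b1 + a2 * b2) ^+ 2.
    by ring.
  by rewrite ab e01 e02; lra.
have d0 : a1 * b2 - a2 * b1 != 0.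
  by apply/eqP => d0; move: d; rewrite d0; lra.
have w1 : v1 * (a1 * b2 - a2 * b1) = 0.
  have -> : v1 * (a1 * b2 - a2 * b1) =
    b2 * (v1 * a1 + v2 * a2) - a2 * (v1 * b1 + v2 * b2) by ring.
  by rewrite ha hb; ring.
have w2 : v2 * (a1 * b2 - a2 * b1) = 0.
  have -> : v2 * (a1 * b2 - a2 * b1) =
    a1 * (v1 * b1 + v2 * b2) - b1 * (v1 * a1 + v2 * a2) by ring.
  by rewrite ha hb; ring.
move/eqP: w1; rewrite mulf_eq0 (negPf d0) orbF subr_eq0 => /eqP w1.
move/eqP: w2; rewrite mulf_eq0 (negPf d0) orbF subr_eq0 => /eqP w2.
by case: z z' w1 w2 {h h0 h1 h2 v1 v2 ha hb} => [? ?] [? ?] /= -> ->.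
Qed.

Lemma vertex_inj : injective p.
Proof.
move=> i j pij; have := barycentric_vertex i j; rewrite -pij.
rewrite barycentric_vertex eqxx; case: eqP => // _ /eqP.
by rewrite oner_eq0.
Qed.

Lemma continuous_barycentric i : continuous (b i).
Proof.
have c1 : continuous (@fst R R) by move=> ?; exact: cvg_fst.
have c2 : continuous (@snd R R) by move=> ?; exact: cvg_snd.
move=> z; rewrite /barycentric /=; apply: cvgD; first exact: cvg_cst.
apply: cvgM; first exact: cvg_cst.
apply: cvgD; (apply: cvgM; last exact: cvg_cst); apply: cvgB;
  try exact: cvg_cst; [exact: c1|exact: c2].
Qed.

Definition triangle : set (R * R) := [set z | forall i, 0 <= b i z].

Lemma triangle_map i z : triangle z -> triangle (gasket_map p i z).
Proof.
move=> tz j; rewrite barycentric_mapE; apply: mulr_ge0.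
  by rewrite invr_ge0.
by apply: addr_ge0; [exact: tz|exact: ler0n].
Qed.

Lemma triangle_vertex i : triangle (p i).
Proof. by move=> j; rewrite barycentric_vertex ler0n. Qed.

(** In the i-th half-size triangle the i-th coordinate is at least 1/2. A point common to the i-th
    and the j-th has both coordinates at least 1/2, so it is the midpoint of the edge from p_i to
    p_j. *)
Lemma triangle_overlap i j z z' : i != j -> triangle z -> triangle z' ->
  gasket_map p i z = gasket_map p j z' -> z = p j /\ z' = p i.
Proof.
move=> ij tz tz' e.
have E k : b k z + (k == i)%:R = b k z' + (k == j)%:R.
  by have := congr1 (b k) e; rewrite !barycentric_mapE; lra.
have sz := sum_barycentric z; have sz' := sum_barycentric z'.
have [[E0 E1] E2] := (E o0, E o1, E o2).
have [[tz0 tz1] tz2] := (tz o0, tz o1, tz o2).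
have [[tz'0 tz'1] tz'2] := (tz' o0, tz' o1, tz' o2).
by split; apply: barycentric_inj => k; rewrite barycentric_vertex;
  move: ij E0 E1 E2; elim/ord3P: i {e E}; elim/ord3P: j; elim/ord3P: k => //=;
  lra.
Qed.

(** The j-th coordinate is 1 at p_j, whereas it is at most 1/2 on the i-th half-size triangle when i
    differs from j. *)
Lemma triangle_map_vertex i j z : triangle z ->
  gasket_map p i z = p j -> i = j /\ z = p j.
Proof.
move=> tz e; have E := congr1 (b j) e.
have ij : i = j.
  move: E; rewrite barycentric_mapE barycentric_vertex eqxx.
  case: eqP => [//|_ E]; exfalso; have sz := sum_barycentric z.
  have [[tz0 tz1] tz2] := (tz o0, tz o1, tz o2).
  by move: E; elim/ord3P: j {e} => /=; lra.
split=> //; apply: (@gasket_map_inj p j).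
by rewrite gasket_map_fix -{1}ij.
Qed.

Lemma triangle_word_vertex w j z : triangle z ->
  word_map p w z = p j -> z = p j.
Proof.
move=> tz; have tw v : triangle (word_map p v z).
  by elim: v => //= i v; exact: triangle_map.
by elim: w => //= i w IH /triangle_map_vertex [//|_ /IH].
Qed.

End barycentric_coordinates.

Section gasket_set.
Context (p : 'I_3 -> R * R) (K : set (R * R)).
Hypotheses (eqp : unit_equilateral p) (hK : sierpinski_gasket p K).

Lemma gasket_mapK i z : K z -> K (gasket_map p i z).
Proof. by case: hK => _ _ {2}-> Kz; exists i => //; exists z. Qed.

Lemma word_mapK w z : K z -> K (word_map p w z).
Proof. by elim: w => //= i w IH /IH; exact: gasket_mapK. Qed.

Lemma gasket_split z : K z -> exists i, exists2 z', K z' & z = gasket_map p i z'.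
Proof. by case: hK => _ _ {1}-> [i _ [z' Kz' <-]]; exists i, z'. Qed.

Lemma gasket_closed : closed K.
Proof. by case: hK => _ cK _; exact: compact_closed. Qed.

Lemma gasket_bounded : exists2 M : R, 0 < M &
  forall z z', K z -> K z' -> `|z - z'| <= M.
Proof.
case: hK => _ /compact_bounded [M [Mr HM]] _.
have H z : K z -> `|z| <= `|M| + 1.
  by move=> Kz; apply: HM => //; rewrite (le_lt_trans (ler_norm M))// ltrDl.
exists ((`|M| + 1) + (`|M| + 1)).
  by rewrite addr_gt0// ltr_wpDl.
move=> z z' Kz Kz'; apply: le_trans (ler_normB _ _) _.
by rewrite lerD // H.
Qed.

Lemma word_map_small (e : R) : 0 < e -> exists n, forall w, (n <= size w)%N ->
  forall z z', K z -> K z' -> `|word_map p w z - word_map p w z'| < e.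
Proof.
move=> e0; have [M M0 HM] := gasket_bounded.
have h : `|2^-1 : R| < 1 by rewrite ger0_norm ?invr_ge0// invf_lt1// ltr1n.
have /cvgrPdist_lt := cvg_geometric M h.
move=> /(_ e e0) [n _ Hn]; exists n => w nw z z' Kz Kz'.
rewrite word_map_dist normrZ; apply: le_lt_trans (Hn (size w) nw).
rewrite sub0r normrN /geometric /= normrM mulrC [`|M|]gtr0_norm//.
by rewrite ler_pM2r ?HM// normr_gt0 expf_neq0// invr_neq0.
Qed.

Lemma gasket_word n z : K z ->
  exists2 w : n.-tuple 'I_3, True & exists2 z', K z' & z = word_map p w z'.
Proof.
elim: n z => [|n IH] z Kz; first by exists [tuple] => //; exists z.
have [i [z1 Kz1 ->]] := gasket_split Kz.
have [w _ [z2 Kz2 ->]] := IH _ Kz1.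
by exists [tuple of i :: w] => //; exists z2.
Qed.

(** K is known only as a compact fixed point, so p_i is reached as the limit of the iterates of the
    i-th map at an arbitrary point of K. *)
Lemma gasket_vertex i : K (p i).
Proof.
apply/gasket_closed => B /nbhs_ballP[e /= e0 eB].
have [[z0 Kz0] _ _] := hK.
have [M M0 HM] := gasket_bounded.
have h : `|2^-1 : R| < 1 by rewrite ger0_norm ?invr_ge0// invf_lt1// ltr1n.
have pn n : word_map p (nseq n i) (p i) = p i.
  by elim: n => //= n ->; exact: gasket_map_fix.
have /cvgrPdist_lt := cvg_geometric (`|p i - z0|) h.
move=> /(_ e e0) [n _ /(_ n (leqnn n)) Hn].
exists (word_map p (nseq n i) z0); split; first exact: word_mapK.
apply: eB; rewrite -ball_normE /ball_/=.
rewrite -{1}(pn n) word_map_dist normrZ size_nseq.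
move: Hn; rewrite sub0r normrN /geometric /= normrM normr_id.
by rewrite mulrC.
Qed.

(** Let m be the minimum of a barycentric coordinate over K. The minimizer is the image of a point
    of K under one of the maps, hence m >= m / 2, that is m >= 0. *)
Lemma gasket_triangle : K `<=` triangle p.
Proof.
have [K0 cK _] := hK => z Kz i.
have cb : {within K, continuous (barycentric p i)}.
  by apply: continuous_subspaceT => x; exact: continuous_barycentric.
have [c Kc cmin] : exists2 c, c \in K &
    forall t, t \in K -> barycentric p i c <= barycentric p i t.
  exact: compact_EVT_min.
have c0 : 0 <= barycentric p i c.
  move: Kc; rewrite inE => /gasket_split[j [c' Kc' e]].
  have := cmin c' (mem_set Kc').
  have : (0 : R) <= (i == j)%:R by rewrite ler0n.
  have := congr1 (barycentric p i) e; rewrite barycentric_mapE//.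
  by lra.
by apply: le_trans c0 (cmin _ _); rewrite inE.
Qed.

(** Equal first letters are stripped by injectivity; at the first difference the common point is a
    vertex of both half-size pieces, and a preimage of a vertex under a word map is again a
    vertex. *)
Lemma cell_overlap n (v w : n.-tuple 'I_3) z z' : v != w -> K z -> K z' ->
  word_map p v z = word_map p w z' ->
  (exists i, z = p i) /\ (exists i, z' = p i).
Proof.
elim: n v w z z' => [|n IH] v w z z'.
  by rewrite (tuple0 v) (tuple0 w) eqxx.
case/tupleP: v => i v; case/tupleP: w => j w vw Kz Kz' /= e.
have tv := gasket_triangle (word_mapK v Kz).
have tw := gasket_triangle (word_mapK w Kz').
have [ij|ij] := eqVneq i j; last first.
  have [e1 e2] := triangle_overlap eqp ij tv tw e.
  split; [exists j|exists i].
    exact: triangle_word_vertex (gasket_triangle Kz) e1.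
  exact: triangle_word_vertex (gasket_triangle Kz') e2.
move: e; rewrite ij => /gasket_map_inj; apply: IH => //.
by apply: contraNneq vw => ->; rewrite ij.
Qed.

End gasket_set.
End geometry.

(** * The energy form *)

Section energy_sums.
Context {R : realType}.
Implicit Types (p : 'I_3 -> R * R) (f g h : R * R -> R).

Definition vertex_energy p f g : R :=
  (f (p o0) - f (p o1)) * (g (p o0) - g (p o1)) +
  (f (p o0) - f (p o2)) * (g (p o0) - g (p o2)) +
  (f (p o1) - f (p o2)) * (g (p o1) - g (p o2)).

Definition cell_sum p (m : nat) f g : R :=
  \sum_(w : m.-tuple 'I_3) vertex_energy p (f \o word_map p w) (g \o word_map p w).

Lemma vertex_energy_oriented p f g :
  vertex_energy p f g = 2^-1 * \sum_(t : 'I_3 * 'I_3 | t.1 != t.2)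
     (f (p t.1) - f (p t.2)) * (g (p t.1) - g (p t.2)).
Proof.
rewrite (eq_bigl (fun t : 'I_3 * 'I_3 => xpredT t.1 && (t.1 != t.2))) //.
rewrite -(pair_big_dep xpredT (fun i j : 'I_3 => i != j) (fun i j =>
  (f (p i) - f (p j)) * (g (p i) - g (p j)))) /=.
under eq_bigr do rewrite big_mkcond big_ord3.
by rewrite big_ord3 /= /vertex_energy; field.
Qed.

Lemma vertices_word_map p m (w : m.-tuple 'I_3) i :
  vertices p m (word_map p w (p i)).
Proof.
elim: m w => [|m IH] w; first by rewrite (tuple0 w); exists i.
case/tupleP: w => j w /=; exists j => //.
by exists (word_map p w (p i)).
Qed.

(** Two distinct cells share at most one point, so the two ends of an edge determine its cell.
    Summing over cells thus counts each edge once. *)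
Lemma cell_edge_inj p m (v w : m.-tuple 'I_3) i i' j j' :
  unit_equilateral p -> i != j ->
  word_map p v (p i) = word_map p w (p i') ->
  word_map p v (p j) = word_map p w (p j') -> v = w.
Proof.
move=> eqp ij; elim: m v w => [|m IH] v w.
  by rewrite (tuple0 v) (tuple0 w).
have tw (u : seq 'I_3) k : triangle p (word_map p u (p k)).
  elim: u => [|k' u IHu] /=; first exact: triangle_vertex.
  exact: triangle_map.
case/tupleP: v => a v; case/tupleP: w => b w /= e1 e2.
have [ab|ab] := eqVneq a b; last first.
  have [e3 _] := triangle_overlap eqp ab (tw _ _) (tw _ _) e1.
  have [e4 _] := triangle_overlap eqp ab (tw _ _) (tw _ _) e2.
  have /word_map_inj/(vertex_inj eqp) e5 :
    word_map p v (p i) = word_map p v (p j) by rewrite e3 e4.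
  by move: ij; rewrite e5 eqxx.
subst b; congr [tuple of _ :: _]; apply: IH.
  exact: gasket_map_inj e1.
exact: gasket_map_inj e2.
Qed.

Lemma sum_oriented_edges p m (F : (R * R) * (R * R) -> R) :
  unit_equilateral p ->
  \sum_(e \in oriented_edges p m) F e =
  \sum_(w : m.-tuple 'I_3) \sum_(t : 'I_3 * 'I_3 | t.1 != t.2)
     F (word_map p w (p t.1), word_map p w (p t.2)).
Proof.
move=> eqp.
pose G (t : m.-tuple 'I_3 * ('I_3 * 'I_3)) :=
  (word_map p t.1 (p t.2.1), word_map p t.1 (p t.2.2)).
pose A := [pred t : m.-tuple 'I_3 * ('I_3 * 'I_3) | t.2.1 != t.2.2].
pose r := [seq G t | t <- enum A].
have Er : oriented_edges p m = [set` r].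
  apply/seteqP; split=> [[x y] [/= _ _ [xy [w [[_ [i _ <-]] e1 [_ [j _ <-]] e2]]]]|].
    apply/mapP; exists (w, (i, j)); last by rewrite /G /= e1 e2.
    rewrite mem_enum inE /=; apply: contra_notN xy => /eqP ij.
    by rewrite -e1 -e2 ij.
  move=> e /mapP[[w [i j]]]; rewrite mem_enum inE /= => ij -> /=.
  split; [exact: vertices_word_map|exact: vertices_word_map|split].
    by move=> /word_map_inj/(vertex_inj eqp) /= e'; rewrite e' eqxx in ij.
  by exists w; split; [exists (p i)|exists (p j)] => //; eexists.
have ur : uniq r.
  rewrite map_inj_in_uniq ?enum_uniq //.
  move=> [v [i j]] [w [i' j']]; rewrite !mem_enum !inE /= => ij ij' [e1 e2].
  have vw := cell_edge_inj eqp ij e1 e2; subst w.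
  move/word_map_inj/(vertex_inj eqp) : e1 => ->.
  by move/word_map_inj/(vertex_inj eqp) : e2 => ->.
rewrite Er -fsbig_seq // big_map big_enum /= pair_big_dep /=.
by apply: eq_big => [[]|[]].
Qed.

(** The constant is 5^m / (3^(m+1) / 2); the factor 1/2 for orientation is absorbed cell by cell. In
    this form the renormalization 5/3 per level is explicit. *)
Lemma graph_energyE p m f g : unit_equilateral p ->
  graph_energy p m f g = 2 / 3 * (5 / 3) ^+ m * cell_sum p m f g.
Proof.
move=> eqp; rewrite /graph_energy sum_oriented_edges //.
rewrite mulr_sumr -[X in _ = _ * X]/(\sum_(w : m.-tuple 'I_3) _).
under [in RHS]eq_bigr do rewrite vertex_energy_oriented.
congr (_ * _); rewrite exprS expr_div_n.
have : 3 ^+ m != 0 :> R by rewrite expf_neq0.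
by move: (3 ^+ m) (5 ^+ m) => a b a0; field.
Qed.

Lemma big_tupleS (n : nat) (F : n.+1.-tuple 'I_3 -> R) :
  \sum_(w : n.+1.-tuple 'I_3) F w =
  \sum_(i < 3) \sum_(w : n.-tuple 'I_3) F [tuple of i :: w].
Proof.
rewrite pair_big /=.
rewrite (reindex (fun iw : 'I_3 * n.-tuple 'I_3 => [tuple of iw.1 :: iw.2])) //=.
exists (fun w : n.+1.-tuple 'I_3 => (thead w, [tuple of behead w])).
  move=> [i w] _ /=; congr pair; exact: val_inj.
by move=> w _ /=; rewrite -tuple_eta.
Qed.

Lemma cell_sum0 p f g : cell_sum p 0 f g = vertex_energy p f g.
Proof.
rewrite /cell_sum (big_pred1 [tuple]) //= => w.
exact/esym/eqP/tuple0.
Qed.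

Lemma cell_sumS p m f g : cell_sum p m.+1 f g =
  \sum_(i < 3) cell_sum p m (f \o gasket_map p i) (g \o gasket_map p i).
Proof. by rewrite /cell_sum big_tupleS. Qed.

Lemma cell_sumD p n m f g : cell_sum p (n + m) f g =
  \sum_(w : n.-tuple 'I_3) cell_sum p m (f \o word_map p w) (g \o word_map p w).
Proof.
elim: n f g => [|n IH] f g.
  by rewrite (big_pred1 [tuple]) //= => w; exact/esym/eqP/tuple0.
rewrite addSn cell_sumS big_tupleS; apply: eq_bigr => i _.
by rewrite IH.
Qed.

Lemma cell_sum_linear p m a f g h :
  cell_sum p m (fun x => a * f x + g x) h =
  a * cell_sum p m f h + cell_sum p m g h.
Proof.
rewrite /cell_sum mulr_sumr -big_split /=; apply: eq_bigr => w _.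
by rewrite /vertex_energy /=; ring.
Qed.

Lemma cell_sumC p m f g : cell_sum p m f g = cell_sum p m g f.
Proof.
by rewrite /cell_sum; apply: eq_bigr => w _; rewrite /vertex_energy; ring.
Qed.

Lemma vertex_energy_ge0 p f : 0 <= vertex_energy p f f.
Proof. by rewrite /vertex_energy !addr_ge0 // -expr2 sqr_ge0. Qed.

Lemma cell_sum_ge0 p m f : 0 <= cell_sum p m f f.
Proof. by apply: sumr_ge0 => w _; exact: vertex_energy_ge0. Qed.

Lemma eq_cell_sum p (K : set (R * R)) m f f' g g' :
  unit_equilateral p -> sierpinski_gasket p K ->
  (forall x, K x -> f x = f' x) -> (forall x, K x -> g x = g' x) ->
  cell_sum p m f g = cell_sum p m f' g'.
Proof.
move=> eqp hK ff' gg'; apply: eq_bigr => w _; rewrite /vertex_energy /=.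
have Kw i : K (word_map p w (p i)) by apply: (word_mapK hK); exact: (gasket_vertex hK).
by rewrite !ff' // !gg'.
Qed.

(* The values x, y, z at the midpoints minimizing the sum of the energies of
   the three half-size triangles are (a + 2 b + 2 c) / 5 and its permutations,
   and the minimum is 3/5 of the energy of (a, b, c). *)
Lemma vertex_energy_split p f :
  vertex_energy p f f <= 5 / 3 * cell_sum p 1 f f.
Proof.
rewrite cell_sumS big_ord3 !cell_sum0 /vertex_energy /= !gasket_map_fix.
rewrite (gasket_mapC p o1 o0) (gasket_mapC p o2 o0) (gasket_mapC p o2 o1).
move: (f (p o0)) (f (p o1)) (f (p o2)) (f (gasket_map p o0 (p o1)))
  (f (gasket_map p o0 (p o2))) (f (gasket_map p o1 (p o2))) => a b c z y x.
pose X := x - (a + 2 * b + 2 * c) / 5.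
pose Y := y - (2 * a + b + 2 * c) / 5.
pose Z := z - (2 * a + 2 * b + c) / 5.
rewrite -subr_ge0; set L := (X in 0 <= X).
have -> : L = 5 / 3 * (2 * X ^+ 2 + 2 * Y ^+ 2 + 2 * Z ^+ 2 +
    (X - Y) ^+ 2 + (X - Z) ^+ 2 + (Y - Z) ^+ 2).
  by rewrite /L /X /Y /Z; field.
have := sqr_ge0 X; have := sqr_ge0 Y; have := sqr_ge0 Z.
have := sqr_ge0 (X - Y); have := sqr_ge0 (X - Z); have := sqr_ge0 (Y - Z).
by lra.
Qed.

Lemma cell_sum_scaleS p m f :
  (5 / 3) ^+ m * cell_sum p m f f <= (5 / 3) ^+ m.+1 * cell_sum p m.+1 f f.
Proof.
rewrite exprSr -mulrA ler_pM2l ?exprn_gt0 ?divr_gt0//.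
rewrite -(addn1 m) cell_sumD.
rewrite mulr_sumr; apply: ler_sum => w _; exact: vertex_energy_split.
Qed.

Lemma cell_sum_scale p m n f : (m <= n)%N ->
  (5 / 3) ^+ m * cell_sum p m f f <= (5 / 3) ^+ n * cell_sum p n f f.
Proof.
move=> /subnK <-; elim: (n - m)%N => //= k IH; apply: le_trans IH _.
by rewrite addSn cell_sum_scaleS.
Qed.

End energy_sums.

Section energy_limits.
Context {R : realType} (p : 'I_3 -> R * R) (K : set (R * R)).
Hypothesis (eqp : unit_equilateral p).
Implicit Types f g h : R * R -> R.
Local Notation D := (dirichlet_domain p K).

Lemma graph_energy_ge0 m f : 0 <= graph_energy p m f f.
Proof.
by rewrite graph_energyE // mulr_ge0 ?cell_sum_ge0.
Qed.

Lemma graph_energy_nondecreasing f :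
  nondecreasing_seq (fun m => graph_energy p m f f).
Proof.
move=> m n mn; rewrite !graph_energyE // -!(mulrA (2 / 3)).
by rewrite ler_pM2l ?divr_gt0//; exact: cell_sum_scale.
Qed.

Lemma energyP f :
  (energy p f < +oo)%E <-> exists M, forall m, graph_energy p m f f <= M.
Proof.
have nd : nondecreasing_seq (fun m => (graph_energy p m f f)%:E).
  by move=> m n mn; rewrite lee_fin; exact: graph_energy_nondecreasing.
have lE := cvg_lim (@ereal_hausdorff R) (ereal_nondecreasing_cvgn nd).
rewrite /energy lE; split=> [h|[M HM]]; last first.
  apply: le_lt_trans (ltry M); apply: ge_ereal_sup => _ [m _ <-].
  by rewrite lee_fin.
exists (fine (ereal_sup (range (fun m => (graph_energy p m f f)%:E)))) => m.
have ub : ((graph_energy p m f f)%:E <=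
    ereal_sup (range (fun m => (graph_energy p m f f)%:E)))%E.
  by apply: ereal_sup_ubound; exists m.
rewrite -lee_fin fineK // fin_numElt h andbT.
by apply: lt_le_trans ub; rewrite ltNyr.
Qed.

(** Polarization reduces the claim to quadratic energies, which are monotone. That of f + g is
    bounded by the parallelogram law, through the nonnegative energy of f - g. *)
Lemma cvg_graph_energy f g : D f -> D g ->
  (fun m => graph_energy p m f g) @ \oo --> energy_form p f g.
Proof.
suff H : D f -> D g -> cvgn (fun m => graph_energy p m f g) by [].
have C h : (exists M, forall m, graph_energy p m h h <= M) ->
    cvgn (fun m => graph_energy p m h h).
  move=> [M HM]; apply: nondecreasing_is_cvgn.
    exact: graph_energy_nondecreasing.
  by exists M => _ [m _ <-].
move=> [_ /energyP [M HM] _] [_ /energyP [N HN] _].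
have Cs : cvgn (fun m => graph_energy p m (fun x => 1 * f x + g x)
                                       (fun x => 1 * f x + g x)).
  apply: C; exists (2 * M + 2 * N) => m; have := HM m; have := HN m.
  have := graph_energy_ge0 m (fun x => (-1) * g x + f x).
  rewrite !graph_energyE // !(cell_sum_linear, cell_sumC _ _ _ (fun=> _ + _)).
  rewrite (cell_sumC p m g f); lra.
have -> : (fun m => graph_energy p m f g) = (fun m => 2^-1 *
    (graph_energy p m (fun x => 1 * f x + g x) (fun x => 1 * f x + g x)
     - graph_energy p m f f - graph_energy p m g g)).
  apply/funext => m; rewrite !graph_energyE //.
  rewrite !(cell_sum_linear, cell_sumC _ _ _ (fun=> _ + _)).
  by rewrite (cell_sumC p m g f); field.
apply: is_cvgMr; apply: is_cvgB; first apply: is_cvgB => //.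
  by apply: C; exists M.
by apply: C; exists N.
Qed.

Lemma dirichlet_domain_linear a f g : D f -> D g -> D (fun x => a * f x + g x).
Proof.
move=> [cf /energyP [M HM] f0] [cg /energyP [N HN] g0]; split.
- by move=> x; apply: cvgD; [apply: cvgMr; exact: cf|exact: cg].
- apply/energyP; exists (2 * (a ^+ 2 * M) + 2 * N) => m.
  have := HM m; have := HN m; have := sqr_ge0 a.
  (* The energy of g - a f being nonnegative bounds the cross term in the energy of a f + g. *)
  have := graph_energy_ge0 m (fun x => (- a) * f x + g x).
  rewrite !graph_energyE // !(cell_sum_linear, cell_sumC _ _ _ (fun=> _ + _)).
  rewrite (cell_sumC p m g f); set A := cell_sum _ _ f f; set B := cell_sum _ _ f g.
  set C := cell_sum _ _ g g; set c := 2 / 3 * _ => h1 h2 h3 h4.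
  have := ler_wpM2l h2 h4; nra.
- by move=> i; rewrite f0 g0 mulr0 addr0.
Qed.

Lemma dirichlet_domain0 : D (fun=> 0).
Proof.
split=> //; first by move=> x; exact: cvg_cst.
apply/energyP; exists 0 => m; rewrite graph_energyE // /cell_sum big1 ?mulr0//.
by move=> w _; rewrite /vertex_energy /= subrr !mulr0 !addr0.
Qed.

Lemma dirichlet_domain_sum (I : Type) (r : seq I) (c : I -> R)
    (u : I -> R * R -> R) :
  (forall i, D (u i)) -> D (fun x => \sum_(i <- r) c i * u i x).
Proof.
move=> Du; elim: r => [|i r IH].
  have -> : (fun x => \sum_(i <- [::]) c i * u i x) = fun=> 0.
    by apply/funext => x; rewrite big_nil.
  exact: dirichlet_domain0.
have -> : (fun x => \sum_(j <- i :: r) c j * u j x) =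
  fun x => c i * u i x + \sum_(j <- r) c j * u j x.
  by apply/funext => x; rewrite big_cons.
exact: dirichlet_domain_linear.
Qed.

Lemma energy_form_linear a f g h : D f -> D g -> D h ->
  energy_form p (fun x => a * f x + g x) h =
  a * energy_form p f h + energy_form p g h.
Proof.
move=> Df Dg Dh; apply: (cvg_lim (@Rhausdorff R)).
have -> : (fun m => graph_energy p m (fun x => a * f x + g x) h) =
    (fun m => a * graph_energy p m f h + graph_energy p m g h).
  by apply/funext => m; rewrite !graph_energyE// cell_sum_linear; ring.
by apply: cvgD; [apply: cvgMr; exact: cvg_graph_energy Df Dh|
  exact: cvg_graph_energy Dg Dh].
Qed.

Lemma energy_formC f g : energy_form p f g = energy_form p g f.
Proof.
have E : (fun m => graph_energy p m f g) = (fun m => graph_energy p m g f).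
  by apply/funext => m; rewrite !(graph_energyE _ _ _ eqp) cell_sumC.
by rewrite /energy_form E.
Qed.

Lemma energy_form_sum (I : Type) (r : seq I) (c : I -> R)
    (u : I -> R * R -> R) h : (forall i, D (u i)) -> D h ->
  energy_form p (fun x => \sum_(i <- r) c i * u i x) h =
  \sum_(i <- r) c i * energy_form p (u i) h.
Proof.
move=> Du Dh; elim: r => [|i r IH].
  rewrite big_nil; apply: (cvg_lim (@Rhausdorff R)).
  rewrite (_ : (fun m => _) = fun=> 0); first exact: cvg_cst.
  apply/funext => m; rewrite graph_energyE // /cell_sum big1 ?mulr0// => w _.
  by rewrite /vertex_energy /= !big_nil subrr !mul0r !addr0.
have -> : (fun x => \sum_(j <- i :: r) c j * u j x) =
  fun x => c i * u i x + \sum_(j <- r) c j * u j x.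
  by apply/funext => x; rewrite big_cons.
by rewrite (energy_form_linear _ (Du i) (dirichlet_domain_sum r c Du) Dh)
  big_cons IH.
Qed.

Lemma graph_energy_le f m : D f -> graph_energy p m f f <= energy_form p f f.
Proof.
move=> Df; rewrite -(cvg_lim (@Rhausdorff R) (cvg_graph_energy Df Df)).
apply: nondecreasing_cvgn_le; first exact: graph_energy_nondecreasing.
by apply/cvg_ex; eexists; exact: (cvg_graph_energy Df Df).
Qed.

Lemma energy_form_ge0 f : D f -> 0 <= energy_form p f f.
Proof. by move=> Df; apply: le_trans (graph_energy_le 0 Df); exact: graph_energy_ge0. Qed.

End energy_limits.

(** * Square integrable functions *)

Section plane_measurability.
Context {R : realType}.

(** The plane carries the product sigma-algebra, so an open set has to be exhibited as a countable
    union of boxes, here with rational centres and radii 1/(n+1). *)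
Lemma open_measurable_plane (U : set (R * R)) : open U -> measurable U.
Proof.
move=> oU.
pose B (n : nat) (a b : rat) : set (R * R) :=
  ball (ratr a : R) n.+1%:R^-1 `*` ball (ratr b : R) n.+1%:R^-1.
have mB n a b : measurable (B n a b).
  by apply: measurableX; apply: open_measurable; apply: ball_open; rewrite invr_gt0.
have -> : U = \bigcup_n \bigcup_a \bigcup_b (if `[< B n a b `<=` U >] then B n a b else set0).
  apply/seteqP; split => [z Uz|z [n _ [a _ [b _]]]]; last first.
    by case: ifPn => // /asboolP BU /BU.
  have /nbhs_ballP[e /= e0 eU] : nbhs z U by exact: open_nbhs_nbhs.
  (* A box of radius 1/(n+1) around a rational centre that lies within 1/(n+1) of z stays within
     2/(n+1) < e of z. *)
  have [n ne] : exists n : nat, n.+1%:R^-1 < e / 2.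
    have e2 : 0 < e / 2 by rewrite divr_gt0.
    have [n _ Hn] := near_infty_natSinv_lt (PosNum e2).
    by exists n; apply: Hn => /=.
  have r0 : 0 < n.+1%:R^-1 :> R by rewrite invr_gt0.
  have Hq (x : R) : exists q : rat, ball (ratr q : R) n.+1%:R^-1 x.
    have /rat_in_itvoo[q] : x - n.+1%:R^-1 < x + n.+1%:R^-1.
      by rewrite ltrBlDr -addrA ltrDl addr_gt0.
    rewrite in_itv /= => /andP[q1 q2].
    exists q; rewrite /ball /= ltr_distlC; move: q1 q2.
    by move: (n.+1%:R^-1) => r q1 q2; apply/andP; split; lra.
  have [a az] := Hq z.1; have [b bz] := Hq z.2.
  exists n => //; exists a => //; exists b => //.
  clear Hq.
  have BU : B n a b `<=` U.
    move=> y [ya yb]; apply: eU; split.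
      move: az ya; rewrite /ball /= !ltr_distlC => /andP[].
      move: ne; move: (n.+1%:R^-1) => r ne q1 q2 /andP[q3 q4].
      by apply/andP; split; lra.
    move: bz yb; rewrite /ball /= !ltr_distlC => /andP[].
    move: ne; move: (n.+1%:R^-1) => r ne q1 q2 /andP[q3 q4].
    by apply/andP; split; lra.
  by rewrite asboolT.
apply: bigcupT_measurable => n; apply: bigcupT_measurable_rat => a.
by apply: bigcupT_measurable_rat => b; case: ifP.
Qed.

Lemma closed_measurable_plane (A : set (R * R)) : closed A -> measurable A.
Proof. by move/closed_openC/open_measurable_plane/measurableC; rewrite setCK. Qed.

Lemma within_continuous_measurable (A : set (R * R)) (f : R * R -> R) :
  measurable A -> {within A, continuous f} -> measurable_fun A f.
Proof.
move=> mA /continuousP cf; apply: (measurability _ (RGenOpens.measurableE R)).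
move=> _ [_ [a [b ->] <-]].
have : open ((f : subspace A -> R) @^-1` `]a, b[%classic).
  exact/cf/interval_open.
move=> /open_subspaceP[V oV VA].
rewrite setIC -VA; apply: measurableI => //; exact: open_measurable_plane.
Qed.

End plane_measurability.

Section square_integrable.
Context {R : realType} d (T : measurableType d) (mu : {measure set T -> \bar R})
  (D : set T).
Hypothesis mD : measurable D.
Implicit Types f g h : T -> R.

(* For a measure on the plane, [square_integrable], [dot] and [l2_sum] below are
   convertible to [L2], [inner] and [L2_sum]. *)
Definition square_integrable f := measurable_fun D f /\
  (\int[mu]_(x in D) ((f x) ^+ 2)%:E < +oo)%E.

Definition dot f g : R := \int[mu]_(x in D) (f x * g x).

Local Notation L2 := square_integrable.

Lemma square_integrable_sqr f : L2 f ->
  mu.-integrable D (fun x => ((f x) ^+ 2)%:E).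
Proof.
move=> [mf If]; apply/integrableP; split.
  by apply/measurable_EFinP; exact: measurable_funX.
by under eq_integral do rewrite gee0_abs ?lee_fin ?sqr_ge0//.
Qed.

Lemma square_integrableM f g : L2 f -> L2 g ->
  mu.-integrable D (fun x => (f x * g x)%:E).
Proof.
move=> Lf Lg; have [mf _] := Lf; have [mg _] := Lg.
have Ifg := integrableD mD (square_integrable_sqr Lf) (square_integrable_sqr Lg).
apply: le_integrable Ifg => //.
  by apply/measurable_EFinP; exact: measurable_funM.
move=> x _ /=; rewrite lee_fin [leRHS]ger0_norm ?addr_ge0 ?sqr_ge0//.
have := sqr_ge0 (f x - g x); have := sqr_ge0 (f x + g x).
by have := sqr_ge0 (f x); have := sqr_ge0 (g x); case: (ger0P (f x * g x)); nra.
Qed.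

Lemma square_integrable_linear a f g : L2 f -> L2 g -> L2 (fun x => a * f x + g x).
Proof.
move=> Lf Lg; have [mf _] := Lf; have [mg _] := Lg.
have mh : measurable_fun D (fun x => a * f x + g x).
  by apply: measurable_funD => //; apply: measurable_funM.
split=> //.
have I2 : mu.-integrable D (fun x => ((a ^+ 2)%:E * ((f x) ^+ 2)%:E +
    ((2 * a)%:E * (f x * g x)%:E + ((g x) ^+ 2)%:E))%E).
  apply: integrableD => //.
    by apply: integrableZl => //; exact: square_integrable_sqr.
  apply: integrableD => //; last exact: square_integrable_sqr.
  by apply: integrableZl => //; exact: square_integrableM.
have := integrable_lty mD I2; congr (_ < _)%E; apply: eq_integral => x _.
by rewrite -!EFinM -!EFinD; congr EFin; ring.
Qed.

Lemma square_integrable0 : L2 (fun=> 0).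
Proof.
split=> //; rewrite integral0_eq ?ltry// => x _.
by rewrite expr0n.
Qed.

Lemma square_integrable_sum (I : Type) (r : seq I) (c : I -> R) (u : I -> T -> R) :
  (forall i, L2 (u i)) -> L2 (fun x => \sum_(i <- r) c i * u i x).
Proof.
move=> Lu; elim: r => [|i r IH].
  under eq_fun do rewrite big_nil; exact: square_integrable0.
by under eq_fun do rewrite big_cons; exact: square_integrable_linear.
Qed.

Lemma square_integrableB f g : L2 f -> L2 g -> L2 (fun x => f x - g x).
Proof.
move=> Lf Lg; have := square_integrable_linear (-1) Lg Lf.
by under eq_fun do rewrite mulN1r addrC.
Qed.

Lemma dotC f g : dot f g = dot g f.
Proof. by rewrite /dot; under eq_Rintegral do rewrite mulrC. Qed.

Lemma dot_linear a f g h : L2 f -> L2 g -> L2 h ->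
  dot (fun x => a * f x + g x) h = a * dot f h + dot g h.
Proof.
move=> Lf Lg Lh; rewrite /dot -RintegralZl//; last exact: square_integrableM.
rewrite -RintegralD//.
- by under eq_Rintegral do rewrite mulrDl -mulrA.
- rewrite (_ : EFin \o _ = fun x => (a%:E * (f x * h x)%:E)%E).
    by apply: integrableZl => //; exact: square_integrableM.
  by apply/funext => x /=; rewrite EFinM.
- exact: square_integrableM.
Qed.

Lemma dotBl f g h : L2 f -> L2 g -> L2 h ->
  dot (fun x => f x - g x) h = dot f h - dot g h.
Proof.
move=> Lf Lg Lh; rewrite (_ : (fun x => _) = fun x => -1 * g x + f x).
  by rewrite dot_linear//; ring.
by apply/funext => x; ring.
Qed.

Lemma dotBB f g : L2 f -> L2 g ->
  dot (fun x => f x - g x) (fun x => f x - g x) = dot f f - 2 * dot f g + dot g g.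
Proof.
move=> Lf Lg; have Lh := square_integrableB Lf Lg.
rewrite dotBl// !(dotC _ (fun=> _ - _)) !dotBl// (dotC g f); ring.
Qed.

Lemma dot_sum (I : Type) (r : seq I) (c : I -> R) (u : I -> T -> R) f :
  (forall i, L2 (u i)) -> L2 f ->
  dot (fun x => \sum_(i <- r) c i * u i x) f = \sum_(i <- r) c i * dot (u i) f.
Proof.
move=> Lu Lf; elim: r => [|i r IH].
  rewrite big_nil /dot /Rintegral integral0_eq// => x _.
  by rewrite big_nil mul0r.
rewrite big_cons -IH -dot_linear//; last exact: square_integrable_sum.
by congr dot; apply/funext => x; rewrite big_cons.
Qed.

Lemma dot_ge0 f : 0 <= dot f f.
Proof. by apply: Rintegral_ge0 => x _; rewrite -expr2 sqr_ge0. Qed.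

Lemma dotE f : L2 f -> (\int[mu]_(x in D) ((f x) ^+ 2)%:E = (dot f f)%:E)%E.
Proof.
move=> Lf; rewrite /dot /Rintegral fineK; first by under eq_integral do rewrite expr2.
exact/integrable_fin_num/square_integrableM.
Qed.

Lemma eq_dot f f' g g' : {in D, f =1 f'} -> {in D, g =1 g'} -> dot f g = dot f' g'.
Proof. by move=> ff' gg'; apply: eq_Rintegral => x Dx; rewrite ff'// gg'. Qed.

Lemma cauchy_schwarz f g : L2 f -> L2 g -> (dot f g) ^+ 2 <= dot f f * dot g g.
Proof.
move=> Lf Lg.
have H a : 0 <= a ^+ 2 * dot f f + 2 * a * dot f g + dot g g.
  have := dot_ge0 (fun x => a * f x + g x).
  have Lh := square_integrable_linear a Lf Lg.
  rewrite dot_linear// !(dotC _ (fun=> _ + _)) !dot_linear// (dotC g f).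
  by congr (0 <= _); ring.
have F0 := dot_ge0 f; have G0 := dot_ge0 g.
move: H F0 G0; move: (dot f f) (dot f g) (dot g g) => F I G H F0 G0.
have [F1|F1] := eqVneq F 0.
  (* With F = 0 the quadratic is affine in a, and this choice of a gives it the value -1 unless I =
     0. The other case below evaluates it at its minimizer - I / F. *)
  have := H (- (G + 1) / (2 * I)); rewrite F1 mulr0 mul0r add0r.
  have [-> _|I0] := eqVneq I 0; first by rewrite expr0n.
  have -> : 2 * (- (G + 1) / (2 * I)) * I + G = -1 by field.
  by rewrite ler0N1.
have Fp : 0 < F by rewrite lt0r F1.
have := H (- I / F); have -> : (- I / F) ^+ 2 * F + 2 * (- I / F) * I + G =
  (F * G - I ^+ 2) / F by field.
by rewrite pmulr_lge0 ?invr_gt0// subr_ge0.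
Qed.

Lemma ae_eq_dot0 f : L2 f -> dot f f = 0 -> {ae mu, forall x, D x -> f x = 0}.
Proof.
move=> Lf f0; have := dotE Lf; rewrite f0 => I0.
have [mf _] := Lf.
have mf2 : measurable_fun D (EFin \o (fun x => f x ^+ 2)).
  by apply/measurable_EFinP; exact: measurable_funX.
have [+ _] := ae_eq_integral_abs mu mD mf2.
have E : (\int[mu]_(x in D) `|(EFin \o (fun x0 : T => (f x0 ^+ 2)%R)) x| =
  \int[mu]_(x in D) ((f x) ^+ 2)%:E)%E.
  by apply: eq_integral => x _ /=; rewrite ger0_norm// sqr_ge0.
rewrite E => /(_ I0); apply: filterS => x /= h /h [].
by move=> /eqP; rewrite sqrf_eq0 => /eqP.
Qed.

Definition l2_sum (u : nat -> T -> R) h := L2 h /\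
  (fun n => \int[mu]_(x in D) ((h x - \sum_(j < n) u j x) ^+ 2)%:E)%E @ \oo --> 0%E.

Section orthonormal.
Context (Phi : nat -> T -> R).
Hypotheses (LPhi : forall j, L2 (Phi j))
  (ortho : forall i j, dot (Phi i) (Phi j) = (i == j)%:R).
Implicit Types c : nat -> R.

Local Notation S c n := (fun x => \sum_(j < n) c j * Phi j x).

Lemma partial_sumE c n x :
  \sum_(j < n) c j * Phi j x = \sum_(j <- iota 0 n) c j * Phi j x.
Proof. by rewrite -(big_mkord xpredT (fun j => c j * Phi j x)) /index_iota subn0. Qed.

Lemma partial_sum_L2 c n : L2 (S c n).
Proof. by under eq_fun do rewrite partial_sumE; exact: square_integrable_sum. Qed.

Lemma dot_partial_sum c n f : L2 f ->
  dot (S c n) f = \sum_(j < n) c j * dot (Phi j) f.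
Proof.
move=> Lf; under eq_fun do rewrite partial_sumE.
rewrite dot_sum//.
by rewrite -(big_mkord xpredT (fun j => c j * dot (Phi j) f)) /index_iota subn0.
Qed.

Lemma dot_partial_sum_basis c n k :
  dot (S c n) (Phi k) = if (k < n)%N then c k else 0.
Proof.
rewrite dot_partial_sum//; under eq_bigr do rewrite ortho.
case: ltnP => kn.
  rewrite (bigD1 (Ordinal kn)) //= eqxx mulr1 big1 ?addr0// => j jk.
  rewrite (_ : (j == k :> nat) = false) ?mulr0//; apply/negbTE.
  by apply: contraNneq jk => e; apply/eqP; exact: val_inj.
rewrite big1// => j _; rewrite (_ : (j == k :> nat) = false) ?mulr0//.
by apply/negbTE; rewrite neq_ltn (leq_trans (ltn_ord j) kn).
Qed.

Lemma dot_partial_sums (b c : nat -> R) n : dot (S b n) (S c n) = \sum_(j < n) b j * c j.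
Proof.
rewrite dot_partial_sum; last exact: partial_sum_L2.
by apply: eq_bigr => j _; rewrite dotC dot_partial_sum_basis ltn_ord.
Qed.

Lemma bessel f n : L2 f -> \sum_(j < n) (dot (Phi j) f) ^+ 2 <= dot f f.
Proof.
move=> Lf; have := dot_ge0 (fun x => f x - S (fun j => dot (Phi j) f) n x).
have Ls := partial_sum_L2 (fun j => dot (Phi j) f) n.
rewrite dotBB// (dot_partial_sums (fun j => dot (Phi j) f)
  (fun j => dot (Phi j) f)) (dotC f).
rewrite (dot_partial_sum (fun j => dot (Phi j) f))//.
have -> : \sum_(j < n) dot (Phi j) f * dot (Phi j) f =
  \sum_(j < n) (dot (Phi j) f) ^+ 2 by [].
by lra.
Qed.

Lemma l2_sum_cvg c h f : l2_sum (fun j x => c j * Phi j x) h -> L2 f ->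
  (fun n => \sum_(j < n) c j * dot (Phi j) f) @ \oo --> dot h f.
Proof.
move=> [Lh hc] Lf.
have hc' : (fun n => dot (fun x => h x - S c n x) (fun x => h x - S c n x)) @ \oo
    --> (0 : R).
  move: hc; under eq_fun => n do
    rewrite (dotE (square_integrableB Lh (partial_sum_L2 c n))).
  by move/fine_cvg.
apply/cvgrPdist_lt => e e0.
(* The summand 1 keeps the tolerance for the squared distance meaningful when f has norm zero. *)
have e2 : 0 < e ^+ 2 / (dot f f + 1) by rewrite divr_gt0 ?exprn_gt0// ltr_wpDl// dot_ge0.
move/cvgrPdist_lt: hc' => /(_ _ e2); apply: filterS => n.
rewrite sub0r normrN ger0_norm ?dot_ge0// => Hn.
have Ls := partial_sum_L2 c n.
rewrite -dot_partial_sum// -dotBl//.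
have := cauchy_schwarz (square_integrableB Lh Ls) Lf => CS.
rewrite -(@ltr_pXn2r _ 2) ?nnegrE ?normr_ge0 ?(ltW e0)//.
rewrite -normrX ger0_norm ?sqr_ge0//; apply: le_lt_trans CS _.
move: Hn; rewrite ltr_pdivlMr ?ltr_wpDl ?dot_ge0//; apply: le_lt_trans.
by rewrite ler_wpM2l ?dot_ge0// lerDl.
Qed.

Lemma l2_sum_coef c h k : l2_sum (fun j x => c j * Phi j x) h ->
  dot (Phi k) h = c k.
Proof.
move=> hc; rewrite dotC; have H := l2_sum_cvg hc (LPhi k).
apply: (cvg_unique (@Rhausdorff R) H).
apply: cvg_near_cst; exists k.+1 => // n /= kn.
by rewrite -dot_partial_sum// dot_partial_sum_basis kn.
Qed.

End orthonormal.
End square_integrable.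

Lemma within_continuousP {R : realType} {V : normedModType R} (A : set V)
    (f : V -> R) :
  {within A, continuous f} <->
  forall x, A x -> forall e, 0 < e ->
    exists2 r, 0 < r & forall y, A y -> `|x - y| < r -> `|f x - f y| < e.
Proof.
rewrite subspace_continuousP; split=> [cf x Ax e e0|H x Ax].
  have /cvgrPdist_lt/(_ e e0) := cf x Ax.
  rewrite near_withinE => /nbhs_ballP[r /= r0 rB]; exists r => // y Ay xy.
  by apply: rB => //; rewrite -ball_normE.
apply/cvgrPdist_lt => e e0; have [r r0 rB] := H x Ax e e0.
rewrite near_withinE; apply/nbhs_ballP; exists r => //= y.
by rewrite -ball_normE /= => xy Ay; exact: rB.
Qed.

(** A homogeneous system with more unknowns than equations has a nonzero solution. The test
    functions of both eigenvalue bounds come from here. *)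
Lemma kernel_vector {F : fieldType} (I J : finType) (a : I -> J -> F) :
  (#|J| < #|I|)%N ->
  exists2 c : I -> F, (exists i, c i != 0) & forall j, \sum_i c i * a i j = 0.
Proof.
move=> IJ; pose A := \matrix_(i < #|I|, j < #|J|) a (enum_val i) (enum_val j).
have : kermx A != 0.
  rewrite -mxrank_eq0 mxrank_ker -lt0n subn_gt0.
  exact: leq_ltn_trans (rank_leq_col A) IJ.
case/rowV0Pn => v /sub_kermxP vA v0.
exists (fun i => v 0 (enum_rank i)).
  have [i vi] : exists i, v 0 i != 0.
    apply: contrapT => h; move/negP: v0; apply; apply/eqP/rowP => i.
    by rewrite mxE; apply/eqP/negPn/negP => vi; apply: h; exists i.
  by exists (enum_val i); rewrite enum_valK.
move=> j; have /rowP/(_ (enum_rank j)) := vA; rewrite !mxE => h.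
rewrite -[RHS]h (reindex enum_rank); last first.
  by exists enum_val => i _; [exact: enum_rankK|exact: enum_valK].
by apply: eq_bigr => i _; rewrite mxE !enum_rankK.
Qed.

(** * Oscillation and Poincare inequalities *)

Section oscillation.
Context {R : realType} (p : 'I_3 -> R * R) (K : set (R * R)).
Hypotheses (eqp : unit_equilateral p) (hK : sierpinski_gasket p K).
Implicit Types (f : R * R -> R) (B : R).

(** The point f_i(p_0) equals f_0(p_i), a vertex of the cell of f_0, so the difference runs along an
    edge of that cell and its square is at most the level 1 sum, at most 3/5 B^2. Replacing 3/5 by
    16/25 avoids a square root. *)
Lemma vertex_osc f B : 0 <= B ->
  (forall m, (5 / 3) ^+ m * cell_sum p m f f <= B ^+ 2) ->
  forall i, `|f (gasket_map p i (p o0)) - f (p o0)| <= 4 / 5 * B.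
Proof.
move=> B0 HB i.
have H1 : cell_sum p 1 f f <= 3 / 5 * B ^+ 2 by have := HB 1%N; rewrite expr1; lra.
have H2 : (f (gasket_map p i (p o0)) - f (p o0)) ^+ 2 <= cell_sum p 1 f f.
  rewrite gasket_mapC -[X in _ - f X](gasket_map_fix p o0) cell_sumS big_ord3 !cell_sum0.
  apply: le_trans (_ : _ <= vertex_energy p (f \o gasket_map p o0)
    (f \o gasket_map p o0)) _; last first.
    by rewrite -addrA lerDl addr_ge0// vertex_energy_ge0.
  have H (a b c : R) : 0 <= (a - b) ^+ 2 /\ 0 <= (a - c) ^+ 2 /\ 0 <= (b - c) ^+ 2.
    by rewrite !sqr_ge0.
  have [h1 [h2 h3]] := H (f (gasket_map p o0 (p o0)))
    (f (gasket_map p o0 (p o1))) (f (gasket_map p o0 (p o2))).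
  by rewrite /vertex_energy /=; elim/ord3P: i; nra.
rewrite -(@ler_pXn2r _ 2) ?nnegrE ?mulr_ge0 ?divr_ge0//.
rewrite -normrX ger0_norm ?sqr_ge0//; apply: le_trans H2 _.
by apply: le_trans H1 _; have := sqr_ge0 B; rewrite exprMn; lra.
Qed.

Lemma cell_sum_part m f i :
  cell_sum p m (f \o gasket_map p i) (f \o gasket_map p i) <= cell_sum p m.+1 f f.
Proof.
rewrite cell_sumS (bigD1 i) //= lerDl; apply: sumr_ge0 => j _.
exact: cell_sum_ge0.
Qed.

(* One step of the chain p_0, f_i p_0, f_i f_j p_0, ... costs the factor
   sqrt (3/5) < 4/5, whence a geometric series of sum 4. *)
Lemma word_osc w f B : 0 <= B ->
  (forall m, (5 / 3) ^+ m * cell_sum p m f f <= B ^+ 2) ->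
  `|f (word_map p w (p o0)) - f (p o0)| <= 4 * B.
Proof.
elim: w f B => [|i w IH] f B B0 HB /=.
  by rewrite subrr normr0 mulr_ge0.
have h1 := vertex_osc B0 HB i.
have B0' : 0 <= 4 / 5 * B by rewrite mulr_ge0// divr_ge0.
have HB' m : (5 / 3) ^+ m * cell_sum p m (f \o gasket_map p i) (f \o gasket_map p i)
    <= (4 / 5 * B) ^+ 2.
  have h : 5 / 3 * ((5 / 3) ^+ m * cell_sum p m.+1 f f) <= B ^+ 2.
    by rewrite mulrA -exprS; exact: HB.
  have a0 : 0 <= (5 / 3) ^+ m :> R by rewrite exprn_ge0// divr_ge0.
  apply: le_trans (ler_wpM2l a0 (cell_sum_part m f i)) _.
  by rewrite [(4 / 5 * B) ^+ 2]exprMn; have := sqr_ge0 B; lra.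
have h2 := IH _ _ B0' HB'.
rewrite /= in h2.
have := ler_normD (f (gasket_map p i (word_map p w (p o0))) - f (gasket_map p i (p o0)))
  (f (gasket_map p i (p o0)) - f (p o0)).
by rewrite addrA subrK; lra.
Qed.

(** The images of p_0 under words are dense in K, so continuity extends [word_osc] to all of K with
    the same constant. *)
Lemma gasket_osc f B : {within K, continuous f} -> 0 <= B ->
  (forall m, (5 / 3) ^+ m * cell_sum p m f f <= B ^+ 2) ->
  forall x, K x -> `|f x - f (p o0)| <= 4 * B.
Proof.
move=> cf B0 HB x Kx; apply/ler_addgt0Pr => e e0.
have [r r0 rB] := (within_continuousP _ _).1 cf x Kx e e0.
have [n Hn] := word_map_small hK r0.
have [w _ [x' Kx' xE]] := gasket_word hK n Kx.
have Kp := gasket_vertex hK o0.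
have h1 := rB _ (word_mapK hK w Kp).
have {h1}h1 : `|f x - f (word_map p w (p o0))| < e.
  by apply: h1; rewrite xE; apply: Hn => //; rewrite size_tuple.
have h2 := word_osc w B0 HB.
have := ler_normD (f x - f (word_map p w (p o0))) (f (word_map p w (p o0)) - f (p o0)).
by rewrite addrA subrK; lra.
Qed.

End oscillation.

Section gasket_measure.
Context {R : realType} (p : 'I_3 -> R * R) (K : set (R * R))
  (mu : {measure set (R * R) -> \bar R}).
Hypotheses (eqp : unit_equilateral p) (hK : sierpinski_gasket p K)
  (hmu : selfsimilar_measure p K mu).
Local Notation D := (dirichlet_domain p K).
Local Notation L2' := (square_integrable mu K).
Implicit Types f : R * R -> R.

Lemma gasket_measurable : measurable K.
Proof. exact: closed_measurable_plane (gasket_closed hK). Qed.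

Let mK := gasket_measurable.

Lemma gasket_mass : mu K = 1%E.
Proof.
have [_ /(_ [::])] := hmu; rewrite /= expr0 => <-.
by congr (mu _); rewrite image_id.
Qed.

Lemma cell_mass w : mu (word_map p w @` K) = ((3^-1) ^+ size w)%:E.
Proof. by have [_] := hmu. Qed.

Lemma cell_closed w : closed (word_map p w @` K).
Proof.
apply: compact_closed => //; apply: continuous_compact; last by case: hK.
by apply: continuous_subspaceT; exact: continuous_word_map.
Qed.

Lemma cell_measurable w : measurable (word_map p w @` K).
Proof. by apply: closed_measurable_plane; exact: cell_closed. Qed.

Lemma cell_sub w : word_map p w @` K `<=` K.
Proof. by move=> _ [x Kx <-]; exact: word_mapK. Qed.

Lemma within_continuous_bounded f : {within K, continuous f} ->
  exists2 M, 0 <= M & forall x, K x -> `|f x| <= M.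
Proof.
move=> cf; have [K0 cK _] := hK.
have cn : {within K, continuous (fun x => `|f x|)}.
  by move=> x; apply: cvg_norm; exact: cf.
have [c Kc Hc] := compact_EVT_max K0 cK cn.
by exists `|f c| => // x Kx; apply: Hc; rewrite inE.
Qed.

Lemma bounded_square_integrable f M : measurable_fun K f ->
  (forall x, K x -> `|f x| <= M) -> L2' f.
Proof.
move=> mf fM; split=> //.
apply: le_lt_trans (_ : \int[mu]_(x in K) (M ^+ 2)%:E < +oo)%E; last first.
  by rewrite integral_cst// gasket_mass mule1 ltry.
apply: ge0_le_integral => //.
- by move=> x _; rewrite lee_fin sqr_ge0.
- by apply/measurable_EFinP; exact: measurable_funX.
- move=> x Kx; rewrite lee_fin -[f x ^+ 2]ger0_norm ?sqr_ge0// normrX.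
  by rewrite ler_pXn2r ?nnegrE ?fM// (le_trans _ (fM x Kx)).
Qed.

Lemma within_continuous_L2 f : {within K, continuous f} -> L2' f.
Proof.
move=> cf; have [M _ HM] := within_continuous_bounded cf.
apply: bounded_square_integrable HM; exact: within_continuous_measurable.
Qed.

Lemma dirichlet_domain_L2 f : D f -> L2' f.
Proof. by move=> [cf _ _]; exact: within_continuous_L2. Qed.

Lemma within_continuous_word f w : {within K, continuous f} ->
  {within K, continuous (f \o word_map p w)}.
Proof.
move=> /within_continuousP cf; apply/within_continuousP => x Kx e e0.
have [r r0 rB] := cf _ (word_mapK hK w Kx) e e0.
exists r => // y Ky xy; apply: rB; first exact: word_mapK.
rewrite word_map_dist normrZ; apply: le_lt_trans xy.
rewrite ler_piMl// ger0_norm ?exprn_ge0 ?invr_ge0//.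
by rewrite exprn_ile1 ?invr_ge0// invf_le1// ler1n.
Qed.

Lemma cell_sum_energy m f : D f ->
  (5 / 3) ^+ m * cell_sum p m f f <= 3 / 2 * energy_form p f f.
Proof.
move=> Df; have := graph_energy_le eqp m Df.
by rewrite graph_energyE//; lra.
Qed.

(** On the cell of w the square of f is at most 16 s_w, where s_w is the limit of the rescaled
    energies of f on that cell. The s_w add up to at most (3/5)^n (3/2) E(f, f), and each cell has
    mass 3^-n; 24 is 16 * 3/2. *)
Lemma poincare n f : D f ->
  (forall w : n.-tuple 'I_3, f (word_map p w (p o0)) = 0) ->
  dot mu K f f <= 24 * (5^-1) ^+ n * energy_form p f f.
Proof.
move=> Df f0; have [cf _ _] := Df.
pose a (w : n.-tuple 'I_3) m :=
  (5 / 3) ^+ m * cell_sum p m (f \o word_map p w) (f \o word_map p w).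
have nd w : nondecreasing_seq (a w) by move=> i j ij; exact: cell_sum_scale.
have suma m : \sum_w a w m <= (3 / 5) ^+ n * (3 / 2 * energy_form p f f).
  rewrite -mulr_sumr -cell_sumD.
  have h := cell_sum_energy (n + m) Df; rewrite exprD in h.
  have xy : (3 / 5) ^+ n * (5 / 3) ^+ n = 1 :> R.
    by rewrite -exprMn (_ : 3 / 5 * (5 / 3) = 1) ?expr1n//; field.
  have x0 : 0 <= (3 / 5) ^+ n :> R by rewrite exprn_ge0// divr_ge0.
  by have := ler_wpM2l x0 h; rewrite !mulrA xy mul1r.
have a0 w m : 0 <= a w m.
  by rewrite mulr_ge0 ?cell_sum_ge0// exprn_ge0// divr_ge0.
have ca w : cvgn (a w).
  apply: nondecreasing_is_cvgn => //.
  exists ((3 / 5) ^+ n * (3 / 2 * energy_form p f f)) => _ [m _ <-].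
  apply: le_trans (suma m); rewrite (bigD1 w)//= lerDl.
  by apply: sumr_ge0.
pose s w : R := limn (a w).
have as_ w m : a w m <= s w by exact: nondecreasing_cvgn_le.
have s0 w : 0 <= s w by apply: le_trans (as_ w 0%N).
have ss : \sum_w s w <= (3 / 5) ^+ n * (3 / 2 * energy_form p f f).
  have cs : (fun m => \sum_w a w m) @ \oo --> \sum_w s w.
    by apply: cvg_big; [exact: add_continuous|move=> w _; exact: ca].
  rewrite -(cvg_lim (@Rhausdorff R) cs); apply: limr_le.
    by apply/cvg_ex; eexists; exact: cs.
  by apply: nearW.
have Hs (w : n.-tuple 'I_3) x : K x -> (f (word_map p w x)) ^+ 2 <= 16 * s w.
  move=> Kx; have := @gasket_osc R p K hK (f \o word_map p w) (Num.sqrt (s w))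
    (@within_continuous_word f w cf) (sqrtr_ge0 _) _ x Kx.
  rewrite sqr_sqrtr// => /(_ (as_ w)); rewrite /= f0 subr0 => h.
  have := s0 w => /sqr_sqrtr E.
  rewrite -[leLHS]ger0_norm ?sqr_ge0// normrX.
  apply: le_trans (_ : _ <= (4 * Num.sqrt (s w)) ^+ 2) _.
    by rewrite ler_pXn2r ?nnegrE// mulr_ge0// sqrtr_ge0.
  by rewrite exprMn E; lra.
rewrite -lee_fin -dotE//; last exact: dirichlet_domain_L2.
(* Points lying in several cells only increase the right-hand side, so the cells need not be made
   disjoint. *)
apply: le_trans (_ : _ <= \int[mu]_(x in K)
   \sum_(w : n.-tuple 'I_3) (16 * s w * \1_(word_map p w @` K) x)%:E)%E _.
  apply: ge0_le_integral => //.
  - by move=> x _; rewrite lee_fin sqr_ge0.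
  - apply/measurable_EFinP/measurable_funX.
    by have [] := dirichlet_domain_L2 Df.
  - apply: emeasurable_sum => w; apply/measurable_EFinP.
    by apply: measurable_funM => //; apply: measurable_indic; exact: cell_measurable.
  - move=> x Kx; have [w _ [x' Kx' xE]] := gasket_word hK n Kx.
    rewrite sumEFin lee_fin (bigD1 w)//=.
    rewrite indicE mem_set ?mulr1; last by exists x'.
    apply: le_trans (_ : 16 * s w <= _); first by rewrite xE Hs.
    by rewrite lerDl; apply: sumr_ge0 => v _; rewrite !mulr_ge0.
rewrite ge0_integral_sum//; last 2 first.
- move=> w; apply/measurable_EFinP.
  by apply: measurable_funM => //; apply: measurable_indic; exact: cell_measurable.
- by move=> w x _; rewrite lee_fin !mulr_ge0.
have Iw (w : n.-tuple 'I_3) :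
    (\int[mu]_(x in K) (16 * s w * \1_(word_map p w @` K) x)%:E =
     (16 * s w * (3^-1) ^+ n)%:E)%E.
  have mw := cell_measurable w.
  rewrite (integralZl_indic mK (fun=> word_map p w @` K))//; last first.
    by move=> h; exfalso; have := s0 w; lra.
  rewrite integral_indic// setIidl; last exact: cell_sub.
  by rewrite cell_mass size_tuple -EFinM.
rewrite (eq_bigr _ (fun w _ => Iw w)).
rewrite sumEFin lee_fin -mulr_suml -mulr_sumr.
have x0 : 0 <= (3^-1) ^+ n :> R by rewrite exprn_ge0// invr_ge0.
have := ler_wpM2l x0 ss.
rewrite !mulrA -exprMn (_ : 3^-1 * (3 / 5) = 5^-1); last by field.
lra.
Qed.

End gasket_measure.

(** * Growth of the eigenvalues *)

Section cell_copies.
Context {R : realType} (p : 'I_3 -> R * R) (K : set (R * R)).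
Hypotheses (eqp : unit_equilateral p) (hK : sierpinski_gasket p K).
Implicit Types (u f : R * R -> R).
Local Notation D := (dirichlet_domain p K).

(** The three pieces are closed: near x, a piece that contains x is controlled by the continuity of
    f on it, and one that does not is at positive distance. *)
Lemma continuous_pieces f :
  (forall i, {within K, continuous (f \o gasket_map p i)}) ->
  {within K, continuous f}.
Proof.
move=> cf; apply/within_continuousP => x Kx e e0.
have H i : exists2 r, 0 < r & forall y, K y -> `|x - gasket_map p i y| < r ->
    `|f x - f (gasket_map p i y)| < e.
  have [[x' Kx' xE]|nx] := pselect ((gasket_map p i @` K) x).
    have [r r0 rB] := (within_continuousP _ _).1 (cf i) _ Kx' e e0.
    exists (2^-1 * r); first by rewrite mulr_gt0// invr_gt0.
    move=> y Ky; rewrite -xE => xy; apply: rB => //.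
    have := word_map_dist p [:: i] x' y; rewrite /= expr1 => E.
    move: xy; rewrite E normrZ ger0_norm ?invr_ge0//.
    by rewrite ltr_pM2l// invr_gt0.
  have oC : open (~` (gasket_map p i @` K)).
    by apply: closed_openC; exact: (@cell_closed _ _ _ hK [:: i]).
  have /nbhs_ballP[r /= r0 rB] : nbhs x (~` (gasket_map p i @` K)).
    exact: open_nbhs_nbhs.
  exists r => // y Ky xy; exfalso; apply: (rB (gasket_map p i y)).
    by rewrite -ball_normE.
  by exists y.
have [[r0 r00 B0] [r1 r10 B1]] := (H ord0, H (lift ord0 ord0)).
have [r2 r20 B2] := H (lift ord0 (lift ord0 ord0)).
exists (Num.min r0 (Num.min r1 r2)); first by rewrite !lt_min r00 r10 r20.
move=> y Ky; rewrite !lt_min => /and3P[h0 h1 h2].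
have [i [y' Ky' yE]] := gasket_split hK Ky; move: h0 h1 h2; rewrite yE.
by elim/ord3P: i {yE} => *; [exact: B0|exact: B1|exact: B2].
Qed.

Lemma continuous_cells n f :
  (forall w : n.-tuple 'I_3, {within K, continuous (f \o word_map p w)}) ->
  {within K, continuous f}.
Proof.
elim: n f => [|n IH] f cf; first exact: (cf [tuple]).
apply: continuous_pieces => i; apply: IH => w.
exact: (cf [tuple of i :: w]).
Qed.

Lemma eq_within_continuous f g : (forall x, K x -> f x = g x) ->
  {within K, continuous f} -> {within K, continuous g}.
Proof.
move=> fg /within_continuousP cf; apply/within_continuousP => x Kx e e0.
have [r r0 rB] := cf x Kx e e0; exists r => // y Ky xy.
by rewrite -!fg//; exact: rB.
Qed.

Section glued.
Context (n : nat) (a : n.-tuple 'I_3 -> R) (u U : R * R -> R).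
Hypotheses (Du : D u)
  (UE : forall (w : n.-tuple 'I_3) x, K x -> U (word_map p w x) = a w * u x).

Lemma glued_cell_sum m :
  cell_sum p (n + m) U U = (\sum_w a w ^+ 2) * cell_sum p m u u.
Proof.
rewrite cell_sumD mulr_suml; apply: eq_bigr => w _.
have E x : K x -> (U \o word_map p w) x = a w * u x + 0.
  by move=> Kx; rewrite addr0 /= UE.
rewrite (eq_cell_sum m eqp hK E E) cell_sum_linear cell_sumC cell_sum_linear.
have Z h : cell_sum p m (fun=> 0) h = 0.
  rewrite /cell_sum big1// => v _; rewrite /vertex_energy /= subrr !mul0r.
  by rewrite !addr0.
by rewrite !Z; ring.
Qed.

(** Passing from level m to level n + m can only increase the graph energy, and at level n + m the
    sum splits over the cells of generation n, each giving a_w^2 times the sum for u at level m;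
    (5/3)^n is the renormalization of n levels. *)
Lemma glued_energy_le m :
  graph_energy p m U U <= (5 / 3) ^+ n * (\sum_w a w ^+ 2) * energy_form p u u.
Proof.
apply: le_trans (graph_energy_nondecreasing eqp U (leq_addl n m)) _.
rewrite graph_energyE// glued_cell_sum exprD.
have := graph_energy_le eqp m Du; rewrite graph_energyE// => h.
have a0 : 0 <= \sum_w a w ^+ 2 by apply: sumr_ge0 => w _; exact: sqr_ge0.
have b0 : 0 <= (5 / 3) ^+ n :> R by rewrite exprn_ge0// divr_ge0.
have := ler_wpM2l (mulr_ge0 b0 a0) h.
set A := \sum_w _; set B := (5 / 3) ^+ n; set C := (5 / 3) ^+ m.
set c := cell_sum _ _ _ _.
by rewrite (_ : B * A * (2 / 3 * C * c) = 2 / 3 * (B * C) * (A * c)) //; ring.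
Qed.

Lemma glued_domain : D U.
Proof.
have [cu _ u0] := Du; split.
- apply: (@continuous_cells n) => w.
  apply: (@eq_within_continuous (fun x => a w * u x)).
    by move=> x Kx /=; rewrite UE.
  by move=> x; apply: cvgMr; exact: cu.
- apply/(energyP eqp); eexists => m; exact: glued_energy_le.
- move=> i; have E : word_map p (nseq n i) (p i) = p i.
    by elim: n => //= k ->; exact: gasket_map_fix.
  have sz : size (nseq n i) == n by rewrite size_nseq.
  have := @UE (Tuple sz) (p i) (gasket_vertex hK i).
  by rewrite /= E u0 mulr0.
Qed.

Lemma glued_energy :
  energy_form p U U <= (5 / 3) ^+ n * (\sum_w a w ^+ 2) * energy_form p u u.
Proof.
have H := cvg_graph_energy eqp glued_domain glued_domain.
rewrite -(cvg_lim (@Rhausdorff R) H); apply: limr_le.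
  by apply/cvg_ex; eexists; exact: H.
by apply: nearW => m; exact: glued_energy_le.
Qed.

End glued.

(** This is u composed with the inverse of the word map, extended by zero. The default of [xget] is
    never returned, since its branch is taken only where a preimage exists. *)
Definition cell_copy (w : seq 'I_3) u (z : R * R) : R :=
  if `[< (word_map p w @` K) z >]
  then u (xget (p ord0) [set x | word_map p w x = z]) else 0.

(** A point of the cell of w that also lies in another cell is the image of a vertex, where u
    vanishes; the two descriptions of the value there agree. *)
Lemma cell_copyE n (v w : n.-tuple 'I_3) u x : D u -> K x ->
  cell_copy w u (word_map p v x) = (v == w)%:R * u x.
Proof.
move=> [_ _ u0] Kx; rewrite /cell_copy.
have xE : xget (p ord0) [set y | word_map p w y = word_map p w x] = x.
  case: xgetP => [y _ /= /word_map_inj//|/(_ x) /=]; by [].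
case: asboolP => [[x' Kx' e]|h]; last first.
  case: eqP => vw; last by rewrite mul0r.
  by exfalso; apply: h; rewrite vw; exists x.
case: eqP => [vw|/eqP vw]; first by rewrite vw xE mul1r.
have x'E : xget (p ord0) [set y | word_map p w y = word_map p v x] = x'.
  case: xgetP => [y _ /=|/(_ x') /=]; last by rewrite e.
  by rewrite -e => /word_map_inj.
rewrite mul0r x'E; rewrite eq_sym in vw.
by have [[i ->] _] := cell_overlap eqp hK vw Kx' Kx e.
Qed.

End cell_copies.

Section eigenvalues.
Context {R : realType} (p : 'I_3 -> R * R) (K : set (R * R))
  (mu : {measure set (R * R) -> \bar R}) (lam : nat -> R) (Phi : nat -> R * R -> R).
Hypotheses (eqp : unit_equilateral p) (hK : sierpinski_gasket p K)
  (hmu : selfsimilar_measure p K mu) (hb : dirichlet_eigenbasis p K mu lam Phi).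
Local Notation D := (dirichlet_domain p K).
Local Notation L2' := (square_integrable mu K).
Local Notation ip := (dot mu K).

Let mK := gasket_measurable hK.

Lemma eigen_gt0 j : 0 < lam j.
Proof. by have [l0 lnd _ _ _] := hb; apply: lt_le_trans l0 (lnd _ _ _). Qed.

Lemma eigen_homo i j : (i <= j)%N -> lam i <= lam j.
Proof. by have [_ lnd _ _ _] := hb; exact: lnd. Qed.

Lemma eigen_domain j : D (Phi j).
Proof. by have [_ _ /(_ j) [] ] := hb. Qed.

Lemma eigen_L2 j : L2' (Phi j).
Proof. exact: dirichlet_domain_L2 (eigen_domain j). Qed.

Lemma eigen_ortho i j : ip (Phi i) (Phi j) = (i == j)%:R.
Proof. by have [_ _ _ + _] := hb; exact. Qed.

Lemma eigen_complete f : L2' f -> l2_sum mu K (fun j x => ip (Phi j) f * Phi j x) f.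
Proof. by have [_ _ _ _ +] := hb; exact. Qed.

Lemma eigen_energy j g : D g -> energy_form p (Phi j) g = lam j * ip (Phi j) g.
Proof.
move=> Dg; have [_ _ /(_ j) [_ _ /(_ g Dg) ->] _ _] := hb.
have Lg := dirichlet_domain_L2 hK hmu Dg.
have := dot_linear mK (- lam j) (eigen_L2 j) (square_integrable0 mu K) Lg.
have -> : dot mu K (fun x => - lam j * Phi j x + 0) g =
    inner K mu (fun x => - lam j * Phi j x) g.
  by congr dot; apply/funext => x; rewrite addr0.
move=> ->; have -> : ip (fun=> 0) g = 0.
  by rewrite /dot /Rintegral integral0_eq// => x _; rewrite mul0r.
by ring.
Qed.

(** The energy of u - S is nonnegative, where S is the projection of u on the first n
    eigenfunctions; E(S, u) and E(S, S) are both equal to the left-hand side. *)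
Lemma eigen_bessel u n : D u ->
  \sum_(j < n) lam j * ip (Phi j) u ^+ 2 <= energy_form p u u.
Proof.
move=> Du; pose c j := ip (Phi j) u.
pose S x := \sum_(j <- iota 0 n) c j * Phi j x.
have DS : D S by apply: dirichlet_domain_sum => // j; exact: eigen_domain.
have LS := dirichlet_domain_L2 hK hmu DS.
have sumE (F : nat -> R) : \sum_(j <- iota 0 n) F j = \sum_(j < n) F j.
  by rewrite -(big_mkord xpredT F) /index_iota subn0.
have DuS := dirichlet_domain_linear eqp (-1) DS Du.
have := energy_form_ge0 eqp DuS.
rewrite (energy_form_linear eqp _ DS Du DuS) !(energy_formC eqp _ (fun=> _ + _)).
rewrite !(energy_form_linear eqp _ DS Du) // (energy_formC eqp u S).
have ESu : energy_form p S u = \sum_(j < n) lam j * ip (Phi j) u ^+ 2.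
  rewrite (energy_form_sum eqp _ _ eigen_domain Du) sumE.
  by apply: eq_bigr => j _; rewrite eigen_energy// /c; ring.
have ESS : energy_form p S S = \sum_(j < n) lam j * ip (Phi j) u ^+ 2.
  rewrite (energy_form_sum eqp _ _ eigen_domain DS) sumE.
  apply: eq_bigr => j _; rewrite eigen_energy// dotC.
  have -> : ip S (Phi j) = c j.
    have -> : S = fun x => \sum_(j < n) c j * Phi j x.
      by apply/funext => x; rewrite -(sumE (fun j => c j * Phi j x)).
    by rewrite (dot_partial_sum_basis mK eigen_L2 eigen_ortho) ltn_ord.
  by rewrite /c; ring.
rewrite ESu ESS; lra.
Qed.

(** The energy of Phi_j is lam_j, so [gasket_osc] applies with B^2 = 3/2 lam_j; as Phi_j vanishes at
    p_0, its square is at most 16 B^2. *)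
Lemma eigen_sup j x : K x -> (Phi j x) ^+ 2 <= 24 * lam j.
Proof.
move=> Kx; have Dj := eigen_domain j; have [cj _ j0] := Dj.
have l0 := eigen_gt0 j.
pose B := Num.sqrt (3 / 2 * lam j).
have B2 : B ^+ 2 = 3 / 2 * lam j by rewrite sqr_sqrtr// mulr_ge0 ?divr_ge0// ltW.
have HB m : (5 / 3) ^+ m * cell_sum p m (Phi j) (Phi j) <= B ^+ 2.
  apply: le_trans (cell_sum_energy eqp m Dj) _.
  by rewrite eigen_energy// eigen_ortho eqxx mulr1 B2.
have := gasket_osc hK cj (sqrtr_ge0 _) HB Kx.
rewrite j0 subr0 => h.
rewrite -[leLHS]ger0_norm ?sqr_ge0// normrX.
apply: le_trans (_ : _ <= (4 * B) ^+ 2) _.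
  by rewrite ler_pXn2r ?nnegrE// mulr_ge0// sqrtr_ge0.
by rewrite exprMn B2; lra.
Qed.

(* A nonzero combination of the first 3^n + 1 eigenfunctions vanishes at one
   vertex of each of the 3^n cells of generation n. *)
Lemma eigen_lower n : 5 ^+ n <= 24 * lam (3 ^ n).
Proof.
pose N := (3 ^ n)%N.
have NN : (#|{: n.-tuple 'I_3}| < #|'I_N.+1|)%N by rewrite card_tuple !card_ord.
have [c [i0 ci0] cK] := kernel_vector
  (fun (j : 'I_N.+1) (w : n.-tuple 'I_3) => Phi j (word_map p w (p ord0))) NN.
pose c' j := c (inord j).
pose u x := \sum_(j < N.+1) c' j * Phi j x.
have uE x : u x = \sum_(j <- iota 0 N.+1) c' j * Phi j x.
  by rewrite /u -(big_mkord xpredT (fun j => c' j * Phi j x)) /index_iota subn0.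
have uE' : u = fun x => \sum_(j <- iota 0 N.+1) c' j * Phi j x by exact/funext.
have Du : D u.
  by rewrite uE'; apply: dirichlet_domain_sum => // j; exact: eigen_domain.
have u0 (w : n.-tuple 'I_3) : u (word_map p w (p ord0)) = 0.
  by rewrite -(cK w); apply: eq_bigr => j _; rewrite /c' inord_val.
have := poincare eqp hK hmu Du u0.
have -> : ip u u = \sum_(j < N.+1) c' j ^+ 2.
  by rewrite (dot_partial_sums mK eigen_L2 eigen_ortho).
have Ej j : ip (Phi j) u = if (j < N.+1)%N then c' j else 0.
  by rewrite dotC (dot_partial_sum_basis mK eigen_L2 eigen_ortho).
have Eu : energy_form p u u = \sum_(j < N.+1) lam j * c' j ^+ 2.
  rewrite {1}uE'.
  rewrite (energy_form_sum eqp _ _ eigen_domain Du).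
  have := big_mkord xpredT (fun j => c' j * energy_form p (Phi j) u)
    (n := N.+1) (op := +%R) (idx := 0).
  rewrite /index_iota subn0 => ->.
  by apply: eq_bigr => j _; rewrite eigen_energy// Ej ltn_ord; ring.
rewrite Eu => h.
have c0 : 0 < \sum_(j < N.+1) c' j ^+ 2.
  rewrite (bigD1 i0)//= ltr_pwDl//; last by apply: sumr_ge0 => j _; exact: sqr_ge0.
  by rewrite /c' inord_val exprn_even_gt0.
have h2 : \sum_(j < N.+1) lam j * c' j ^+ 2 <= lam N * \sum_(j < N.+1) c' j ^+ 2.
  rewrite mulr_sumr; apply: ler_sum => j _; apply: ler_wpM2r; first exact: sqr_ge0.
  by apply: eigen_homo; rewrite -ltnS ltn_ord.
have f5 : 0 < 5^-1 ^+ n :> R by rewrite exprn_gt0// invr_gt0.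
have h3 : \sum_(j < N.+1) c' j ^+ 2 <= 24 * 5^-1 ^+ n * lam N * \sum_(j < N.+1) c' j ^+ 2.
  apply: le_trans h _; rewrite -(mulrA (24 * 5^-1 ^+ n)).
  by apply: ler_wpM2l => //; rewrite mulr_ge0// ltW.
have : 1 <= 24 * 5^-1 ^+ n * lam N.
  by rewrite -(@ler_pM2r _ (\sum_(j < N.+1) c' j ^+ 2))// mul1r.
rewrite -(@ler_pM2l _ (5 ^+ n)) ?exprn_gt0// mulr1 => /le_trans; apply.
rewrite exprVn (_ : 5 ^+ n * (24 / 5 ^+ n * lam N) = 24 * lam N) //.
have : 5 ^+ n != 0 :> R by rewrite expf_neq0.
by move: (5 ^+ n) => x x0; field.
Qed.

(* The first eigenfunction, transplanted to each of the 3^n cells of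
   generation n, spans a test space of dimension 3^n. *)
Lemma eigen_upper : exists2 C, 0 < C & forall n, lam (3 ^ n).-1 <= C * 5 ^+ n.
Proof.
have D0 := eigen_domain 0%N; have [c0 _ z0] := D0.
have [x0 Kx0 Px0] : exists2 x0, K x0 & Phi 0%N x0 != 0.
  apply: contrapT => h; have := eigen_ortho 0 0; rewrite eqxx.
  rewrite /dot /Rintegral integral0_eq => [/esym/eqP|x Kx]; first by rewrite oner_eq0.
  have [->|P0] := eqVneq (Phi 0%N x) 0; first by rewrite mul0r.
  by exfalso; apply: h; exists x.
(* Norms of the copies are bounded below through masses of cells: a small cell v of fixed depth k is
   chosen on which |Phi_0| stays above e, and the copy in w is then at least e on the cell w ++ v,
   of mass 3^-(n+k). *)
pose e := `|Phi 0%N x0| / 2.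
have e0 : 0 < e by rewrite divr_gt0// normr_gt0.
have [r r0 rB] := (within_continuousP _ _).1 c0 x0 Kx0 e e0.
have [k Hk] := word_map_small hK r0.
have [v _ [x1 Kx1 x0E]] := gasket_word hK k Kx0.
have Pv y : K y -> e ^+ 2 <= Phi 0%N (word_map p v y) ^+ 2.
  move=> Ky; have := rB _ (word_mapK hK v Ky).
  rewrite {1}x0E => /(_ (Hk _ _ _ _ Kx1 Ky)); rewrite size_tuple => /(_ (leqnn _)) h.
  rewrite -[leRHS]ger0_norm ?sqr_ge0// normrX.
  rewrite ler_pXn2r ?nnegrE ?(ltW e0)//.
  have := ler_normD (Phi 0%N x0 - Phi 0%N (word_map p v y)) (Phi 0%N (word_map p v y)).
  by rewrite subrK; move: h; rewrite /e; lra.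
pose E0 := energy_form p (Phi 0%N) (Phi 0%N).
exists ((3 ^+ k / e ^+ 2) * lam 0%N).
  by rewrite mulr_gt0 ?eigen_gt0// divr_gt0 ?exprn_gt0.
move=> n; pose N := (3 ^ n)%N.
have N0 : (0 < N)%N by rewrite expn_gt0.
pose cc (w : n.-tuple 'I_3) := cell_copy p K w (Phi 0%N).
have ccE (w w' : n.-tuple 'I_3) x : K x ->
    cc w (word_map p w' x) = (w' == w)%:R * Phi 0%N x.
  by move=> Kx; rewrite /cc cell_copyE.
have Dcc w : D (cc w) by exact: (glued_domain eqp hK D0 (ccE w)).
(* The 3^n coefficients can satisfy only 3^n - 1 orthogonality conditions nontrivially, whence the
   index (3^n).-1 in the bound. *)
have NN : (#|'I_N.-1| < #|{: n.-tuple 'I_3}|)%N.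
  by rewrite card_tuple !card_ord prednK.
have [a [w0 aw0] aK] := kernel_vector
  (fun (w : n.-tuple 'I_3) (j : 'I_N.-1) => ip (cc w) (Phi j)) NN.
pose U x := \sum_w a w * cc w x.
have UE (w : n.-tuple 'I_3) x : K x -> U (word_map p w x) = a w * Phi 0%N x.
  move=> Kx; rewrite /U (bigD1 w)//= big1 => [|w' ww'].
    by rewrite ccE// eqxx mul1r addr0.
  by rewrite ccE// eq_sym (negPf ww') mul0r mulr0.
have DU : D U by exact: (glued_domain eqp hK D0 UE).
have LU := dirichlet_domain_L2 hK hmu DU.
have EU := glued_energy eqp hK D0 UE.
have Uj j : (j < N.-1)%N -> ip (Phi j) U = 0.
  move=> jN; rewrite dotC -(aK (Ordinal jN)) /U.
  rewrite dot_sum//; last exact: eigen_L2.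
  by move=> w; exact: (dirichlet_domain_L2 hK hmu (Dcc w)).
(* The coefficients of U below N.-1 vanish, and at the remaining indices the eigenvalue is at least
   lam N.-1. *)
have UU : lam N.-1 * ip U U <= energy_form p U U.
  have H : (fun M => lam N.-1 * \sum_(j < M) ip (Phi j) U * ip (Phi j) U) @ \oo
      --> lam N.-1 * ip U U.
    by apply: cvgMr; exact: (l2_sum_cvg mK eigen_L2 (eigen_complete LU) LU).
  rewrite -(cvg_lim (@Rhausdorff R) H); apply: limr_le.
    by apply/cvg_ex; eexists; exact: H.
  apply: nearW => M; apply: le_trans (eigen_bessel M DU).
  rewrite mulr_sumr; apply: ler_sum => j _.
  have [jN|jN] := ltnP j N.-1; first by rewrite Uj// expr0n !mulr0.
  by apply: ler_wpM2r; [exact: sqr_ge0|exact: eigen_homo].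
have A0 : 0 < \sum_w a w ^+ 2.
  rewrite (bigD1 w0)//= ltr_pwDl//; last by apply: sumr_ge0 => j _; exact: sqr_ge0.
  by rewrite exprn_even_gt0.
have LUU : e ^+ 2 * 3^-1 ^+ k * 3^-1 ^+ n * (\sum_w a w ^+ 2) <= ip U U.
  rewrite -lee_fin -dotE//.
  have mv w : measurable (word_map p (w ++ v) @` K) by exact: cell_measurable.
  apply: le_trans (_ : _ <= \int[mu]_(x in K)
    \sum_(w : n.-tuple 'I_3) (a w ^+ 2 * e ^+ 2 * \1_(word_map p (w ++ v) @` K) x)%:E)%E _.
    rewrite ge0_integral_sum//; last 2 first.
    - move=> w; apply/measurable_EFinP.
      by apply: measurable_funM => //; apply: measurable_indic.
    - move=> w x _; rewrite lee_fin; apply: mulr_ge0 => //; apply: mulr_ge0; exact: sqr_ge0.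
    have Iw (w : n.-tuple 'I_3) : (\int[mu]_(x in K) (a w ^+ 2 * e ^+ 2 *
        \1_(word_map p (w ++ v) @` K) x)%:E =
        (a w ^+ 2 * e ^+ 2 * (3^-1) ^+ (n + k))%:E)%E.
      rewrite (integralZl_indic mK (fun=> word_map p (w ++ v) @` K))//; last first.
        move=> h; exfalso; move: h; apply/negP; rewrite -leNgt; apply: mulr_ge0; exact: sqr_ge0.
      rewrite integral_indic// setIidl; last exact: cell_sub.
      by rewrite (cell_mass hmu) size_cat !size_tuple -EFinM.
    rewrite (eq_bigr _ (fun w _ => Iw w)) sumEFin lee_fin -!mulr_suml exprD.
    by rewrite le_eqVlt; apply/orP; left; apply/eqP; ring.
  apply: ge0_le_integral => //.
  - move=> x _; apply: sume_ge0 => w _; rewrite lee_fin.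
    apply: mulr_ge0 => //; apply: mulr_ge0; exact: sqr_ge0.
  - apply: emeasurable_sum => w; apply/measurable_EFinP.
    by apply: measurable_funM => //; apply: measurable_indic.
  - by apply/measurable_EFinP/measurable_funX; have [] := LU.
  - move=> x Kx; have [w _ [y Ky xE]] := gasket_word hK n Kx.
    rewrite sumEFin lee_fin (bigD1 w)//= big1 ?addr0 => [|w' ww'].
      rewrite xE UE// [(a w * _) ^+ 2]exprMn -(mulrA (a w ^+ 2)); apply: ler_wpM2l; first exact: sqr_ge0.
      rewrite indicE; case: (boolP (_ \in _)); last first.
        by move=> _; rewrite mulr0 sqr_ge0.
      rewrite inE mulr1 => -[z Kz]; rewrite word_map_cat => /word_map_inj <-.
      exact: Pv.
    rewrite indicE; case: (boolP (_ \in _)); last by rewrite mulr0.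
    (* A point of the subcell of another word lying in the cell of w would be a vertex image, where
       Phi_0 vanishes, against the lower bound [Pv]. *)
    rewrite inE => -[z Kz]; rewrite word_map_cat xE => e1; exfalso.
    have [[i zi] _] := cell_overlap eqp hK ww' (word_mapK hK v Kz) Ky e1.
    have := Pv z Kz; rewrite zi z0 expr0n /= => /(lt_le_trans (exprn_gt0 2 e0)).
    by rewrite ltxx.
have l0 := eigen_gt0 N.-1.
have E0E : energy_form p (Phi 0%N) (Phi 0%N) = lam 0%N.
  by rewrite eigen_energy// eigen_ortho eqxx mulr1.
rewrite E0E in EU.
have := le_trans (ler_wpM2l (ltW l0) LUU) (le_trans UU EU).
set A := \sum_w _ in A0 *.
have -> : lam N.-1 * (e ^+ 2 * 3^-1 ^+ k * 3^-1 ^+ n * A) =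
  (lam N.-1 * (e ^+ 2 * 3^-1 ^+ k * 3^-1 ^+ n)) * A by ring.
have -> : (5 / 3) ^+ n * A * lam 0%N = (5 / 3) ^+ n * lam 0%N * A by ring.
rewrite (ler_pM2r A0) => h.
have ek : 0 < e ^+ 2 * 3^-1 ^+ k * 3^-1 ^+ n :> R.
  by do 2?[apply: mulr_gt0]; apply: exprn_gt0; rewrite ?invr_gt0.
move: h; rewrite -ler_pdivlMr// => /le_trans; apply.
rewrite expr_div_n !exprVn le_eqVlt; apply/orP; left; apply/eqP.
have : e ^+ 2 != 0 by rewrite expf_neq0// gt_eqF.
have : 3 ^+ k != 0 :> R by rewrite expf_neq0.
have : 3 ^+ n != 0 :> R by rewrite expf_neq0.
move: (e ^+ 2) (3 ^+ k) (3 ^+ n) (5 ^+ n) => x y z t nz ny nx.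
by field; rewrite nx ny nz.
Qed.

End eigenvalues.

(** * Sums of negative powers of the eigenvalues, by triadic blocks *)

Section eigenvalue_series.
Context {R : realType} (lam : nat -> R).
Hypotheses (lam_gt0 : forall j, 0 < lam j)
  (lam_homo : forall i j, (i <= j)%N -> lam i <= lam j).

Lemma sum_triadic (F : nat -> R) n : \sum_(j < 3 ^ n.+1) F j =
  \sum_(j < 3 ^ n) F j + \sum_(3 ^ n <= j < 3 ^ n.+1) F j.
Proof.
rewrite -!(big_mkord xpredT F) /= [LHS](@big_cat_nat _ _ _ (3 ^ n))//.
by rewrite leq_exp2l.
Qed.

Lemma triadic_block n : (3 ^ n.+1 - 3 ^ n = 2 * 3 ^ n)%N.
Proof. by rewrite expnS -{2}(mul1n (3 ^ n)%N) -mulnBl. Qed.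

Lemma powR_exprn (x a : R) n : 0 <= x -> (x ^+ n) `^ a = (x `^ a) ^+ n.
Proof. by move=> x0; rewrite -(powR_mulrn n x0) -(powR_mulrn n (powR_ge0 x a)) powRAC. Qed.

(** The block of indices from 3^n to 3^(n+1) has 2 * 3^n terms, each at least C^(-s) 3^-(n+1); every
    block thus contributes at least the constant c = 2/3 C^(-s). *)
Lemma eigen_series_unbounded C s : 0 < C -> 0 <= s -> 5 `^ s <= 3 ->
  (forall n, lam (3 ^ n).-1 <= C * 5 ^+ n) ->
  forall M, exists n, M < \sum_(j < n) (lam j) `^ (- s).
Proof.
move=> C0 s0 s53 HC M.
pose c := 2 / 3 * C `^ (- s).
have c0 : 0 < c by rewrite mulr_gt0 ?powR_gt0// divr_gt0.
have H n : n%:R * c <= \sum_(j < 3 ^ n) (lam j) `^ (- s).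
  elim: n => [|n IH].
    by rewrite mul0r; apply: sumr_ge0 => j _; exact: powR_ge0.
  rewrite (sum_triadic (fun j => lam j `^ (- s))) -[n.+1%:R]natr1 mulrDl mul1r.
  apply: lerD => //.
  have lo j : (3 ^ n <= j < 3 ^ n.+1)%N ->
      C `^ (- s) * 3 ^- n.+1 <= lam j `^ (- s).
    move=> /andP[_ jn].
    have h1 : lam j <= C * 5 ^+ n.+1.
      apply: le_trans (HC n.+1); apply: lam_homo.
      by rewrite -ltnS prednK// expn_gt0.
    have h2 : lam j `^ s <= C `^ s * 3 ^+ n.+1.
      apply: le_trans (_ : (C * 5 ^+ n.+1) `^ s <= _).
        by apply: ge0_ler_powR => //; rewrite nnegrE ?mulr_ge0 ?exprn_ge0 ?ltW.
      rewrite powRM; [|exact: ltW|exact: exprn_ge0].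
      apply: ler_wpM2l; first exact: powR_ge0.
      by rewrite powR_exprn// ler_pXn2r ?nnegrE ?powR_ge0.
    have h3 : 0 < C `^ s * 3 ^+ n.+1 by apply: mulr_gt0; [exact: powR_gt0|exact: exprn_gt0].
    by rewrite !powRN -invfM lef_pV2// posrE powR_gt0.
  have -> : c = \sum_(3 ^ n <= j < 3 ^ n.+1) (C `^ (- s) * 3 ^- n.+1).
    rewrite sumr_const_nat triadic_block -[RHS]mulr_natr natrM natrX exprS /c.
    have : 3 ^+ n != 0 :> R by rewrite expf_neq0.
    by move: (3 ^+ n) (C `^ (- s)) => x y x0; field.
  by apply: ler_sum_nat => j; exact: lo.
have [n Hn] : exists n : nat, M < n%:R * c.
  exists (Num.bound `|M / c|); rewrite -ltr_pdivrMr//.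
  by apply: le_lt_trans (ler_norm _) _; apply: archi_boundP; exact: normr_ge0.
by exists (3 ^ n)%N; apply: lt_le_trans Hn (H n).
Qed.

(** A block of 2 * 3^n terms, each at most 24^s 5^(-s n), contributes at most a q^n, where the ratio
    q = 3 / 5^s is less than 1. *)
Lemma eigen_series_bounded s : 0 <= s -> 3 < 5 `^ s ->
  (forall n, 5 ^+ n <= 24 * lam (3 ^ n)) ->
  exists M, forall n, \sum_(j < n) (lam j) `^ (- s) <= M.
Proof.
move=> s0 s53 HC.
pose q := 3 / 5 `^ s.
have p5 : 0 < 5 `^ s :> R by rewrite powR_gt0.
have q0 : 0 < q by rewrite divr_gt0.
have q1 : q < 1 by rewrite ltr_pdivrMr// mul1r.
pose a := 2 * 24 `^ s.
have a0 : 0 < a by rewrite mulr_gt0// powR_gt0.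
have H n : \sum_(j < 3 ^ n) (lam j) `^ (- s) <=
    lam 0%N `^ (- s) + a * \sum_(k < n) q ^+ k.
  elim: n => [|n IH].
    by rewrite !big_ord0 mulr0 addr0 expn0 big_ord_recl big_ord0 addr0.
  rewrite (sum_triadic (fun j => lam j `^ (- s))) big_ord_recr /= mulrDr addrA.
  apply: lerD => //.
  have up j : (3 ^ n <= j < 3 ^ n.+1)%N ->
      lam j `^ (- s) <= 24 `^ s * (5 `^ s) ^- n.
    move=> /andP[jn _].
    have h1 : 5 ^+ n <= 24 * lam j.
      by apply: le_trans (HC n) _; rewrite ler_pM2l//; apply: lam_homo.
    have h2 : (5 `^ s) ^+ n <= 24 `^ s * lam j `^ s.
      rewrite -powR_exprn// -powRM//; last exact: ltW.
      apply: ge0_ler_powR => //; first by rewrite nnegrE exprn_ge0.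
      by rewrite nnegrE mulr_ge0// ltW.
    rewrite powRN ler_pdivlMr ?exprn_gt0// mulrC ler_pdivrMr ?powR_gt0//.
  have -> : a * q ^+ n =
      \sum_(3 ^ n <= j < 3 ^ n.+1) (24 `^ s * (5 `^ s) ^- n).
    rewrite sumr_const_nat triadic_block -[RHS]mulr_natr natrM natrX /a /q expr_div_n.
    have : (5 `^ s) ^+ n != 0 :> R by rewrite expf_neq0// gt_eqF.
    by move: (3 ^+ n) ((5 `^ s) ^+ n) (24 `^ s) => x y z y0; field.
  by apply: ler_sum_nat => j; exact: up.
exists (lam 0%N `^ (- s) + a * (1 - q)^-1) => n.
have n3 : (n <= 3 ^ n)%N by apply: ltnW; exact: ltn_expl.
apply: le_trans (_ : \sum_(j < 3 ^ n) (lam j) `^ (- s) <= _).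
  rewrite -!(big_mkord xpredT (fun j => lam j `^ (- s))).
  rewrite [leRHS](@big_cat_nat _ _ _ n)//= lerDl.
  by apply: sumr_ge0 => j _; exact: powR_ge0.
apply: le_trans (H n) _; rewrite lerD2l ler_pM2l//.
have := subrX1 q n; have q1' : 0 < 1 - q by rewrite subr_gt0.
rewrite -[leRHS]mul1r ler_pdivlMr// => E.
have -> : (\sum_(k < n) q ^+ k) * (1 - q) = 1 - q ^+ n.
  by rewrite mulrC -(opprB q) mulNr -E opprB.
by rewrite gerBl exprn_ge0// ltW.
Qed.

(** The factors ln 2 of the two dimensions cancel, so the threshold is ln 3 / (2 ln 5). *)
Lemma critical_exponent s : (s <= hausdorff_dim / (2 * walk_dim)) = (5 `^ (2 * s) <= 3 :> R).
Proof.
have l2 : 0 < ln 2 :> R by rewrite ln_gt0// ltr1n.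
have l5 : 0 < ln 5 :> R by rewrite ln_gt0// ltr1n.
have -> : hausdorff_dim / (2 * walk_dim) = ln 3 / (2 * ln 5) :> R.
  rewrite /hausdorff_dim /walk_dim.
  by field; rewrite !gt_eqF.
rewrite ler_pdivlMr ?mulr_gt0//.
rewrite -[RHS]ler_ln ?posrE ?powR_gt0// ln_powR.
by rewrite mulrA (mulrC s 2).
Qed.

End eigenvalue_series.

(** * Parseval's identity and functions of the Laplacian *)

Section spectral_calculus.
Context {R : realType} (p : 'I_3 -> R * R) (K : set (R * R))
  (mu : {measure set (R * R) -> \bar R}) (lam : nat -> R) (Phi : nat -> R * R -> R).
Hypotheses (eqp : unit_equilateral p) (hK : sierpinski_gasket p K)
  (hmu : selfsimilar_measure p K mu) (hb : dirichlet_eigenbasis p K mu lam Phi).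
Local Notation ip := (dot mu K).
Let mK := gasket_measurable hK.
Let LPhi := eigen_L2 hK hmu hb.
Let ortho := eigen_ortho hb.

Lemma parseval (b c : nat -> R) g h :
  l2_sum mu K (fun j x => b j * Phi j x) g ->
  l2_sum mu K (fun j x => c j * Phi j x) h ->
  (fun n => \sum_(j < n) b j * c j) @ \oo --> ip g h.
Proof.
move=> gb hc; have Lh := hc.1; have := l2_sum_cvg mK LPhi gb Lh.
by under eq_fun do under eq_bigr do rewrite (l2_sum_coef mK LPhi ortho _ hc).
Qed.

(** Without a known sum h the choice could be the default 0; each use therefore first produces some
    sum of the series. *)
Lemma spectral_calculusP phi f h :
  l2_sum mu K (fun j x => phi (lam j) * ip (Phi j) f * Phi j x) h ->
  l2_sum mu K (fun j x => phi (lam j) * ip (Phi j) f * Phi j x)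
    (spectral_calculus K mu lam Phi phi f).
Proof.
by move=> H; exact: (xgetPex (cst 0) (ex_intro _ h H)).
Qed.

(** On an eigenfunction the series has a single nonzero term, so its sum exists whatever phi is. The
    chosen representative enters only through Parseval's identity. *)
Lemma spectral_calculus_eigen phi k :
  inner K mu (spectral_calculus K mu lam Phi phi (Phi k))
             (spectral_calculus K mu lam Phi phi (Phi k)) = phi (lam k) ^+ 2.
Proof.
have S n x : (k < n)%N ->
    \sum_(j < n) phi (lam j) * ip (Phi j) (Phi k) * Phi j x = phi (lam k) * Phi k x.
  move=> kn; rewrite (bigD1 (Ordinal kn)) //= ortho eqxx mulr1 big1 ?addr0// => j jk.
  rewrite ortho (_ : (j == k :> nat) = false) ?mulr0 ?mul0r//; apply/negbTE.
  by apply: contraNneq jk => e; apply/eqP; exact: val_inj.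
have H : l2_sum mu K (fun j x => phi (lam j) * ip (Phi j) (Phi k) * Phi j x)
    (fun x => phi (lam k) * Phi k x).
  split.
    have := square_integrable_linear mK (phi (lam k)) (LPhi k) (square_integrable0 mu K).
    by under eq_fun do rewrite addr0.
  apply: cvg_near_cst; exists k.+1 => // n /= kn.
  by rewrite integral0_eq// => x _; rewrite S// subrr expr0n.
have := spectral_calculusP H => {}H.
apply: (cvg_unique (@Rhausdorff R) (parseval H H)).
apply: cvg_near_cst; exists k.+1 => // n /= kn.
rewrite (bigD1 (Ordinal kn)) //= ortho eqxx mulr1 expr2 big1 ?addr0// => j jk.
rewrite ortho (_ : (j == k :> nat) = false) ?mulr0 ?mul0r//; apply/negbTE.
by apply: contraNneq jk => e; apply/eqP; exact: val_inj.
Qed.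

Lemma test_function_eigen k : test_functions p K mu Phi (Phi k).
Proof.
have [ck _ zk] := eigen_domain hb k; split=> // m.
apply: cvg_near_cst; exists k.+1 => // n /= kn.
have -> : inner K mu (Phi n) (Phi k) = 0.
  by have := ortho n k; rewrite /dot /inner => ->; rewrite gtn_eqF.
by rewrite normr0 mulr0.
Qed.

End spectral_calculus.

(** * Fields with a square integrable density *)

Section restricted_fubini.
Context d1 d2 (T1 : measurableType d1) (T2 : measurableType d2) (R : realType).
Variable m1 : {sigma_finite_measure set T1 -> \bar R}.
Variable m2 : {sigma_finite_measure set T2 -> \bar R}.
Variables (D1 : set T1) (D2 : set T2) (F : T1 * T2 -> \bar R).
Hypotheses (mD1 : measurable D1) (mD2 : measurable D2)
  (mF : measurable_fun (D1 `*` D2) F).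
Local Open Scope ereal_scope.

Let G := F \_ (D1 `*` D2).

Let mD12 : measurable (D1 `*` D2).
Proof. exact: measurableX. Qed.

Let mG : measurable_fun setT G.
Proof. exact/(measurable_restrictT _ mD12). Qed.

(** Extending F by zero turns integrals over D1 and D2 into integrals over whole spaces. H is the
    identity for the iterated integrals and the absolute value for the integrability condition of
    Fubini's theorem. *)
Lemma restrict_section1 (H : \bar R -> \bar R) : H 0 = 0 ->
  (fun x => \int[m2]_y H (G (x, y))) = (fun x => \int[m2]_(y in D2) H (F (x, y))) \_ D1.
Proof.
move=> H0; apply/funext => x; rewrite /patch; case: ifPn => xD1.
  rewrite [RHS]integral_mkcond; apply: eq_integral => y _.
  by rewrite /G /patch in_setX xD1 /=; case: (y \in D2).
by rewrite integral0_eq// => y _; rewrite /G /patch in_setX (negPf xD1) /=.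
Qed.

Lemma restrict_section2 (H : \bar R -> \bar R) : H 0 = 0 ->
  (fun y => \int[m1]_x H (G (x, y))) = (fun y => \int[m1]_(x in D1) H (F (x, y))) \_ D2.
Proof.
move=> H0; apply/funext => y; rewrite /patch; case: ifPn => yD2.
  rewrite [RHS]integral_mkcond; apply: eq_integral => x _.
  by rewrite /G /patch in_setX yD2 andbT /=; case: (x \in D1).
by rewrite integral0_eq// => x _; rewrite /G /patch in_setX (negPf yD2) andbF.
Qed.

Lemma measurable_section1 x : D1 x -> measurable_fun D2 (fun y => F (x, y)).
Proof.
move=> xD1; apply: (@measurable_comp _ _ _ _ _ _ (D1 `*` D2)) => //.
  by move=> _ [y yD2 <-].
by apply: measurable_funTS; exact: pair1_measurable.
Qed.

Lemma measurable_section2 y : D2 y -> measurable_fun D1 (fun x => F (x, y)).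
Proof.
move=> yD2; apply: (@measurable_comp _ _ _ _ _ _ (D1 `*` D2)) => //.
  by move=> _ [x xD1 <-].
by apply: measurable_funTS; exact: pair2_measurable.
Qed.

Let G_ge0 : (forall z, (D1 `*` D2) z -> 0 <= F z) -> forall z, 0 <= G z.
Proof.
by move=> F0 z; rewrite /G /patch; case: ifPn => // /set_mem; exact: F0.
Qed.

Lemma measurable_tonelli1 : (forall z, (D1 `*` D2) z -> 0 <= F z) ->
  measurable_fun D1 (fun x => \int[m2]_(y in D2) F (x, y)).
Proof.
move=> F0; apply/(measurable_restrictT _ mD1).
rewrite -(restrict_section1 (H := id))//.
exact: (measurable_fun_fubini_tonelli_F G mG (G_ge0 F0)).
Qed.

Lemma measurable_tonelli2 : (forall z, (D1 `*` D2) z -> 0 <= F z) ->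
  measurable_fun D2 (fun y => \int[m1]_(x in D1) F (x, y)).
Proof.
move=> F0; apply/(measurable_restrictT _ mD2).
rewrite -(restrict_section2 (H := id))//.
exact: (measurable_fun_fubini_tonelli_G G mG (G_ge0 F0)).
Qed.

Lemma tonelli_on : (forall z, (D1 `*` D2) z -> 0 <= F z) ->
  \int[m1]_(x in D1) \int[m2]_(y in D2) F (x, y) =
  \int[m2]_(y in D2) \int[m1]_(x in D1) F (x, y).
Proof.
move=> F0; rewrite integral_mkcond [RHS]integral_mkcond.
rewrite -(restrict_section1 (H := id))// -(restrict_section2 (H := id))//.
exact: (fubini_tonelli G mG (G_ge0 F0)).
Qed.

Lemma fubini_on : \int[m1]_(x in D1) \int[m2]_(y in D2) `|F (x, y)| < +oo ->
  \int[m1]_(x in D1) \int[m2]_(y in D2) F (x, y) =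
  \int[m2]_(y in D2) \int[m1]_(x in D1) F (x, y).
Proof.
rewrite integral_mkcond -(restrict_section1 (H := abse)) ?abse0// => IF.
rewrite integral_mkcond [RHS]integral_mkcond.
rewrite -(restrict_section1 (H := id))// -(restrict_section2 (H := id))//.
by apply: Fubini; apply/integrable12ltyP.
Qed.

End restricted_fubini.

Section measurable_integral.
Context d1 d2 (T1 : measurableType d1) (T2 : measurableType d2) (R : realType).
Variable m1 : {sigma_finite_measure set T1 -> \bar R}.
Variables (D1 : set T1) (D2 : set T2) (F : T1 * T2 -> R).
Hypotheses (mD1 : measurable D1) (mD2 : measurable D2)
  (mF : measurable_fun (D1 `*` D2) F).

(** No integrability is assumed: the positive and negative parts are measurable by Tonelli, and the
    integral is by definition their difference. It thus covers fields whose paths may fail to be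
    integrable. *)
Lemma measurable_parametric_integral :
  measurable_fun D2 (fun y => \int[m1]_(x in D1) (F (x, y))%:E)%E.
Proof.
pose Fp (z : T1 * T2) := (maxe (F z)%:E 0)%E.
pose Fn (z : T1 * T2) := (maxe (- (F z)%:E) 0)%E.
have mE : measurable_fun (D1 `*` D2) (fun z => (F z)%:E) by exact/measurable_EFinP.
have mp : measurable_fun (D1 `*` D2) Fp by exact: measurable_maxe.
have mn : measurable_fun (D1 `*` D2) Fn.
  by apply: measurable_maxe => //; exact: measurableT_comp.
rewrite (_ : (fun y => _) = (fun y => \int[m1]_(x in D1) Fp (x, y) -
  \int[m1]_(x in D1) Fn (x, y))%E).
  apply: emeasurable_funB.
    by apply: (measurable_tonelli2 m1 mD1 mD2 mp) => z _; rewrite le_max lexx orbT.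
  by apply: (measurable_tonelli2 m1 mD1 mD2 mn) => z _; rewrite le_max lexx orbT.
apply/funext => y; rewrite integralE /Fp /Fn.
by congr (_ - _)%E; apply: eq_integral => x _; rewrite ?funeposE ?funenegE.
Qed.

Lemma measurable_Rintegral :
  measurable_fun D2 (fun y => \int[m1]_(x in D1) F (x, y)).
Proof.
by apply: (measurableT_comp (fine_measurable measurableT));
  exact: measurable_parametric_integral.
Qed.

End measurable_integral.

(** An equality of measures, and not only of values, lets mu be replaced by a probability
    throughout; this supplies the sigma-finiteness needed for Fubini and Tonelli. *)
Lemma measure_is_probability d (T : measurableType d) (R : realType)
    (mu : {measure set T -> \bar R}) : mu setT = 1%E ->
  exists nu : probability T R, (nu : {measure set T -> \bar R}) = mu.
Proof.
case: mu => m [c1 c2] m1.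
pose nu0 := Measure.Pack (@Measure.Class _ _ _ _ c1 c2).
pose B := Measure_isProbability.Build d T R nu0 m1.
pose nu : probability T R := HB.pack m nu0 B.
exists nu. reflexivity.
Qed.

Section fgf_with_density.
Context {R : realType} (p : 'I_3 -> R * R) (K : set (R * R))
  (mu : probability (R * R)%type R) (lam : nat -> R) (Phi : nat -> R * R -> R).
Hypotheses (eqp : unit_equilateral p) (hK : sierpinski_gasket p K)
  (hmu : selfsimilar_measure p K mu) (hb : dirichlet_eigenbasis p K mu lam Phi).
Context d (Omega : measurableType d) (P : probability Omega R).
Local Notation ip := (dot mu K).
Let mK := gasket_measurable hK.
Let LPhi := eigen_L2 hK hmu hb.
Let ortho := eigen_ortho hb.

Lemma gaussian_field_measurable (I : Type) (J : set I) (X : I -> Omega -> R) i :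
  gaussian_field P J X -> J i -> measurable_fun setT (X i).
Proof.
move=> /(_ 1%N (fun=> i) (fun=> 1)) H Ji; have [+ _] := H (fun=> Ji).
by under eq_fun do rewrite big_ord1 mul1r.
Qed.

Lemma fgf_eigen_second_moment s X k :
  fractional_gaussian_field P p K mu lam Phi s X ->
  (\int[P]_w ((X (Phi k) w) ^+ 2)%:E = (lam k `^ (- (2 * s)))%:E)%E.
Proof.
move=> [_ cov]; have tk := test_function_eigen hb k.
have := cov _ _ tk tk; rewrite unlock (spectral_calculus_eigen hK hmu hb) => E.
under eq_integral do rewrite expr2; rewrite E; congr EFin.
by rewrite -powR_mulrn ?powR_ge0// -powRrM; congr (_ `^ _); ring.
Qed.

Lemma trace_le_second_moment s (Y : R * R -> Omega -> R) n :
  jointly_measurable K Y ->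
  fractional_gaussian_field P p K mu lam Phi s (integrated_field K mu Y) ->
  ((\sum_(j < n) lam j `^ (- (2 * s)))%:E <=
    \int[P]_w \int[mu]_(x in K) ((Y x w) ^+ 2)%:E)%E.
Proof.
move=> mY fY.
have mX j : measurable_fun setT (integrated_field K mu Y (Phi j)).
  have [[gY _] _] := fY.
  exact: (gaussian_field_measurable gY (test_function_eigen hb j)).
rewrite -sumEFin.
under eq_bigr do rewrite -(fgf_eigen_second_moment _ fY).
rewrite -ge0_integral_sum//; last 2 first.
- by move=> j; apply/measurable_EFinP; exact: measurable_funX.
- by move=> j w _; rewrite lee_fin sqr_ge0.
have mY2 : measurable_fun (K `*` [set: Omega]) (fun z => ((Y z.1 z.2) ^+ 2)%:E).
  by apply/measurable_EFinP; exact: measurable_funX.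
apply: ge0_le_integral => //.
- by move=> w _; apply: sume_ge0 => j _; rewrite lee_fin sqr_ge0.
- apply: emeasurable_sum => j; apply/measurable_EFinP; exact: measurable_funX.
- apply: (measurable_tonelli2 mu mK measurableT mY2) => z _.
  by rewrite lee_fin sqr_ge0.
- move=> w _; rewrite sumEFin.
  (* Bessel's inequality needs a square integrable path; for the other outcomes w the bound is
     infinite and holds trivially. *)
  have [LY|LY] := ltP (\int[mu]_(x in K) ((Y x w) ^+ 2)%:E)%E +oo%E; last first.
    by apply: le_trans LY; exact: leey.
  have Yw : square_integrable mu K (Y ^~ w).
    split=> //; apply/measurable_EFinP.
    have mYE : measurable_fun (K `*` [set: Omega]) (fun z => (Y z.1 z.2)%:E).
      exact/measurable_EFinP.
    exact: (measurable_section2 mK measurableT mYE (y := w)).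
  rewrite (dotE mK Yw) lee_fin.
  exact: (bessel mK LPhi ortho n Yw).
Qed.

Lemma fgf_density_exponent s (Y : R * R -> Omega -> R) : 0 <= s ->
  jointly_measurable K Y ->
  (\int[P]_w \int[mu]_(x in K) ((Y x w) ^+ 2)%:E < +oo)%E ->
  fractional_gaussian_field P p K mu lam Phi s (integrated_field K mu Y) ->
  hausdorff_dim / (2 * walk_dim) < s.
Proof.
move=> s0 mY Yoo fY; rewrite ltNge critical_exponent; apply/negP => s53.
have [C C0 HC] := eigen_upper eqp hK hmu hb.
have [n] := eigen_series_unbounded (eigen_gt0 hb) (eigen_homo hb) C0
  (mulr_ge0 (ler0n R 2) s0) s53 HC
  (fine (\int[P]_w \int[mu]_(x in K) ((Y x w) ^+ 2)%:E)%E).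
apply/negP; rewrite -leNgt -lee_fin fineK; first exact: trace_le_second_moment.
rewrite ge0_fin_numE//; apply: integral_ge0 => w _; apply: integral_ge0 => x _.
by rewrite lee_fin sqr_ge0.
Qed.

End fgf_with_density.

(** * The heat kernel and the Green function *)

Section gamma.
Context {R : realType}.
Local Notation leb := (@lebesgue_measure R).
Implicit Types a b t : R.

Lemma measurable_positive_half_line : measurable (`]0%R, +oo[%classic : set R).
Proof. exact: measurable_itv. Qed.

(** The change of variable t -> b t: b times the image of Lebesgue measure under this map agrees
    with Lebesgue measure on half-open intervals, hence everywhere by uniqueness. *)
Lemma scaling_integral b (f : R -> R) : 0 < b ->
  measurable_fun (`]0%R, +oo[%classic : set R) f -> (forall t, 0 < t -> 0 <= f t) ->
  (\int[leb]_(t in `]0%R, +oo[) (f t)%:E =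
   b%:E * \int[leb]_(t in `]0%R, +oo[) (f (b * t))%:E)%E.
Proof.
move=> b0 mf f0.
pose phi : measurableTypeR R -> measurableTypeR R := fun t => (b * (t : R))%R.
have mphi : measurable_fun setT phi.
  by apply: measurable_funM => //; exact: measurable_id.
pose nu := measure_function_pushforward__canonical__measure_function_Measure leb mphi.
pose bnn := NngNum (ltW b0).
have phiE : phi @^-1` `]0%R, +oo[ = `]0%R, +oo[%classic.
  by apply/seteqP; split=> t; rewrite /phi /= !in_itv /= !andbT pmulr_rgt0.
have E A : measurable A -> leb A = mscale bnn nu A.
  move=> mA; apply: lebesgue_measure_unique => // _ [[u v]] _ <-.
  suff : leb `]u, v] = (b%:E * leb (phi @^-1` `]u, v]))%E by [].
  have -> : phi @^-1` `]u, v] = `](u / b), (v / b)]%classic.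
    apply/seteqP; split=> t; rewrite /phi /= !in_itv /=.
      by rewrite ltr_pdivrMr// ler_pdivlMr// mulrC.
    by rewrite ltr_pdivrMr// ler_pdivlMr// mulrC.
  rewrite !lebesgue_measure_itv /= !lte_fin ltr_pM2r ?invr_gt0//.
  case: ifP => _; last by rewrite mule0.
  by rewrite -!EFinB -EFinM; congr EFin; field; rewrite gt_eqF.
transitivity (\int[mscale bnn nu]_(t in (`]0%R, +oo[%classic : set (measurableTypeR R))) (f t)%:E)%E.
  by apply: eq_measure_integral => A mA _; exact: E.
have mfE : measurable_fun (`]0%R, +oo[%classic : set (measurableTypeR R)) (EFin \o f).
  exact/measurable_EFinP.
rewrite ge0_integral_mscale//; last first.
  by move=> t /=; rewrite in_itv /= andbT lee_fin; exact: f0.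
rewrite (ge0_integral_pushforward mphi)//; last first.
  by move=> t; rewrite inE /= in_itv /= andbT lee_fin; exact: f0.
by rewrite phiE.
Qed.

Lemma measurable_gamma_integrand a b :
  measurable_fun (`]0%R, +oo[%classic : set R) (fun t => t `^ (a - 1) * expR (- (b * t))).
Proof.
apply: measurable_funTS; apply: measurable_funM; first exact: measurable_powR.
apply: (measurableT_comp (@measurable_expR R)); exact: measurableT_comp.
Qed.

Lemma measurable_gamma_integrand1 a :
  measurable_fun (`]0%R, +oo[%classic : set R) (fun t => t `^ (a - 1) * expR (- t)).
Proof.
rewrite (_ : (fun t => _) = (fun t => t `^ (a - 1) * expR (- (1 * t)))).
  exact: measurable_gamma_integrand.
by apply/funext => t; rewrite mul1r.
Qed.

Lemma powR_le_expR a : 0 < a ->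
  exists2 C, 0 < C & forall t, 0 < t -> 1 + t `^ a <= C * expR (t / 2).
Proof.
move=> a0; have [N aN] : exists N : nat, a <= N.+1%:R.
  exists (Num.bound a); rewrite ltW// (lt_le_trans (archi_boundP (ltW a0)))//.
  by rewrite ler_nat.
pose c : R := 2 ^+ N.+1 * N.+1`!%:R.
have c0 : 0 <= c by rewrite mulr_ge0.
exists (2 + c) => [|t t0]; first by rewrite ltr_pwDl.
have t2 : 0 <= t / 2 by rewrite divr_ge0// ltW.
have e1 : 1 <= expR (t / 2) by rewrite -[leLHS]expR0 ler_expR.
have h1 : t `^ a <= 1 + t ^+ N.+1.
  have [t1|t1] := leP t 1.
    apply: le_trans (_ : 1 <= _); last by rewrite lerDl exprn_ge0// ltW.
    by rewrite -(powRr0 t); apply: ger_powR; [rewrite t0|exact: ltW].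
  apply: le_trans (_ : t `^ N.+1%:R <= _); first by apply: ler_powR => //; exact: ltW.
  by rewrite powR_mulrn ?lerDr// ltW.
have h2 : t ^+ N.+1 <= c * expR (t / 2).
  have := expR_ge1Dxn N t2.
  have f0 : 0 < N.+1`!%:R :> R by rewrite ltr0n fact_gt0.
  rewrite expr_div_n => h.
  have : t ^+ N.+1 / 2 ^+ N.+1 / N.+1`!%:R <= expR (t / 2) by lra.
  by rewrite -mulrA -invfM ler_pdivrMr ?mulr_gt0// mulrC.
by rewrite mulrDl; lra.
Qed.

(** The function H = -1 / (1 + t^a) increases from -1 to 0 on the half-line, so its derivative h has
    integral at most 1 on every compact subinterval. Since (1 + t^a)^2 <= C^2 exp(t), the integrand
    is at most (C^2 / a) h, which treats 0 and infinity together. *)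
Lemma gamma_fin a : 0 < a ->
  (\int[leb]_(t in `]0%R, +oo[) (t `^ (a - 1) * expR (- t))%:E < +oo)%E.
Proof.
move=> a0; have [C C0 HC] := powR_le_expR a0.
pose H t := - (1 + t `^ a)^-1.
pose h t := a * t `^ (a - 1) / (1 + t `^ a) ^+ 2.
pose f t := t `^ (a - 1) * expR (- t).
have pt t : 0 < 1 + t `^ a by rewrite ltr_pwDl// powR_ge0.
have dH t : 0 < t -> is_derive t 1 H (h t).
  move=> t0.
  have d1 := is_derive1_powR a t0.
  have d2 : is_derive t 1 (cst 1 + (fun u => u `^ a)) (0 + a * t `^ (a - 1)).
    have d0 : is_derive t 1 (cst (1 : R)) 0 by exact: is_derive_cst.
    exact: (is_deriveD d0 d1).
  have d3 := @is_deriveV R (cst 1 + (fun u => u `^ a)) t _ 1 (lt0r_neq0 (pt t)) d2.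
  have d4 := is_deriveN d3.
  apply: is_derive_eq d4 _; rewrite /h add0r.
  have -> : (cst 1 + (fun u => u `^ a)) t = 1 + t `^ a by [].
  by rewrite scaleNr opprK /GRing.scale /= mulrC.
have ch t : 0 < t -> {for t, continuous h}.
  move=> t0; have cp (b : R) : {for t, continuous (fun u => u `^ b)}.
    apply: differentiable_continuous; apply/derivable1_diffP.
    by apply: ex_derive; exact: is_derive1_powR.
  apply: continuousM; first by apply: continuousM; [exact: cvg_cst|exact: cp].
  apply: continuousV; first by rewrite expf_neq0// gt_eqF.
  have c1 : {for t, continuous (fun u => 1 + u `^ a)}.
    by apply: continuousD; [exact: cvg_cst|exact: cp].
  exact: continuousM.
have cH t : 0 < t -> {for t, continuous H}.
  move=> t0; apply: differentiable_continuous; apply/derivable1_diffP.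
  by apply: ex_derive; exact: dH.
pose F (n : nat) : set R := `[n.+1%:R^-1, n.+1%:R + 1]%classic.
have F0 n t : F n t -> 0 < t.
  by rewrite /F /= in_itv /= => /andP[+ _]; apply: lt_le_trans; rewrite invr_gt0.
have FE : \bigcup_n F n = `]0%R, +oo[%classic.
  apply/seteqP; split=> t; first by case=> n _ /F0; rewrite /= in_itv /= andbT.
  rewrite /= in_itv /= andbT => t0.
  exists (maxn (Num.bound t) (Num.bound t^-1)) => //.
  set N := maxn _ _; rewrite /F /= in_itv /=.
  have hN1 : t <= N.+1%:R.
    rewrite ltW// (lt_le_trans (archi_boundP (ltW t0)))// ler_nat.
    by rewrite (leq_trans (leq_maxl _ _) (leqnSn _)).
  have hN2 : t^-1 <= N.+1%:R.
    have ti0 : 0 <= t^-1 by rewrite invr_ge0 ltW.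
    rewrite ltW// (lt_le_trans (archi_boundP ti0))// ler_nat.
    by rewrite (leq_trans (leq_maxr _ _) (leqnSn _)).
  apply/andP; split; last by rewrite (le_trans hN1)// lerDl.
  by rewrite -[t]invrK lef_pV2// posrE ?invr_gt0.
have nF : nondecreasing_seq F.
  move=> m n mn; apply/subsetPset => t; rewrite /F /= !in_itv /= => /andP[h1 h2].
  have mnR : m.+1%:R <= n.+1%:R :> R by rewrite ler_nat.
  apply/andP; split.
    by apply: le_trans h1; rewrite lef_pV2// posrE.
  by apply: le_trans h2 _; rewrite lerD2r.
have mf : measurable_fun (`]0%R, +oo[%classic : set R) (fun t => (f t)%:E).
  by apply/measurable_EFinP; exact: measurable_gamma_integrand1.
have f0 t : 0 <= f t by rewrite mulr_ge0 ?powR_ge0 ?expR_ge0.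
have Fs n : F n `<=` `]0%R, +oo[%classic by rewrite -FE; exact: bigcup_sup.
have bound n : (\int[leb]_(t in F n) (f t)%:E <= (C ^+ 2 / a)%:E)%E.
  have uv : n.+1%:R^-1 < n.+1%:R + 1 :> R.
    by rewrite (@le_lt_trans _ _ 1)// ?invf_le1// ?ler1n// ltrDr.
  have Hint : (\int[leb]_(t in F n) (h t)%:E <= 1)%E.
    rewrite (continuous_FTC2 (F := H) uv).
    - rewrite -EFinB lee_fin /H.
      set u := n.+1%:R^-1; set v := n.+1%:R + 1.
      have : 0 < (1 + v `^ a)^-1 by rewrite invr_gt0.
      have : (1 + u `^ a)^-1 <= 1 by rewrite invf_le1// lerDl powR_ge0.
      by lra.
    - apply: continuous_in_subspaceT => t; rewrite inE => /F0; exact: ch.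
    - split.
      + move=> t tn; apply: ex_derive; apply: dH; apply: (F0 n).
        exact: subset_itv_oo_cc tn.
      + apply: cvg_at_right_filter; apply: cH; rewrite invr_gt0//.
      + apply: cvg_at_left_filter; apply: cH; rewrite addr_gt0//.
    - move=> t tn; rewrite derive1E; apply: derive_val; apply: dH; apply: (F0 n).
      exact: subset_itv_oo_cc tn.
  apply: le_trans (_ : \int[leb]_(t in F n) ((C ^+ 2 / a)%:E * (h t)%:E) <= _)%E.
    apply: ge0_le_integral => //.
    - exact: measurable_itv.
    - by move=> t _; rewrite lee_fin.
    - exact: measurable_funS mf.
    - apply/measurable_funeM/measurable_EFinP.
      apply: subspace_continuous_measurable_fun; first exact: measurable_itv.
      apply: continuous_in_subspaceT => t; rewrite inE => /F0; exact: ch.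
    - move=> t /F0 t0; rewrite -EFinM lee_fin /f /h.
      have h1 : (1 + t `^ a) ^+ 2 <= C ^+ 2 * expR t.
        have -> : expR t = expR (t / 2) ^+ 2 by rewrite expr2 -expRD -splitr.
        by rewrite -exprMn ler_pXn2r ?nnegrE ?mulr_ge0 ?expR_ge0 ?HC// ?ltW.
      have -> : C ^+ 2 / a * (a * t `^ (a - 1) / (1 + t `^ a) ^+ 2) =
          t `^ (a - 1) * (C ^+ 2 / (1 + t `^ a) ^+ 2).
        by field; rewrite !gt_eqF.
      apply: ler_wpM2l; first exact: powR_ge0.
      rewrite expRN ler_pdivlMr ?exprn_gt0// mulrC ler_pdivrMr ?expR_gt0//.
  have h0 t : F n t -> (0 <= (h t)%:E)%E.
    move=> _; rewrite lee_fin /h divr_ge0 ?exprn_ge0 ?(ltW (pt t))//.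
    by rewrite mulr_ge0 ?powR_ge0// ltW.
  rewrite ge0_integralZl_EFin//.
  - rewrite -[leRHS]mule1; apply: lee_wpmul2l => //.
    by rewrite lee_fin divr_ge0 ?exprn_ge0 ?ltW.
  - exact: measurable_itv.
  - apply/measurable_EFinP; apply: subspace_continuous_measurable_fun.
      exact: measurable_itv.
    apply: continuous_in_subspaceT => t; rewrite inE => /F0; exact: ch.
  - by rewrite divr_ge0 ?exprn_ge0 ?ltW.
have mFn n : measurable (F n) by exact: measurable_itv.
have cv : (fun n => \int[leb]_(t in F n) (f t)%:E)%E @ \oo -->
    (\int[leb]_(t in \bigcup_n F n) (f t)%:E)%E.
  apply: ge0_nondecreasing_set_cvg_integral => //.
    by move=> n; exact: measurable_funS mf.
  by move=> n x _; rewrite lee_fin.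
apply: (@le_lt_trans _ _ (C ^+ 2 / a)%:E); last exact: ltry.
rewrite -FE -(cvg_lim (@ereal_hausdorff R) cv); apply: lime_le.
  by apply/cvg_ex; eexists; exact: cv.
exact: nearW.
Qed.

Lemma gamma_integral_E a : 0 < a ->
  (\int[leb]_(t in `]0%R, +oo[) (t `^ (a - 1) * expR (- t))%:E = (euler_gamma a)%:E)%E.
Proof.
move=> a0; rewrite /euler_gamma /Rintegral fineK// ge0_fin_numE; first exact: gamma_fin.
by apply: integral_ge0 => t _; rewrite lee_fin mulr_ge0 ?powR_ge0 ?expR_ge0.
Qed.

Lemma gamma_gt0 a : 0 < a -> 0 < euler_gamma a :> R.
Proof.
move=> a0; have f0 t : 0 <= t `^ (a - 1) * expR (- t) by rewrite mulr_ge0 ?powR_ge0 ?expR_ge0.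
rewrite lt0r; apply/andP; split; last first.
  by apply: Rintegral_ge0 => t _.
apply/eqP => g0; have := gamma_integral_E a0; rewrite g0 => I0.
have mf : measurable_fun (`]0%R, +oo[%classic : set R)
    (fun t => (t `^ (a - 1) * expR (- t))%:E).
  by apply/measurable_EFinP; exact: measurable_gamma_integrand1.
have [+ _] := ae_eq_integral_abs leb measurable_positive_half_line mf.
have -> : (\int[leb]_(t in `]0%R, +oo[) `|(t `^ (a - 1) * expR (- t))%:E| =
   \int[leb]_(t in `]0%R, +oo[) (t `^ (a - 1) * expR (- t))%:E)%E.
  by apply: eq_integral => t _; rewrite gee0_abs// lee_fin.
move=> /(_ I0) [N [mN N0 HN]].
have : (leb (`]0%R, 1%R[%classic : set R) <= leb N)%E.
  apply: le_measure; rewrite ?inE//.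
  move=> t; rewrite /= in_itv /= => /andP[t0 _]; apply: HN => /= H.
  have := H; rewrite in_itv /= andbT => /(_ t0) [] /eqP.
  by rewrite gt_eqF// mulr_gt0 ?powR_gt0 ?expR_gt0.
by rewrite N0 lebesgue_measure_itv /= lte_fin ltr01 oppr0 adde0 lee_fin ler10.
Qed.

(** The Laplace transform by which integration in time turns exp(- lam t) into lam^(-s). *)
Lemma gamma_integral_scaled a b : 0 < a -> 0 < b ->
  (\int[leb]_(t in `]0%R, +oo[) (t `^ (a - 1) * expR (- (b * t)))%:E =
   (euler_gamma a * b `^ (- a))%:E)%E.
Proof.
move=> a0 b0.
have mf : measurable_fun (`]0%R, +oo[%classic : set R) (fun t => t `^ (a - 1) * expR (- t)).
  exact: measurable_gamma_integrand1.
have f0 t : 0 < t -> 0 <= t `^ (a - 1) * expR (- t) by rewrite mulr_ge0 ?powR_ge0 ?expR_ge0.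
have := scaling_integral b0 mf f0; rewrite gamma_integral_E//.
have -> : (\int[leb]_(t in `]0%R, +oo[) ((b * t) `^ (a - 1) * expR (- (b * t)))%:E =
  (b `^ (a - 1))%:E * \int[leb]_(t in `]0%R, +oo[) (t `^ (a - 1) * expR (- (b * t)))%:E)%E.
  rewrite -ge0_integralZl_EFin//.
  - apply: eq_integral => t; rewrite inE /= in_itv /= andbT => t0.
    by rewrite -EFinM powRM ?ltW// mulrA.
  - by move=> t _; rewrite lee_fin mulr_ge0 ?powR_ge0 ?expR_ge0.
  - by apply/measurable_EFinP; exact: measurable_gamma_integrand.
  - exact: powR_ge0.
rewrite muleA -EFinM mulr_powRB1 ?(ltW b0)// => E.
have ba : b `^ a != 0 by rewrite gt_eqF// powR_gt0.
by rewrite EFinM E powRN muleC muleA -EFinM mulVf// mul1e.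
Qed.

End gamma.

(** * Uniform and L2 convergence of dominated series *)

Section uniform_series.
Context {R : realType} {T : Type} (A : set T) (u : nat -> T -> R) (b : nat -> R) (M : R).
Hypotheses (ub : forall j x, A x -> `|u j x| <= b j)
  (bM : forall n, \sum_(j < n) b j <= M) (b0 : forall j, 0 <= b j).

Definition series_sum (v : nat -> T -> R) (x : T) : R :=
  limn (fun n => \sum_(j < n) v j x).

Let B n := \sum_(j < n) b j.

Let ndB : nondecreasing_seq B.
Proof. apply/nondecreasing_seqP => n. by rewrite /B big_ord_recr /= lerDl; exact: b0. Qed.

Let cB : cvgn B.
Proof. by apply: nondecreasing_is_cvgn ndB _; exists M => _ [n _ <-]; exact: bM. Qed.

Let partial_diff x n m : A x -> (n <= m)%N ->
  `|\sum_(j < m) u j x - \sum_(j < n) u j x| <= B m - B n.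
Proof.
move=> Ax nm; rewrite /B -!(big_mkord xpredT (fun j => u j x)) -!(big_mkord xpredT b).
rewrite ![in leLHS](@big_cat_nat _ _ _ n 0 m)//= ![in leRHS](@big_cat_nat _ _ _ n 0 m)//=.
rewrite addrAC subrr add0r addrAC subrr add0r.
by apply: le_trans (ler_norm_sum _ _ _) _; apply: ler_sum => j _; exact: ub.
Qed.

Lemma series_sum_cvg x : A x ->
  (fun n => \sum_(j < n) u j x) @ \oo --> series_sum u x.
Proof.
move=> Ax; suff : cvgn (fun n => \sum_(j < n) u j x) by [].
have sE (v : nat -> R) : (fun n => \sum_(j < n) v j) = series v.
  by apply/funext => n; rewrite /series /= big_mkord.
rewrite (sE (fun j => u j x)); apply: normed_cvg.
apply: (@series_le_cvg _ (fun j => `|u j x|) b) => //.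
  by move=> j; exact: ub.
by rewrite -sE; exact: cB.
Qed.

Lemma series_sum_tail : exists2 r : nat -> R, r @ \oo --> 0 &
  forall x n, A x -> `|series_sum u x - \sum_(j < n) u j x| <= r n.
Proof.
exists (fun n => limn B - B n).
  by rewrite -[X in _ --> X](subrr (limn B)); apply: cvgB; [exact: cvg_cst|exact: cB].
move=> x n Ax.
have c1 : (fun m => `|\sum_(j < m) u j x - \sum_(j < n) u j x|) @ \oo -->
    `|series_sum u x - \sum_(j < n) u j x|.
  by apply: cvg_norm; apply: cvgB; [exact: series_sum_cvg|exact: cvg_cst].
rewrite -(cvg_lim (@Rhausdorff R) c1); apply: limr_le.
  by apply/cvg_ex; eexists; exact: c1.
exists n => // m /= nm; apply: le_trans (partial_diff Ax nm) _.
by rewrite lerD2r; exact: nondecreasing_cvgn_le.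
Qed.

End uniform_series.

Lemma uniform_limit_continuous {R : realType} {V : normedModType R} (A : set V)
    (f : nat -> V -> R) (g : V -> R) (r : nat -> R) :
  (forall n, {within A, continuous (f n)}) -> r @ \oo --> (0 : R) ->
  (forall x n, A x -> `|g x - f n x| <= r n) -> {within A, continuous g}.
Proof.
move=> cf r0 H; apply/within_continuousP => x Ax e e0.
have e3 : 0 < e / 3 by rewrite divr_gt0.
have /cvgrPdist_lt/(_ _ e3) [n _ Hn] := r0.
have rn : r n < e / 3.
  by have := Hn n (leqnn n); rewrite /= sub0r normrN; apply: le_lt_trans; exact: ler_norm.
have [d d0 Hd] := (within_continuousP _ _).1 (cf n) x Ax _ e3.
exists d => // y Ay xy.
have h1 := H x n Ax; have h2 := H y n Ay; have h3 := Hd y Ay xy.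
have := ler_normD (g x - f n x) ((f n x - f n y) - (g y - f n y)).
have := ler_normB (f n x - f n y) (g y - f n y).
rewrite (_ : g x - f n x + (f n x - f n y - (g y - f n y)) = g x - g y); last by ring.
by lra.
Qed.

Section l2_more.
Context {R : realType} d (T : measurableType d) (mu : {measure set T -> \bar R})
  (D : set T).
Hypothesis mD : measurable D.

(** The squared distance of g and h is at most twice the sum of their squared distances to a partial
    sum. This ties the representative picked by [xget] to an explicit pointwise series. *)
Lemma l2_sum_unique u (g h : T -> R) : l2_sum mu D u g -> l2_sum mu D u h ->
  (forall n, square_integrable mu D (fun x => \sum_(j < n) u j x)) ->
  {ae mu, forall x, D x -> g x = h x}.
Proof.
move=> [Lg ug] [Lh uh] Lu; have Lgh := square_integrableB mD Lg Lh.
pose v n x := \sum_(j < n) u j x.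
pose E n := 2 * dot mu D (fun x => g x - v n x) (fun x => g x - v n x) +
   2 * dot mu D (fun x => h x - v n x) (fun x => h x - v n x).
have c (k : T -> R) : square_integrable mu D k ->
   (fun n => \int[mu]_(x in D) ((k x - v n x) ^+ 2)%:E)%E @ \oo --> 0%E ->
   (fun n => dot mu D (fun x => k x - v n x) (fun x => k x - v n x)) @ \oo --> (0 : R).
  move=> Lk; under eq_fun => n do rewrite (dotE mD (square_integrableB mD Lk (Lu n))).
  by move/fine_cvg.
have E0 : E @ \oo --> (0 : R).
  rewrite -[X in _ --> X](addr0 0) -[X in _ --> X + _](mulr0 2) -[X in _ --> _ + X](mulr0 2).
  by apply: cvgD; apply: cvgMr; exact: c.
have HE n : dot mu D (fun x => g x - h x) (fun x => g x - h x) <= E n.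
  have L1 := square_integrableB mD Lg (Lu n); have L2 := square_integrableB mD Lh (Lu n).
  have := dot_ge0 mu D (fun x => (g x - v n x) + (h x - v n x)).
  have L3 := square_integrable_linear mD 1 L1 L2.
  have -> : (fun x => (g x - v n x) + (h x - v n x)) =
    (fun x => 1 * (g x - v n x) + (h x - v n x)) by apply/funext => x; rewrite mul1r.
  rewrite (dot_linear mD 1 L1 L2 L3) !(dotC _ _ _ (fun=> _ * _ + _)).
  rewrite !(dot_linear mD 1 L1 L2)//.
  have -> : (fun x => g x - h x) = (fun x => (g x - v n x) - (h x - v n x)).
    by apply/funext => x; ring.
  rewrite (dotBB mD L1 L2) /E (dotC mu D (fun x => h x - v n x) (fun x => g x - v n x)).
  by lra.
have gh0 : dot mu D (fun x => g x - h x) (fun x => g x - h x) = 0.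
  apply/eqP; rewrite eq_le dot_ge0 andbT -(cvg_lim (@Rhausdorff R) E0).
  apply: limr_ge; first by apply/cvg_ex; eexists; exact: E0.
  exact: nearW.
have := ae_eq_dot0 mD Lgh gh0; apply: filterS => x H Dx.
by apply/eqP; rewrite -subr_eq0; apply/eqP; exact: H.
Qed.

Lemma uniform_l2_sum (u : nat -> T -> R) (h : T -> R) (r : nat -> R) :
  (mu D < +oo)%E -> (forall n, measurable_fun D (fun x => \sum_(j < n) u j x)) ->
  square_integrable mu D h -> r @ \oo --> (0 : R) ->
  (forall x n, D x -> `|h x - \sum_(j < n) u j x| <= r n) -> l2_sum mu D u h.
Proof.
move=> muD mu_ Lh r0 H; split=> //.
have muD0 : mu D \is a fin_num by rewrite ge0_fin_numE.
have c2 : (fun n => (r n ^+ 2 * fine (mu D))%:E) @ \oo --> 0%E.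
  apply/cvg_EFin; first exact: nearW.
  rewrite -[X in _ --> X](mul0r (fine (mu D))); apply: cvgMl.
  rewrite -[X in _ --> X](expr0n R 2); exact: cvgM.
apply: (squeeze_cvge _ (cvg_cst _) c2); apply: nearW => n; apply/andP; split.
  by apply: integral_ge0 => x _; rewrite lee_fin sqr_ge0.
rewrite EFinM fineK// -integral_cst//.
apply: ge0_le_integral => //.
- by move=> x _; rewrite lee_fin sqr_ge0.
- by apply/measurable_EFinP/measurable_funX/measurable_funB; [have [] := Lh|].
- move=> x Dx; rewrite lee_fin -[leLHS]ger0_norm ?sqr_ge0// normrX.
  by have h1 := H x n Dx; rewrite ler_pXn2r ?nnegrE// (le_trans _ h1).
Qed.

End l2_more.

Lemma expR_decay {R : realType} k (x : R) : 0 <= x ->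
  expR (- x) * x ^+ k.+1 <= k.+1`!%:R.
Proof.
move=> x0; have f0 : 0 < k.+1`!%:R :> R by rewrite ltr0n fact_gt0.
rewrite expRN mulrC ler_pdivrMr ?expR_gt0// -ler_pdivrMl// mulrC.
by apply: le_trans (expR_ge1Dxn k x0); rewrite lerDr.
Qed.

(** * The eigenfunction expansion of the heat kernel *)

Section heat_kernel.
Context {R : realType} (p : 'I_3 -> R * R) (K : set (R * R))
  (mu : {measure set (R * R) -> \bar R}) (lam : nat -> R) (Phi : nat -> R * R -> R).
Hypotheses (eqp : unit_equilateral p) (hK : sierpinski_gasket p K)
  (hmu : selfsimilar_measure p K mu) (hb : dirichlet_eigenbasis p K mu lam Phi).
Local Notation ip := (dot mu K).
Local Notation L2' := (square_integrable mu K).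
Let mK := gasket_measurable hK.
Let LPhi := eigen_L2 hK hmu hb.
Let ortho := eigen_ortho hb.
Let lam_gt0 := eigen_gt0 hb.

Let c0 := 24 + (lam 0%N)^-1.

Let c0_gt0 : 0 < c0.
Proof. by rewrite ltr_pwDl// invr_ge0 ltW. Qed.

(** From |u| <= 1 + u^2 and [eigen_sup], with 1 <= lam_j / lam_0. A linear bound is coarser than a
    square root one but keeps all later estimates polynomial in lam_j. *)
Lemma eigen_abs j x : K x -> `|Phi j x| <= c0 * lam j.
Proof.
move=> Kx; have h := eigen_sup eqp hK hmu hb j Kx; have l0 := lam_gt0 0.
have h1 : 1 <= (lam 0%N)^-1 * lam j.
  by rewrite mulrC ler_pdivlMr// mul1r; exact: (eigen_homo hb).
have h2 : `|Phi j x| <= 1 + Phi j x ^+ 2.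
  rewrite -[Phi j x ^+ 2]ger0_norm ?sqr_ge0// normrX.
  by have := sqr_ge0 (`|Phi j x| - 1); have := normr_ge0 (Phi j x); nra.
by rewrite /c0 mulrDl; lra.
Qed.

(** Exponent 1 is admissible because 3 < 5; this series dominates all the expansions below. *)
Lemma inverse_eigen_series : exists M, forall n, \sum_(j < n) (lam j)^-1 <= M.
Proof.
have p5 : 3 < 5 `^ 1 :> R by rewrite powRr1// ltr_nat.
have [M HM] := eigen_series_bounded lam_gt0 (eigen_homo hb) ler01 p5
  (eigen_lower eqp hK hmu hb).
exists M => n; have := HM n; congr (_ <= M); apply: eq_bigr => j _.
by rewrite powR_inv1// ltW.
Qed.

Lemma eigen_partial_measurable (a : nat -> R) n :
  measurable_fun K (fun x => \sum_(j < n) a j * Phi j x).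
Proof. by have [] := partial_sum_L2 mK LPhi a n. Qed.

Section rapid.
Context (a : nat -> R) (M : R).
Hypothesis aM : forall j, `|a j| * lam j ^+ 2 <= M.

Let M0 : 0 <= M.
Proof. by apply: le_trans (aM 0%N); rewrite mulr_ge0// exprn_ge0// ltW. Qed.

(** Of the two powers of lam_j that the coefficients absorb, one pays for the sup of Phi_j and the
    other leaves the summable 1 / lam_j. *)
Let bnd j x : K x -> `|a j * Phi j x| <= M * c0 * (lam j)^-1.
Proof.
move=> Kx; rewrite normrM; have l0 := lam_gt0 j.
apply: le_trans (ler_wpM2l (normr_ge0 _) (eigen_abs j Kx)) _.
rewrite ler_pdivlMr//; have := ler_wpM2r (ltW c0_gt0) (aM j).
by congr (_ <= _); ring.
Qed.

Let sumb : exists N, forall n, \sum_(j < n) M * c0 * (lam j)^-1 <= N.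
Proof.
have [N HN] := inverse_eigen_series; exists (M * c0 * N) => n.
by rewrite -mulr_sumr; apply: ler_wpM2l; [rewrite mulr_ge0// ltW|exact: HN].
Qed.

Let b0 j : 0 <= M * c0 * (lam j)^-1.
Proof. by rewrite !mulr_ge0 ?invr_ge0 ?(ltW c0_gt0) ?(ltW (lam_gt0 j)). Qed.

Lemma rapid_cvg x : K x -> (fun n => \sum_(j < n) a j * Phi j x) @ \oo -->
  series_sum (fun j x => a j * Phi j x) x.
Proof. by have [N HN] := sumb; move=> Kx; exact: (series_sum_cvg bnd HN b0 Kx). Qed.

Lemma rapid_measurable : measurable_fun K (series_sum (fun j x => a j * Phi j x)).
Proof.
apply: (measurable_fun_cvg (fun n => eigen_partial_measurable a n)).
by move=> x Kx; exact: rapid_cvg.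
Qed.

Lemma rapid_sum : l2_sum mu K (fun j x => a j * Phi j x)
  (series_sum (fun j x => a j * Phi j x)).
Proof.
have [N HN] := sumb; have [r r0 Hr] := series_sum_tail bnd HN b0.
apply: (uniform_l2_sum mK _ (eigen_partial_measurable a) _ r0).
- by rewrite (gasket_mass hmu) ltry.
- apply: (bounded_square_integrable hK hmu (M := r 0%N)); first exact: rapid_measurable.
  by move=> x Kx; have := Hr x 0%N Kx; rewrite big_ord0 subr0.
- by move=> x n Kx; exact: Hr.
Qed.

End rapid.

Lemma heat_decay (t l : R) k : 0 < t -> 0 < l ->
  expR (- (t * l)) * l ^+ k.+1 <= k.+1`!%:R / t ^+ k.+1.
Proof.
move=> t0 l0; rewrite ler_pdivlMr ?exprn_gt0// -mulrA -exprMn (mulrC l).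
by apply: expR_decay; rewrite mulr_ge0// ltW.
Qed.

(** The Mercer expansion of the heat kernel, as a function of the pair so that joint continuity can
    be stated. *)
Definition heat_series (t : R) (z : (R * R) * (R * R)) : R :=
  series_sum (fun j z => expR (- (t * lam j)) * (Phi j z.1 * Phi j z.2)) z.

Section fixed_time.
Variable t : R.
Hypothesis t0 : 0 < t.

Let bnd j z : (K `*` K) z ->
  `|expR (- (t * lam j)) * (Phi j z.1 * Phi j z.2)| <=
   c0 ^+ 2 * (3`!%:R / t ^+ 3) * (lam j)^-1.
Proof.
move=> [K1 K2]; rewrite !normrM (ger0_norm (expR_ge0 _)).
have h1 := eigen_abs j K1; have h2 := eigen_abs j K2; have l0 := lam_gt0 j.
have h3 := ler_pM (normr_ge0 _) (normr_ge0 _) h1 h2.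
apply: le_trans (ler_wpM2l (expR_ge0 _) h3) _.
(* Three powers of lam_j are absorbed by the exponential: two for the factors Phi_j(z.1) and
   Phi_j(z.2), one to leave 1 / lam_j. *)
have h4 := heat_decay 2 t0 l0; rewrite ler_pdivlMr//.
have := ler_wpM2l (exprn_ge0 2 (ltW c0_gt0)) h4.
by apply: le_trans; rewrite le_eqVlt; apply/orP; left; apply/eqP; ring.
Qed.

Let sumb : exists N, forall n, \sum_(j < n) c0 ^+ 2 * (3`!%:R / t ^+ 3) * (lam j)^-1 <= N.
Proof.
have [N HN] := inverse_eigen_series; exists (c0 ^+ 2 * (3`!%:R / t ^+ 3) * N) => n.
rewrite -mulr_sumr; apply: ler_wpM2l; last exact: HN.
by rewrite mulr_ge0 ?exprn_ge0 ?(ltW c0_gt0)// divr_ge0// exprn_ge0// ltW.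
Qed.

Let b0 j : 0 <= c0 ^+ 2 * (3`!%:R / t ^+ 3) * (lam j)^-1.
Proof.
rewrite mulr_ge0 ?invr_ge0 ?(ltW (lam_gt0 j))//.
by rewrite mulr_ge0 ?exprn_ge0 ?(ltW c0_gt0)// divr_ge0// exprn_ge0// ltW.
Qed.

Lemma heat_series_cvg z : (K `*` K) z ->
  (fun n => \sum_(j < n) expR (- (t * lam j)) * (Phi j z.1 * Phi j z.2)) @ \oo -->
  heat_series t z.
Proof. by have [N HN] := sumb; exact: (series_sum_cvg bnd HN b0). Qed.

Lemma within_product_continuous (f g : R * R -> R) :
  {within K, continuous f} -> {within K, continuous g} ->
  {within K `*` K, continuous (fun z => f z.1 * g z.2)}.
Proof.
move=> /within_continuousP cf /within_continuousP cg.
have c1 : {within K `*` K, continuous (fun z : (R * R) * (R * R) => f z.1)}.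
  apply/within_continuousP => x [K1 K2] e e0; have [r r0 Hr] := cf _ K1 e e0.
  exists r => // y [K3 K4] xy; apply: Hr => //; apply: le_lt_trans xy.
  by rewrite [leRHS]/Num.norm /= le_max lexx.
have c2 : {within K `*` K, continuous (fun z : (R * R) * (R * R) => g z.2)}.
  apply/within_continuousP => x [K1 K2] e e0; have [r r0 Hr] := cg _ K2 e e0.
  exists r => // y [K3 K4] xy; apply: Hr => //; apply: le_lt_trans xy.
  by rewrite [leRHS]/Num.norm /= le_max lexx orbT.
by move=> z; apply: cvgM; [exact: c1|exact: c2].
Qed.

Lemma heat_series_continuous : {within K `*` K, continuous (heat_series t)}.
Proof.
have [N HN] := sumb; have [r r0 Hr] := series_sum_tail bnd HN b0.
apply: (uniform_limit_continuous _ r0 Hr); elim=> [|n IH].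
  under eq_fun do rewrite big_ord0; by move=> z; exact: cvg_cst.
under eq_fun do rewrite big_ord_recr /=.
have [cn _ _] := eigen_domain hb n.
have cnn := within_product_continuous cn cn.
by move=> z; apply: cvgD; [exact: IH|apply: cvgMr; exact: cnn].
Qed.

Lemma heat_series_coef x : K x -> forall j,
  `|expR (- (t * lam j)) * Phi j x| * lam j ^+ 2 <= c0 * (3`!%:R / t ^+ 3).
Proof.
move=> Kx j; rewrite normrM (ger0_norm (expR_ge0 _)).
have h1 := eigen_abs j Kx; have l0 := lam_gt0 j.
have h2 := ler_wpM2r (exprn_ge0 2 (ltW l0)) (ler_wpM2l (expR_ge0 (- (t * lam j))) h1).
apply: le_trans h2 _.
have := ler_wpM2l (ltW c0_gt0) (heat_decay 2 t0 l0).
by apply: le_trans; rewrite le_eqVlt; apply/orP; left; apply/eqP; ring.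
Qed.

Lemma heat_series_section x : K x ->
  l2_sum mu K (fun j y => expR (- (t * lam j)) * Phi j x * Phi j y)
    (series_sum (fun j y => expR (- (t * lam j)) * Phi j x * Phi j y)).
Proof. by move=> Kx; exact: (rapid_sum (heat_series_coef Kx)). Qed.

Lemma heat_series_sectionE x y : heat_series t (x, y) =
  series_sum (fun j y => expR (- (t * lam j)) * Phi j x * Phi j y) y.
Proof.
by rewrite /heat_series /series_sum; under eq_fun do under eq_bigr do rewrite mulrA.
Qed.

Lemma heat_semigroup_coef f : L2' f -> forall j,
  `|expR (- (t * lam j)) * ip (Phi j) f| * lam j ^+ 2 <=
  (1 + ip f f) * (2`!%:R / t ^+ 2).
Proof.
move=> Lf j; rewrite normrM (ger0_norm (expR_ge0 _)); have l0 := lam_gt0 j.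
have h1 : `|ip (Phi j) f| <= 1 + ip f f.
  have := cauchy_schwarz mK (LPhi j) Lf; rewrite ortho eqxx mul1r.
  rewrite -[leLHS]ger0_norm ?sqr_ge0// normrX.
  by have := sqr_ge0 (`|ip (Phi j) f| - 1); have := normr_ge0 (ip (Phi j) f); nra.
have h2 := ler_wpM2l (mulr_ge0 (expR_ge0 (- (t * lam j))) (exprn_ge0 2 (ltW l0))) h1.
have h3 := heat_decay 1 t0 l0.
have f0 : 0 <= 1 + ip f f by rewrite addr_ge0// dot_ge0.
have h4 := ler_wpM2l f0 h3.
apply: le_trans h4; apply: le_trans (_ : _ <= expR (- (t * lam j)) * lam j ^+ 2 * (1 + ip f f)) _.
  by apply: le_trans h2; rewrite le_eqVlt; apply/orP; left; apply/eqP; ring.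
by rewrite le_eqVlt; apply/orP; left; apply/eqP; ring.
Qed.

Lemma heat_semigroup_integral f : L2' f ->
  {ae mu, forall x, K x -> heat_semigroup K mu lam Phi t f x =
     ip (fun y => heat_series t (x, y)) f}.
Proof.
move=> Lf; have H := rapid_sum (heat_semigroup_coef Lf).
have H2 := spectral_calculusP (phi := fun l => expR (- (t * l))) H.
have Lp := partial_sum_L2 mK LPhi (fun j => expR (- (t * lam j)) * ip (Phi j) f).
have := l2_sum_unique mK H2 H Lp.
apply: filterS => x Hx Kx; rewrite /heat_semigroup Hx//.
have c1 := rapid_cvg (heat_semigroup_coef Lf) Kx.
have c2 := l2_sum_cvg mK LPhi (heat_series_section Kx) Lf.
have E : (fun n => \sum_(j < n) expR (- (t * lam j)) * Phi j x * ip (Phi j) f) =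
  (fun n => \sum_(j < n) expR (- (t * lam j)) * ip (Phi j) f * Phi j x).
  by apply/funext => n; apply: eq_bigr => j _; rewrite mulrAC.
rewrite E in c2; rewrite (cvg_unique (@Rhausdorff R) c1 c2).
by congr dot; apply/funext => y; rewrite heat_series_sectionE.
Qed.

End fixed_time.

(** Every cell has positive mass, so it is not contained in a null set. *)
Lemma positive_mass_ae w (Q : R * R -> Prop) :
  {ae mu, forall x, K x -> Q x} -> exists2 x, K x & Q (word_map p w x).
Proof.
move=> [N [mN N0 HN]]; apply: contrapT => H.
have : (mu (word_map p w @` K) <= mu N)%E.
  apply: le_measure; rewrite ?inE//; first exact: cell_measurable.
  move=> _ [x Kx <-]; apply: HN => /= h; apply: H; exists x => //.
  exact: h (word_mapK hK w Kx).
rewrite N0 (cell_mass hmu) lee_fin leNgt exprn_gt0// invr_gt0//.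
Qed.

(* Both kernels are continuous, so that testing against indicators of small cells
   shows that they agree everywhere. *)
Lemma heat_kernelE pt : heat_kernel K mu lam Phi pt ->
  forall t x y, 0 < t -> K x -> K y -> pt t x y = heat_series t (x, y).
Proof.
move=> hpt t x0 y0 t0 Kx0 Ky0; have [cpt ptE] := hpt t t0.
pose D (z : (R * R) * (R * R)) := pt t z.1 z.2 - heat_series t z.
have cD : {within K `*` K, continuous D}.
  by move=> z; apply: cvgB; [exact: cpt|exact: heat_series_continuous].
apply: contrapT => /eqP ne.
have D0 : D (x0, y0) != 0 by rewrite subr_eq0.
pose e := `|D (x0, y0)| / 2; have e0 : 0 < e by rewrite divr_gt0// normr_gt0.
have Kz0 : (K `*` K) (x0, y0) by [].
have [r r0 Hr] := (within_continuousP _ _).1 cD _ Kz0 _ e0.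
have [n Hn] := word_map_small hK r0.
have [v _ [x1 Kx1 x0E]] := gasket_word hK n Kx0.
have [w _ [y1 Ky1 y0E]] := gasket_word hK n Ky0.
pose f : R * R -> R := \1_(word_map p w @` K).
have mw : measurable (word_map p w @` K) by exact: cell_measurable.
have mf : measurable_fun K f by exact: measurable_indic.
have Lf : L2' f.
  apply: (bounded_square_integrable hK hmu (M := 1)) => // x _.
  by rewrite /f indicE; case: (_ \in _); rewrite ?normr1// normr0.
have ae1 := ptE f Lf; have ae2 := heat_semigroup_integral t0 Lf.
(* The kernels are known to agree against f only for almost every x; a good point is picked in the
   small cell v around x0. *)
have [x2 Kx2] : exists2 x, K x & ip (fun y => pt t (word_map p v x) y) f =
    ip (fun y => heat_series t (word_map p v x, y)) f.
  apply: (@positive_mass_ae v (fun x => ip (fun y => pt t x y) f =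
    ip (fun y => heat_series t (x, y)) f)).
  by apply: filterS2 ae1 ae2 => x h1 h2 Kx; rewrite -h2// -h1.
set x3 := word_map p v x2 => E.
have Kx3 : K x3 by exact: word_mapK.
have sec (F : (R * R) * (R * R) -> R) : {within K `*` K, continuous F} ->
    L2' (fun y => F (x3, y)).
  move=> /within_continuousP cF; apply: (within_continuous_L2 hK hmu).
  apply/within_continuousP => y Ky a a0.
  have [b b0' Hb] := cF (x3, y) (conj Kx3 Ky) a a0.
  exists b => // y' Ky' yy'; apply: Hb => //.
  have -> : `|(x3, y) - (x3, y')| = Num.max `|x3 - x3| `|y - y'| by [].
  by rewrite subrr normr0 gt_max b0'.
have L1 := sec _ cpt; have L2 := sec _ (heat_series_continuous t0).
have LD := sec _ cD.
have DE : ip (fun y => D (x3, y)) f = 0.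
  by rewrite (dotBl mK L1 L2 Lf); apply/eqP; rewrite subr_eq0; apply/eqP.
have Dnear y : (word_map p w @` K) y -> `|D (x0, y0) - D (x3, y)| < e.
  move=> [y2 Ky2 <-]; apply: Hr; first by split => //; exact: word_mapK.
  set y3 := word_map p w y2.
  have -> : `|(x0, y0) - (x3, y3)| = Num.max `|x0 - x3| `|y0 - y3| by [].
  rewrite gt_max; apply/andP; split.
    by rewrite x0E; apply: Hn => //; rewrite size_tuple.
  by rewrite y0E; apply: Hn => //; rewrite size_tuple.
have KI : K `&` (word_map p w @` K) = word_map p w @` K.
  by rewrite setIidr//; exact: cell_sub.
pose sg := Num.sg (D (x0, y0)).
(* D has absolute value 2e at (x0, y0) and varies by less than e on the product of the two cells, so
   it keeps its sign there and exceeds e in absolute value. *)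
have low y : K y -> e * f y <= sg * D (x3, y) * f y.
  move=> Ky; rewrite /f indicE; case: (boolP (_ \in _)) => yw; last by rewrite !mulr0.
  rewrite !mulr1; move/set_mem : yw => /Dnear; rewrite /e /sg.
  case: (sgrP (D (x0, y0))) D0 => // d0 _; rewrite ltr_norml => /andP[h1 h2];
  move: h1 h2; rewrite ?(gtr0_norm d0) ?(ltr0_norm d0); lra.
have fE : ip (fun=> e) f = e * 3^-1 ^+ n.
  have Ie : (\int[mu]_(x in K) (f x)%:E = (3^-1 ^+ n)%:E)%E.
    by rewrite integral_indic// setIC KI (cell_mass hmu) size_tuple.
  rewrite /dot RintegralZl//; first by rewrite /Rintegral Ie.
  have := square_integrableM mK Lf Lf; congr (integrable _ _ _).
  apply/funext => x; congr EFin; rewrite /f indicE.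
  by case: (_ \in _); rewrite ?mulr1 ?mulr0.
have Le : L2' (fun=> e).
  by apply: (bounded_square_integrable hK hmu (M := e)) => // x _; rewrite gtr0_norm.
have LsD := square_integrable_linear mK sg LD (square_integrable0 mu K).
have : ip (fun=> e) f <= ip (fun y => sg * D (x3, y) + 0) f.
  apply: le_Rintegral => //; [exact: square_integrableM|exact: square_integrableM|].
  by move=> y Ky; rewrite addr0; exact: low.
rewrite (dot_linear mK sg LD (square_integrable0 mu K) Lf) DE mulr0 add0r fE.
rewrite /dot /Rintegral integral0_eq => [/=|y _]; last by rewrite mul0r.
by rewrite leNgt mulr_gt0// exprn_gt0// invr_gt0.
Qed.

End heat_kernel.

(** * Square integrability and coefficients of the Green function *)

Section green_function.
Context {R : realType} (p : 'I_3 -> R * R) (K : set (R * R))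
  (mu : probability (R * R)%type R) (lam : nat -> R) (Phi : nat -> R * R -> R).
Hypotheses (eqp : unit_equilateral p) (hK : sierpinski_gasket p K)
  (hmu : selfsimilar_measure p K mu) (hb : dirichlet_eigenbasis p K mu lam Phi).
Local Notation ip := (dot mu K).
Local Notation L2' := (square_integrable mu K).
Local Notation leb := (@lebesgue_measure R).
Local Notation half := (`]0%R, +oo[%classic : set (measurableTypeR R)).
Let mK := gasket_measurable hK.
Let LPhi := eigen_L2 hK hmu hb.
Let ortho := eigen_ortho hb.
Let lam_gt0 := eigen_gt0 hb.
Let mhalf : measurable half := measurable_positive_half_line.

Let halfP t : half t -> 0 < t.
Proof. by rewrite /= in_itv /= andbT. Qed.

Section exponents.
Context (s r : R).
Hypotheses (r_lt : r < 2 * s) (r_gt0 : 0 < r)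
  (r_sum : exists M, forall n, \sum_(j < n) lam j `^ (- r) <= M).

(** Integrated over K, the series becomes the sum of lam_j^(-r), because each Phi_j has norm 1; a
    nonnegative function with finite integral is finite almost everywhere. *)
Lemma ae_eigen_sum : {ae mu, forall x, K x ->
  exists A, forall n, \sum_(j < n) lam j `^ (- r) * Phi j x ^+ 2 <= A}.
Proof.
have [M HM] := r_sum.
pose h j x := (lam j `^ (- r) * Phi j x ^+ 2)%:E.
have h0 j x : (0 <= h j x)%E by rewrite lee_fin mulr_ge0 ?powR_ge0 ?sqr_ge0.
have mh j : measurable_fun K (h j).
  apply/measurable_EFinP; apply: measurable_funM => //.
  by apply: measurable_funX; have [] := LPhi j.
pose T x := (\sum_(0 <= j <oo) h j x)%E.
have Ih j : (\int[mu]_(x in K) h j x = (lam j `^ (- r))%:E)%E.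
  under eq_integral do rewrite /h EFinM.
  rewrite ge0_integralZl_EFin ?powR_ge0//.
  - by rewrite (dotE mK (LPhi j)) ortho eqxx mule1.
  - by move=> x _; rewrite lee_fin sqr_ge0.
  - by apply/measurable_EFinP/measurable_funX; have [] := LPhi j.
have IT : (\int[mu]_(x in K) T x <= M%:E)%E.
  rewrite integral_nneseries//; under eq_eseriesr do rewrite Ih.
  apply: lime_le; first by apply: is_cvg_nneseries => j _ _; rewrite lee_fin powR_ge0.
  by apply: nearW => n; rewrite sumEFin lee_fin big_mkord.
have mT : measurable_fun K T.
  by apply: ge0_emeasurable_sum => // j x _ _.
have iT : mu.-integrable K T.
  apply/integrableP; split=> //; apply: le_lt_trans (ltry M).
  apply: le_trans IT; rewrite le_eqVlt; apply/orP; left; apply/eqP.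
  by apply: eq_integral => x _; rewrite gee0_abs// nneseries_ge0.
have := integrable_ae mK iT; apply: filterS => x Tx Kx.
exists (fine (T x)) => n; rewrite -lee_fin fineK; last exact: Tx.
have := @nneseries_lim_ge R (fun j => h j x) xpredT 0 n (fun j _ _ => h0 j x).
by rewrite big_mkord sumEFin.
Qed.

Section good_point.
Context (x : R * R) (A : R).
Hypotheses (Kx : K x) (HA : forall n, \sum_(j < n) lam j `^ (- r) * Phi j x ^+ 2 <= A).

(* Cauchy-Schwarz in the time variable: t^(s-1) q_t(y) is split into f1 and f2
   with f1^2 = t^(e-1) exp(-c t) and f2^2 = t^(r-1) exp(c t) q_t(y)^2; the integral
   of f2^2 over K converges in t because q_t^2 integrates to
   sum_j exp(-2 lam_j t) Phi_j(x)^2 and lam_j >= c. *)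
Let c := lam 0%N.
Let e := 2 * s - r.
Let e_gt0 : 0 < e.
Proof. by rewrite /e subr_gt0. Qed.
Let q (t : R) (y : R * R) := heat_series lam Phi t (x, y).
Let f1 t := t `^ ((e - 1) / 2) * expR (- (c * t) / 2).
Let f2 t y := t `^ ((r - 1) / 2) * expR (c * t / 2) * q t y.

Let f12 t y : 0 < t -> f1 t * f2 t y = t `^ (s - 1) * q t y.
Proof.
move=> t0; rewrite /f1 /f2.
have -> : s - 1 = (e - 1) / 2 + (r - 1) / 2 by rewrite /e; field.
rewrite powRD; last by rewrite (gt_eqF t0) implybT.
set E1 := expR _; set E2 := expR _.
have E12 : E1 * E2 = 1 by rewrite -expRD mulNr addNr expR0.
by rewrite -[RHS]mul1r -E12; ring.
Qed.

Let sqr_powR (t a : R) : 0 < t -> (t `^ (a / 2)) ^+ 2 = t `^ a.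
Proof. by move=> t0; rewrite -powR_mulrn ?powR_ge0// -powRrM divfK. Qed.

Let f1sq t : 0 < t -> f1 t ^+ 2 = t `^ (e - 1) * expR (- (c * t)).
Proof.
move=> t0; rewrite /f1 exprMn sqr_powR//; congr (_ * _).
by rewrite expr2 -expRD; congr expR; field.
Qed.

Let f2sq t y : 0 < t -> f2 t y ^+ 2 = t `^ (r - 1) * expR (c * t) * q t y ^+ 2.
Proof.
move=> t0; rewrite /f2 !exprMn sqr_powR//; congr (_ * _ * _).
by rewrite expr2 -expRD; congr expR; field.
Qed.

Let mf1 : measurable_fun half f1.
Proof.
apply: measurable_funTS; apply: measurable_funM; first exact: measurable_powR.
apply: measurableT_comp => //; apply: measurable_funM => //.
by apply: measurableT_comp => //; exact: measurable_funM.
Qed.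

Let mq : measurable_fun (half `*` K) (fun z => q z.1 z.2).
Proof.
have mD : measurable (half `*` K) by exact: measurableX.
apply: (@measurable_fun_cvg _ _ _ (half `*` K)
  (fun n z => \sum_(j < n) expR (- (z.1 * lam j)) * (Phi j x * Phi j z.2))).
  move=> n; apply: measurable_sum => j; apply: measurable_funM.
    apply: measurable_funTS; apply: measurableT_comp => //.
    by apply: measurableT_comp => //; exact: measurable_funM.
  apply: measurable_funM => //.
  have [mj _] := LPhi j.
  apply: (@measurable_comp _ _ _ _ _ _ K (Phi j)) => //.
    by move=> _ [[t y] [_ Ky] <-].
  exact: measurable_funTS.
by move=> [t y] [/halfP t0 Ky]; exact: (@heat_series_cvg _ _ _ _ _ _ eqp hK hmu hb t t0 (x, y) (conj Kx Ky)).
Qed.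

Let mf2 : measurable_fun (half `*` K) (fun z => f2 z.1 z.2).
Proof.
apply: measurable_funM mq; apply: measurable_funTS; apply: measurable_funM.
  exact: (measurableT_comp (f := fun t : R => t `^ ((r - 1) / 2))).
apply: measurableT_comp => //; apply: measurable_funM => //.
exact: measurable_funM.
Qed.

Let Lq t : 0 < t -> L2' (q t).
Proof.
move=> t0; have [L _] := heat_series_section eqp hK hmu hb t0 Kx.
by move: L; congr (square_integrable _ _ _); apply/funext => y;
  rewrite /q heat_series_sectionE.
Qed.

Let qsum t : 0 < t -> l2_sum mu K
  (fun j y => expR (- (t * lam j)) * Phi j x * Phi j y) (q t).
Proof.
move=> t0; have := heat_series_section eqp hK hmu hb t0 Kx.
by congr (l2_sum _ _ _ _); apply/funext => y; rewrite /q heat_series_sectionE.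
Qed.

Let If1 : (\int[leb]_(t in half) (f1 t ^+ 2)%:E < +oo)%E.
Proof.
have -> : (\int[leb]_(t in half) (f1 t ^+ 2)%:E =
  \int[leb]_(t in half) (t `^ (e - 1) * expR (- (c * t)))%:E)%E.
  by apply: eq_integral => t /set_mem /halfP t0; rewrite f1sq.
by rewrite (gamma_integral_scaled e_gt0 (lam_gt0 0%N)); exact: ltry.
Qed.

Let If2 : (\int[leb]_(t in half) \int[mu]_(y in K) (f2 t y ^+ 2)%:E < +oo)%E.
Proof.
pose h j (t : R) := (t `^ (r - 1) * expR (c * t) *
  (expR (- (t * lam j)) * Phi j x) ^+ 2)%:E.
have h0 j t : (0 <= h j t)%E.
  by rewrite lee_fin mulr_ge0 ?sqr_ge0// mulr_ge0 ?powR_ge0 ?expR_ge0.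
have mh j : measurable_fun half (h j).
  apply/measurable_EFinP; apply: measurable_funTS; apply: measurable_funM.
    apply: measurable_funM; first exact: measurable_powR.
    by apply: measurableT_comp => //; exact: measurable_funM.
  apply: measurable_funX; apply: measurable_funM => //.
  apply: measurableT_comp => //; apply: measurableT_comp => //.
  exact: measurable_funM.
have E t : 0 < t -> (\int[mu]_(y in K) (f2 t y ^+ 2)%:E = \sum_(0 <= j <oo) h j t)%E.
  move=> t0.
  have -> : (\int[mu]_(y in K) (f2 t y ^+ 2)%:E =
      (t `^ (r - 1) * expR (c * t) * ip (q t) (q t))%:E)%E.
    under eq_integral do rewrite f2sq// EFinM.
    rewrite ge0_integralZl_EFin ?mulr_ge0 ?powR_ge0 ?expR_ge0//.
    - by rewrite (dotE mK (Lq t0)) EFinM.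
    - by move=> y _; rewrite lee_fin sqr_ge0.
    - by apply/measurable_EFinP/measurable_funX; have [] := Lq t0.
  have cv := parseval hK hmu hb (qsum t0) (qsum t0).
  have cv2 : (fun n => (\sum_(0 <= j < n) h j t)%E) @ \oo -->
      (t `^ (r - 1) * expR (c * t) * ip (q t) (q t))%:E.
    under eq_fun do rewrite sumEFin big_mkord -mulr_sumr.
    by apply/cvg_EFin; [exact: nearW|apply: cvgMr; exact: cv].
  by rewrite -(cvg_lim (@ereal_hausdorff R) cv2).
have -> : (\int[leb]_(t in half) \int[mu]_(y in K) (f2 t y ^+ 2)%:E =
   \int[leb]_(t in half) \sum_(0 <= j <oo) h j t)%E.
  by apply: eq_integral => t /set_mem /halfP t0; rewrite E.
rewrite integral_nneseries//.
apply: (@le_lt_trans _ _ (euler_gamma r * A)%:E); last exact: ltry.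
have Ih j : (\int[leb]_(t in half) h j t <=
    (euler_gamma r * (lam j `^ (- r) * Phi j x ^+ 2))%:E)%E.
  have -> : (euler_gamma r * (lam j `^ (- r) * Phi j x ^+ 2))%:E =
    (\int[leb]_(t in half) (Phi j x ^+ 2 * (t `^ (r - 1) * expR (- (lam j * t))))%:E)%E.
    under eq_integral do rewrite EFinM.
    rewrite ge0_integralZl_EFin ?sqr_ge0//.
    - by rewrite gamma_integral_scaled// -EFinM; congr EFin; ring.
    - by move=> t _; rewrite lee_fin mulr_ge0 ?powR_ge0 ?expR_ge0.
    - by apply/measurable_EFinP; exact: measurable_gamma_integrand.
  apply: ge0_le_integral => //.
  - apply/measurable_EFinP; apply: measurable_funM => //.
    exact: measurable_gamma_integrand.
  - move=> t /halfP t0; rewrite lee_fin exprMn.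
    have -> : t `^ (r - 1) * expR (c * t) * (expR (- (t * lam j)) ^+ 2 * Phi j x ^+ 2) =
      Phi j x ^+ 2 * (t `^ (r - 1) * (expR (c * t) * expR (- (t * lam j)) ^+ 2)).
      by ring.
    apply: ler_wpM2l; first exact: sqr_ge0.
    apply: ler_wpM2l; first exact: powR_ge0.
    rewrite expr2 -!expRD ler_expR.
    (* Since c is the lowest eigenvalue, half of the decay exp(-2 lam_j t) absorbs exp(c t); the
       other half yields Gamma(r) lam_j^(-r). *)
    have := eigen_homo hb (leq0n j); rewrite -/c => h1.
    have := ler_wpM2r (ltW t0) h1; lra.
apply: lime_le; first by apply: is_cvg_nneseries => j _ _; exact: integral_ge0.
apply: nearW => n.
apply: le_trans (_ : \sum_(0 <= j < n) (euler_gamma r * (lam j `^ (- r) * Phi j x ^+ 2))%:E <= _)%E.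
  by apply: lee_sum => j _; exact: Ih.
rewrite sumEFin lee_fin big_mkord -mulr_sumr.
by apply: ler_wpM2l; [exact: ltW (gamma_gt0 r_gt0)|exact: HA].
Qed.

Let mf2E : measurable_fun (half `*` K) (fun z => (f2 z.1 z.2 ^+ 2)%:E).
Proof. by apply/measurable_EFinP; exact: measurable_funX. Qed.

Let f2_ge0 (z : measurableTypeR R * (R * R)) : (half `*` K) z ->
  (0 <= (f2 z.1 z.2 ^+ 2)%:E)%E.
Proof. by move=> _; rewrite lee_fin sqr_ge0. Qed.

Let J y := (\int[leb]_(t in half) (f2 t y ^+ 2)%:E)%E.

Let mJ : measurable_fun K J.
Proof. exact: (measurable_tonelli2 leb mhalf mK mf2E f2_ge0). Qed.

Let J_ge0 y : (0 <= J y)%E.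
Proof. by apply: integral_ge0 => t _; rewrite lee_fin sqr_ge0. Qed.

Let IJ : (\int[mu]_(y in K) J y < +oo)%E.
Proof. by rewrite /J -(tonelli_on leb mu mhalf mK mf2E f2_ge0); exact: If2. Qed.

Let J_fin : {ae mu, forall y, K y -> J y \is a fin_num}.
Proof.
apply: integrable_ae => //; apply/integrableP; split; first exact: mJ.
by under eq_integral do rewrite gee0_abs//.
Qed.

Let Lf1 : square_integrable leb half f1.
Proof. by split; [exact: mf1|exact: If1]. Qed.

Let Lf2 y : K y -> J y \is a fin_num -> square_integrable leb half (f2 ^~ y).
Proof.
move=> Ky Jy; split; last by rewrite -ge0_fin_numE//; exact: J_ge0.
have mE : measurable_fun (half `*` K) (fun z => (f2 z.1 z.2)%:E).
  exact/measurable_EFinP.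
by apply/measurable_EFinP; exact: (measurable_section2 mhalf mK mE (y := y)).
Qed.

Let g y := \int[leb]_(t in half) (t `^ (s - 1) * q t y).

Let gE y : g y = dot leb half f1 (f2 ^~ y).
Proof. by apply: eq_Rintegral => t /set_mem /halfP t0; rewrite f12. Qed.

Let mg : measurable_fun K g.
Proof.
apply: (measurable_Rintegral leb mhalf mK (F := fun z => z.1 `^ (s - 1) * q z.1 z.2)).
apply: measurable_funM; last exact: mq.
apply: measurable_funTS.
exact: (measurableT_comp (f := fun t : R => t `^ (s - 1))).
Qed.

(** By Cauchy-Schwarz in t, g(y)^2 is at most the integral of f1^2 times J(y), for almost every y; J
    is integrable over K. *)
Let Lg : L2' g.
Proof.
split; first exact: mg.
have C0 := dot_ge0 leb half f1.
apply: (@le_lt_trans _ _ (\int[mu]_(y in K) ((dot leb half f1 f1)%:E * J y))%E).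
  apply: ae_ge0_le_integral => //.
  - by move=> y _; rewrite lee_fin sqr_ge0.
  - by apply/measurable_EFinP; exact: measurable_funX.
  - by move=> y _; rewrite mule_ge0.
  - exact: measurable_funeM.
  apply: filterS J_fin => y Jy Ky; have Jf := Jy Ky.
  have L2y := Lf2 Ky Jf.
  by rewrite /J (dotE mhalf L2y) -EFinM lee_fin gE; exact: cauchy_schwarz.
rewrite ge0_integralZl_EFin//.
by rewrite lte_mul_pinfty// lee_fin.
Qed.

(** The absolute integrability that Fubini requires: the integrand is Phi_j f1 f2, at most (Phi_j
    f1)^2 + f2^2, and Phi_j has norm 1. *)
Let ImJ (j : nat) : (\int[leb]_(t in half) \int[mu]_(y in K)
  `|(Phi j y * (t `^ (s - 1) * q t y))%:E| < +oo)%E.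
Proof.
have mPt t : measurable_fun K (fun y => ((Phi j y * f1 t) ^+ 2)%:E).
  apply/measurable_EFinP; apply: measurable_funX; apply: measurable_funM => //.
  by have [] := LPhi j.
have mf2t t : half t -> measurable_fun K (fun y => (f2 t y ^+ 2)%:E).
  by move=> ht; exact: (measurable_section1 mhalf mK mf2E ht).
have mG : measurable_fun half (fun t => \int[mu]_(y in K) (f2 t y ^+ 2)%:E)%E.
  exact: (measurable_tonelli1 mu mhalf mK mf2E f2_ge0).
have mF1 : measurable_fun half (fun t => (f1 t ^+ 2)%:E).
  by apply/measurable_EFinP; exact: measurable_funX.
have G0 t : (0 <= \int[mu]_(y in K) (f2 t y ^+ 2)%:E)%E.
  by apply: integral_ge0 => y _; rewrite lee_fin sqr_ge0.
apply: (@le_lt_trans _ _ (\int[leb]_(t in half) ((f1 t ^+ 2)%:E +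
   \int[mu]_(y in K) (f2 t y ^+ 2)%:E))%E); last first.
  rewrite ge0_integralD//; first by rewrite lte_add_pinfty.
  by move=> t _; rewrite lee_fin sqr_ge0.
have mPq : measurable_fun (half `*` K)
    (fun z => (Phi j z.2 * (z.1 `^ (s - 1) * q z.1 z.2))%:E).
  apply/measurable_EFinP; apply: measurable_funM.
    apply: (@measurable_comp _ _ _ _ _ _ K (Phi j)) => //.
    - by move=> _ [[t y] [_ Ky] <-].
    - by have [] := LPhi j.
    - exact: measurable_funTS.
  apply: measurable_funM; last exact: mq.
  by apply: measurable_funTS; exact: (measurableT_comp (f := fun t : R => t `^ (s - 1))).
apply: ge0_le_integral => //.
- by move=> t _; exact: integral_ge0.
- apply: (measurable_tonelli1 mu mhalf mK (F := fun z =>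
    `|(Phi j z.2 * (z.1 `^ (s - 1) * q z.1 z.2))%:E|)%E) => //.
  exact: measurableT_comp.
- exact: emeasurable_funD.
- move=> t ht; have t0 := halfP ht.
  have E1 : ((f1 t ^+ 2)%:E = \int[mu]_(y in K) ((Phi j y * f1 t) ^+ 2)%:E)%E.
    under eq_integral do rewrite exprMn mulrC EFinM.
    rewrite ge0_integralZl_EFin ?sqr_ge0//.
    + by rewrite (dotE mK (LPhi j)) ortho eqxx mule1.
    + by move=> y _; rewrite lee_fin sqr_ge0.
    + by apply/measurable_EFinP/measurable_funX; have [] := LPhi j.
  rewrite E1 -ge0_integralD//; last 3 first.
  + by move=> y _; rewrite lee_fin sqr_ge0.
  + by move=> y _; rewrite lee_fin sqr_ge0.
  + exact: mf2t.
  apply: ge0_le_integral => //.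
  + apply: measurableT_comp => //.
    exact: (measurable_section1 mhalf mK mPq ht).
  + by apply: emeasurable_funD => //; exact: mf2t.
  + move=> y Ky; rewrite -f12//; rewrite -EFinD /= lee_fin.
    move: (Phi j y) (f1 t) (f2 t y) => a b d.
    rewrite mulrA; have := sqr_ge0 (a * b - d); have := sqr_ge0 (a * b + d).
    by have := sqr_ge0 (a * b); have := sqr_ge0 d; case: (ger0P (a * b * d)); nra.
Qed.

Let s_gt0 : 0 < s.
Proof. by have := lt_trans r_gt0 r_lt; lra. Qed.

(** Fubini moves the inner product with Phi_j under the time integral, where the coefficient of q_t
    is exp(- lam_j t) Phi_j(x). *)
Let g_coef j : ip (Phi j) g = euler_gamma s * lam j `^ (- s) * Phi j x.
Proof.
have mPq : measurable_fun (half `*` K)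
    (fun z => (Phi j z.2 * (z.1 `^ (s - 1) * q z.1 z.2))%:E).
  apply/measurable_EFinP; apply: measurable_funM.
    apply: (@measurable_comp _ _ _ _ _ _ K (Phi j)) => //.
    - by move=> _ [[t y] [_ Ky] <-].
    - by have [] := LPhi j.
    - exact: measurable_funTS.
  apply: measurable_funM; last exact: mq.
  by apply: measurable_funTS; exact: (measurableT_comp (f := fun t : R => t `^ (s - 1))).
have F := fubini_on mhalf mK mPq (ImJ j).
have E1 : (\int[mu]_(y in K) \int[leb]_(t in half) (Phi j y * (t `^ (s - 1) * q t y))%:E
   = (ip (Phi j) g)%:E)%E.
  rewrite /dot /Rintegral fineK; last first.
    exact: (integrable_fin_num mK (square_integrableM mK (LPhi j) Lg)).
  have mL : measurable_fun K (fun y => \int[leb]_(t in half)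
      (Phi j y * (t `^ (s - 1) * q t y))%:E)%E.
    apply: (measurable_parametric_integral leb mhalf mK
      (F := fun z => Phi j z.2 * (z.1 `^ (s - 1) * q z.1 z.2))).
    exact/measurable_EFinP.
  apply: ae_eq_integral => //.
    by apply/measurable_EFinP; apply: measurable_funM => //; have [] := LPhi j.
  (* The factor Phi_j(y) leaves the time integral where that integral converges absolutely, which is
     ensured where J is finite. *)
  apply: filterS J_fin => y Jy Ky; have Jf := Jy Ky.
  have L2y := Lf2 Ky Jf.
  have iF : leb.-integrable half (fun t => (t `^ (s - 1) * q t y)%:E).
    have := square_integrableM mhalf Lf1 L2y.
    by apply: eq_integrable => // t /set_mem /halfP t0; rewrite f12.
  under eq_integral do rewrite EFinM.
  rewrite integralZl// /g /Rintegral EFinM fineK//.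
  exact: (integrable_fin_num mhalf iF).
have E2 : (\int[leb]_(t in half) \int[mu]_(y in K) (Phi j y * (t `^ (s - 1) * q t y))%:E
   = \int[leb]_(t in half) ((Phi j x)%:E * (t `^ (s - 1) * expR (- (lam j * t)))%:E))%E.
  apply: eq_integral => t /set_mem /halfP t0.
  have cf := l2_sum_coef mK LPhi ortho j (qsum t0).
  have -> : (\int[mu]_(y in K) (Phi j y * (t `^ (s - 1) * q t y))%:E =
     (t `^ (s - 1))%:E * \int[mu]_(y in K) (Phi j y * q t y)%:E)%E.
    rewrite -integralZl//; last exact: (square_integrableM mK (LPhi j) (Lq t0)).
    by apply: eq_integral => y _; rewrite -EFinM mulrCA.
  have -> : (\int[mu]_(y in K) (Phi j y * q t y)%:E = (ip (Phi j) (q t))%:E)%E.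
    rewrite /dot /Rintegral fineK//.
    exact: (integrable_fin_num mK (square_integrableM mK (LPhi j) (Lq t0))).
  by rewrite cf -!EFinM; congr EFin; rewrite (mulrC t (lam j)); ring.
have E3 : (\int[leb]_(t in half) ((Phi j x)%:E * (t `^ (s - 1) * expR (- (lam j * t)))%:E) =
   (euler_gamma s * lam j `^ (- s) * Phi j x)%:E)%E.
  rewrite integralZl//; first by rewrite gamma_integral_scaled// -EFinM mulrC.
  apply/integrableP; split.
    by apply/measurable_EFinP; exact: measurable_gamma_integrand.
  under eq_integral do rewrite gee0_abs ?lee_fin ?mulr_ge0 ?powR_ge0 ?expR_ge0//.
  by rewrite (gamma_integral_scaled s_gt0 (lam_gt0 j)) ltry.
by apply/EFin_inj; rewrite -E1 -F E2 E3.
Qed.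

Lemma green_at_good_point pt : heat_kernel K mu lam Phi pt ->
  L2' (green pt s x) /\
  forall j, ip (Phi j) (green pt s x) = lam j `^ (- s) * Phi j x.
Proof.
move=> hpt; have g0 := gamma_gt0 s_gt0.
have E : {in K, green pt s x =1 (fun y => (euler_gamma s)^-1 * g y + 0)}.
  move=> y /set_mem Ky; rewrite addr0 /green; congr (_ * _).
  apply: eq_Rintegral => t /set_mem /halfP t0.
  by rewrite (heat_kernelE eqp hK hmu hb hpt t0 Kx Ky).
have LG := square_integrable_linear mK (euler_gamma s)^-1 Lg (square_integrable0 mu K).
split.
  have [mG IG] := LG; split.
    by apply: eq_measurable_fun mG => y Ky; rewrite E.
  by move: IG; congr (_ < _)%E; apply: eq_integral => y Ky; rewrite E.
move=> j; rewrite dotC (eq_dot mu E (fun y _ => erefl)).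
rewrite (dot_linear mK _ Lg (square_integrable0 mu K) (LPhi j)).
rewrite (dotC _ _ g) g_coef.
have -> : ip (fun=> 0) (Phi j) = 0.
  by rewrite /dot /Rintegral integral0_eq// => y _; rewrite mul0r.
by rewrite addr0 !mulrA mulVf ?mul1r// gt_eqF.
Qed.

End good_point.
End exponents.

Lemma critical_exponent_gt0 : 0 < hausdorff_dim / (2 * walk_dim) :> R.
Proof.
have l0 n : (1 < n)%N -> 0 < ln n%:R :> R by move=> n1; rewrite ln_gt0// ltr1n.
rewrite /hausdorff_dim /walk_dim.
by apply: divr_gt0; [|apply: mulr_gt0 => //]; apply: divr_gt0; exact: l0.
Qed.

Lemma supercritical_series s : hausdorff_dim / (2 * walk_dim) < s ->
  exists M, forall n, \sum_(j < n) lam j `^ (- (2 * s)) <= M.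
Proof.
move=> hs; apply: (eigen_series_bounded lam_gt0 (eigen_homo hb)).
- by rewrite mulr_ge0// ltW// (lt_trans critical_exponent_gt0 hs).
- by rewrite ltNge -critical_exponent -ltNge.
- exact: (eigen_lower eqp hK hmu hb).
Qed.

(* Almost every x is enough: the field only enters through its integrals
   against mu. *)
Lemma green_coef s pt : hausdorff_dim / (2 * walk_dim) < s ->
  heat_kernel K mu lam Phi pt ->
  {ae mu, forall x, K x -> L2' (green pt s x) /\
    forall j, ip (Phi j) (green pt s x) = lam j `^ (- s) * Phi j x}.
Proof.
move=> hs hpt; pose theta : R := hausdorff_dim / (2 * walk_dim).
have theta0 : 0 < theta := critical_exponent_gt0.
(* The midpoint of 2 theta and 2 s: r < 2 s leaves room for the Cauchy-Schwarz splitting, while r /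
   2 > theta makes the sum of lam_j^(-r) finite. *)
pose r := s + theta.
have r_lt : r < 2 * s by rewrite /r; move: hs; rewrite -/theta; lra.
have r0 : 0 < r by rewrite /r; move: hs; rewrite -/theta; lra.
have hr : theta < r / 2 by rewrite /r; move: hs; rewrite -/theta; lra.
have := supercritical_series hr; rewrite mulrC divfK// => r_sum.
apply: filterS (ae_eigen_sum r_sum) => x Hx Kx; have [A HA] := Hx Kx.
exact: (green_at_good_point r_lt r0 Kx HA hpt).
Qed.

End green_function.

(** * The white noise field *)

Section almost_sure_equality.
Context {R : realType} d (Omega : measurableType d) (P : probability Omega R).

(** Almost sure equality preserves laws but not measurability, as P need not be complete; the
    measurability of Y is therefore asked separately. *)
Lemma gaussian_rv_ae (X Y : Omega -> R) : gaussian_rv P X ->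
  measurable_fun setT Y -> {ae P, forall w, Y w = X w} -> gaussian_rv P Y.
Proof.
move=> [mX [m law]] mY XY; split=> //; exists m.
have PE A : measurable A -> P (Y @^-1` A) = P (X @^-1` A).
  move=> mA.
  have mYA : measurable (Y @^-1` A) by rewrite -[_ @^-1` _]setTI; exact: mY.
  have mXA : measurable (X @^-1` A) by rewrite -[_ @^-1` _]setTI; exact: mX.
  rewrite -[Y @^-1` A]setIT -[X @^-1` A]setIT -!integral_indic//.
  apply: ae_eq_integral => //; try exact/measurable_EFinP/measurable_indic.
  apply: filterS XY => w e _; rewrite !indicE; congr (_%:R%:E).
  by rewrite /in_mem /= /in_set /= e.
case: law => [law|[s s0 law]]; [left=> A mA|right; exists s => // A mA];
  by rewrite PE// law.
Qed.

(** It identifies the integrated field with a white noise integral, both being L2 limits of the same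
    finite sums; (Y - Z)^2 is at most 2 (Y - V)^2 + 2 (Z - V)^2. *)
Lemma ae_eq_common_limit (V : nat -> Omega -> R) (Y Z : Omega -> R) :
  (forall n, measurable_fun setT (V n)) -> measurable_fun setT Y ->
  measurable_fun setT Z ->
  (fun n => \int[P]_w ((Y w - V n w) ^+ 2)%:E)%E @ \oo --> 0%E ->
  (fun n => \int[P]_w ((Z w - V n w) ^+ 2)%:E)%E @ \oo --> 0%E ->
  {ae P, forall w, Y w = Z w}.
Proof.
move=> mV mY mZ cY cZ.
have msq (A B : Omega -> R) : measurable_fun setT A -> measurable_fun setT B ->
    measurable_fun setT (fun w => ((A w - B w) ^+ 2)%:E).
  by move=> mA mB; apply/measurable_EFinP/measurable_funX/measurable_funB.
have le n : (\int[P]_w ((Y w - Z w) ^+ 2)%:E <=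
    2%:E * \int[P]_w ((Y w - V n w) ^+ 2)%:E + 2%:E * \int[P]_w ((Z w - V n w) ^+ 2)%:E)%E.
  rewrite -!ge0_integralZl_EFin//; try by [move=> w _; rewrite lee_fin sqr_ge0|exact: msq].
  rewrite -ge0_integralD//; last 4 first.
  - by move=> w _; rewrite -EFinM lee_fin mulr_ge0// sqr_ge0.
  - by apply: measurable_funeM; exact: msq.
  - by move=> w _; rewrite -EFinM lee_fin mulr_ge0// sqr_ge0.
  - by apply: measurable_funeM; exact: msq.
  apply: ge0_le_integral => //.
  - by move=> w _; rewrite lee_fin sqr_ge0.
  - exact: msq.
  - by apply: emeasurable_funD; apply: measurable_funeM; exact: msq.
  - move=> w _; rewrite -!EFinM -EFinD lee_fin.
    by have := sqr_ge0 (Y w - V n w + (Z w - V n w)); nra.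
have I0 : (\int[P]_w ((Y w - Z w) ^+ 2)%:E = 0)%E.
  apply/eqP; rewrite eq_le integral_ge0 ?andbT; last first.
    by move=> w _; rewrite lee_fin sqr_ge0.
  have c0 : (fun n => 2%:E * \int[P]_w ((Y w - V n w) ^+ 2)%:E +
      2%:E * \int[P]_w ((Z w - V n w) ^+ 2)%:E)%E @ \oo --> 0%E.
    have -> : (0 = 2%:E * 0 + 2%:E * 0 :> \bar R)%E by rewrite !mule0 adde0.
    by apply: cvgeD; [rewrite !mule0|exact: cvgeZl|exact: cvgeZl].
  rewrite -(cvg_lim (@ereal_hausdorff R) c0); apply: lime_ge; last exact: nearW.
  by apply/cvg_ex; exists 0%E.
have LB : square_integrable P setT (fun w => Y w - Z w).
  by split; [exact: measurable_funB|rewrite I0 ltry].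
have D0 : dot P setT (fun w => Y w - Z w) (fun w => Y w - Z w) = 0.
  by have := dotE measurableT LB; rewrite I0 => -[].
apply: filterS (ae_eq_dot0 measurableT LB D0) => w /(_ I) /eqP.
by rewrite subr_eq0 => /eqP.
Qed.

End almost_sure_equality.

Section white_noise_field.
Context {R : realType} (p : 'I_3 -> R * R) (K : set (R * R))
  (mu : probability (R * R)%type R) (lam : nat -> R) (Phi : nat -> R * R -> R).
Hypotheses (eqp : unit_equilateral p) (hK : sierpinski_gasket p K)
  (hmu : selfsimilar_measure p K mu) (hb : dirichlet_eigenbasis p K mu lam Phi).
Context d (Omega : measurableType d) (P : probability Omega R)
  (W : (R * R -> R) -> Omega -> R).
Hypothesis hW : white_noise P K mu W.
Local Notation ip := (dot mu K).
Local Notation L2' := (square_integrable mu K).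
Let mK := gasket_measurable hK.
Let LPhi := eigen_L2 hK hmu hb.
Let ortho := eigen_ortho hb.
Let lam_gt0 := eigen_gt0 hb.

Lemma white_noise_measurable f : L2' f -> measurable_fun setT (W f).
Proof. by move=> Lf; have [[gW _] _ _] := hW; exact: (gaussian_field_measurable gW Lf). Qed.

Lemma white_noise_isometry f : L2' f ->
  (\int[P]_w ((W f w) ^+ 2)%:E = (ip f f)%:E)%E.
Proof.
move=> Lf; have [_ _ /(_ f f Lf Lf)] := hW; rewrite unlock => E.
by under eq_integral do rewrite expr2.
Qed.

Lemma white_noise0 : {ae P, forall w, W (fun=> 0) w = 0}.
Proof.
have L0 := square_integrable0 mu K.
have [_ /(_ 0 0 _ _ L0 L0) + _] := hW; apply: filterS => w.
rewrite !mul0r addr0 => h; rewrite -[RHS]h; congr (W _ w).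
Qed.

Lemma white_noise_sum (a : nat -> R) n : {ae P, forall w,
  W (fun x => \sum_(j < n) a j * Phi j x) w = \sum_(j < n) a j * W (Phi j) w}.
Proof.
elim: n => [|n IH].
  apply: filterS white_noise0 => w h; rewrite big_ord0 -[RHS]h.
  by congr (W _ w); apply/funext => x; rewrite big_ord0.
have Ls := partial_sum_L2 mK LPhi a n.
have [_ /(_ (a n) 1 _ _ (LPhi n) Ls) lin _] := hW.
apply: filterS2 IH lin => w h1 h2; rewrite big_ord_recr /= -h1.
rewrite (addrC (W _ w)) -[W (fun x => \sum_(j < n) _) w]mul1r -h2; congr (W _ w).
by apply/funext => x; rewrite big_ord_recr /= mul1r addrC.
Qed.

Lemma white_noiseB f g : L2' f -> L2' g -> {ae P, forall w,
  W (fun x => f x - g x) w = W f w - W g w}.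
Proof.
move=> Lf Lg; have [_ /(_ 1 (-1) _ _ Lf Lg) + _] := hW.
apply: filterS => w; rewrite mul1r mulN1r => <-; congr (W _ w).
by apply/funext => x; rewrite mul1r mulN1r.
Qed.

(** The isometry applied to f minus a partial sum. Allowing Z to equal W f only almost surely covers
    both the field at a point x and the white noise integral of (-Delta)^(-s) f. *)
Lemma white_noise_remainder f (Z : Omega -> R) (a : nat -> R) n : L2' f ->
  measurable_fun setT Z -> {ae P, forall w, Z w = W f w} ->
  (\int[P]_w ((Z w - \sum_(j < n) a j * W (Phi j) w) ^+ 2)%:E =
   (ip (fun x => f x - \sum_(j < n) a j * Phi j x)
       (fun x => f x - \sum_(j < n) a j * Phi j x))%:E)%E.
Proof.
move=> Lf mZ ZE; have Ls := partial_sum_L2 mK LPhi a n.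
have LB := square_integrableB mK Lf Ls.
rewrite -(white_noise_isometry LB); apply: ae_eq_integral => //.
- apply/measurable_EFinP/measurable_funX/measurable_funB => //.
  apply: measurable_sum => j; apply: measurable_funM => //.
  exact: white_noise_measurable.
- by apply/measurable_EFinP/measurable_funX; exact: white_noise_measurable.
have h1 := white_noiseB Lf Ls; have h2 := white_noise_sum a n.
by apply: filterS3 ZE h1 h2 => w -> -> -> _.
Qed.

(** The coefficients of a test function decay faster than (j+1)^-4, while lam_j grows at most like
    (j+1)^2; lam_j^2 times the coefficient stays bounded, which is what [rapid_sum] asks for. *)
Lemma neg_power_l2_sum s f : 0 < s -> test_functions p K mu Phi f ->
  l2_sum mu K (fun j x => lam j `^ (- s) * ip (Phi j) f * Phi j x)
    (neg_power K mu lam Phi s f).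
Proof.
move=> s0 [cf zf df].
have [C C0 HC] := eigen_upper eqp hK hmu hb.
have lamC j : lam j <= 5 * C * (j.+1%:R) ^+ 2.
  (* With 3^k <= j+1 < 3^(k+1), monotonicity gives lam_j <= 5 C 5^k; then 5 <= 3^2 turns 5^k into at
     most (j+1)^2. *)
  pose k := trunc_log 3 j.+1.
  have /andP[h1 h2] : (3 ^ k <= j.+1 < 3 ^ k.+1)%N by exact: trunc_log_bounds.
  have h3 : lam j <= C * 5 ^+ k.+1.
    apply: le_trans (HC k.+1); apply: (eigen_homo hb).
    by rewrite -ltnS prednK ?expn_gt0// ltnW.
  apply: le_trans h3 _; rewrite exprS mulrA (mulrC C) ler_pM2l ?mulr_gt0//.
  apply: le_trans (_ : (3 ^+ k) ^+ 2 <= _).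
    have h59 : 5 <= 3 ^+ 2 :> R by rewrite -natrX ler_nat.
    by rewrite -exprM mulnC exprM; apply: lerXn2r; rewrite ?nnegrE.
  by rewrite ler_pXn2r ?nnegrE// -natrX ler_nat.
have [N HN] : exists N, forall j, (j.+1%:R) ^+ 4 * `|ip (Phi j) f| <= N.
  have cb : cvgn (fun n => n.+1%:R ^+ 4 * `|inner K mu (Phi n) f|).
    by apply/cvg_ex; exists 0; exact: (df 4%N).
  have [N [_ HN]] := cvg_seq_bounded cb.
  exists (N + 1) => j; apply: le_trans (ler_norm _) _.
  by apply: (HN (N + 1)) => //; rewrite ltrDl.
apply: (spectral_calculusP (phi := fun l => l `^ (- s))).
apply: (rapid_sum eqp hK hmu hb (M := lam 0%N `^ (- s) * ((5 * C) ^+ 2 * N))).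
move=> j; have l0 := lam_gt0 j; rewrite normrM (ger0_norm (powR_ge0 _ _)) -mulrA.
apply: ler_pM; rewrite ?powR_ge0//.
- by rewrite mulr_ge0// exprn_ge0// ltW.
- rewrite !powRN lef_pV2 ?posrE ?powR_gt0//.
  apply: ge0_ler_powR; [exact: ltW|by rewrite nnegrE ltW|by rewrite nnegrE ltW|].
  exact: (eigen_homo hb).
apply: le_trans (_ : `|ip (Phi j) f| * (5 * C * (j.+1%:R) ^+ 2) ^+ 2 <= _).
  apply: ler_wpM2l => //; rewrite ler_pXn2r ?nnegrE ?(ltW l0)//.
  by rewrite mulr_ge0 ?exprn_ge0// mulr_ge0// ltW.
have C2 : 0 <= (5 * C) ^+ 2 by exact: sqr_ge0.
have := ler_wpM2l C2 (HN j); apply: le_trans.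
by rewrite le_eqVlt; apply/orP; left; apply/eqP; ring.
Qed.

Section green_field.
Context (s : R) (pt : R -> R * R -> R * R -> R) (X : R * R -> Omega -> R).
Hypotheses (hs : hausdorff_dim / (2 * walk_dim) < s)
  (hpt : heat_kernel K mu lam Phi pt) (hX : green_field_version P K pt s W X).

Let mX : measurable_fun (K `*` [set: Omega]) (fun z => X z.1 z.2).
Proof. by have [] := hX. Qed.

Let mXE : measurable_fun (K `*` [set: Omega]) (fun z => (X z.1 z.2)%:E).
Proof. exact/measurable_EFinP. Qed.

Let s_gt0 : 0 < s.
Proof. exact: lt_trans (critical_exponent_gt0) hs. Qed.

Let Xn n x w := \sum_(j < n) lam j `^ (- s) * Phi j x * W (Phi j) w.

Let mXn n : measurable_fun (K `*` [set: Omega]) (fun z => Xn n z.1 z.2).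
Proof.
apply: measurable_sum => j; apply: measurable_funM; last first.
  apply: measurable_funTS; apply: (measurableT_comp (f := W (Phi j))) => //.
  exact: white_noise_measurable.
apply: measurable_funM => //.
apply: (@measurable_comp _ _ _ _ _ _ K (Phi j)) => //.
- by move=> _ [[y w] [Ky _] <-].
- by have [] := LPhi j.
- exact: measurable_funTS.
Qed.

Let mdiff n : measurable_fun (K `*` [set: Omega])
  (fun z => ((X z.1 z.2 - Xn n z.1 z.2) ^+ 2)%:E).
Proof. by apply/measurable_EFinP/measurable_funX/measurable_funB; [exact: mX|exact: mXn]. Qed.

Let diff_ge0 n (z : (R * R) * Omega) : (K `*` [set: Omega]) z ->
  (0 <= ((X z.1 z.2 - Xn n z.1 z.2) ^+ 2)%:E)%E.
Proof. by move=> _; rewrite lee_fin sqr_ge0. Qed.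

Let T j x := ((lam j `^ (- s) * Phi j x) ^+ 2)%:E.

Let T_ge0 j x : (0 <= T j x)%E.
Proof. by rewrite lee_fin sqr_ge0. Qed.

Let mT j : measurable_fun K (T j).
Proof.
apply/measurable_EFinP; apply: measurable_funX; apply: measurable_funM => //.
by have [] := LPhi j.
Qed.

Let IT j : (\int[mu]_(x in K) T j x = (lam j `^ (- (2 * s)))%:E)%E.
Proof.
rewrite /T; under eq_integral do rewrite exprMn EFinM.
rewrite ge0_integralZl_EFin ?sqr_ge0//.
- rewrite (dotE mK (LPhi j)) ortho eqxx mule1 -powR_mulrn ?powR_ge0// -powRrM.
  by congr ((_ `^ _)%:E); ring.
- by move=> x _; rewrite lee_fin sqr_ge0.
- by apply/measurable_EFinP/measurable_funX; have [] := LPhi j.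
Qed.

(** The isometry turns the error at x into the squared distance of G_s(x, .) to its partial sum, and
    completeness of the basis makes it the tail of the squared coefficients. *)
Let pointwise_error n : {ae mu, forall x, K x ->
  (\int[P]_w ((X x w - Xn n x w) ^+ 2)%:E = \sum_(n <= j <oo) T j x)%E}.
Proof.
apply: filterS (green_coef eqp hK hmu hb hs hpt) => x Hx Kx.
have [LG cG] := Hx Kx; have [_ /(_ x Kx) XE] := hX.
have mXx : measurable_fun setT (X x).
  by apply/measurable_EFinP; exact: (measurable_section1 mK measurableT mXE Kx).
have := white_noise_remainder (fun j => lam j `^ (- s) * Phi j x) n LG mXx XE.
rewrite /Xn => ->.
have Ls := partial_sum_L2 mK LPhi (fun j => lam j `^ (- s) * Phi j x) n.
have := l2_sum_cvg mK LPhi (eigen_complete hb LG) LG.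
under eq_fun do under eq_bigr do rewrite cG.
move=> cv.
have -> : ip (fun y => green pt s x y - \sum_(j < n) lam j `^ (- s) * Phi j x * Phi j y)
   (fun y => green pt s x y - \sum_(j < n) lam j `^ (- s) * Phi j x * Phi j y) =
  ip (green pt s x) (green pt s x) -
  \sum_(j < n) lam j `^ (- s) * Phi j x * (lam j `^ (- s) * Phi j x).
  rewrite (dotBB mK LG Ls).
  rewrite (dot_partial_sums mK LPhi ortho (fun j => lam j `^ (- s) * Phi j x)
    (fun j => lam j `^ (- s) * Phi j x)).
  rewrite (dotC _ _ (green pt s x)).
  rewrite (dot_partial_sum mK LPhi (fun j => lam j `^ (- s) * Phi j x) n LG).
  by under eq_bigr do rewrite cG; ring.
have cv2 : (fun m => (\sum_(n <= j < m) T j x)%E) @ \oo -->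
  (ip (green pt s x) (green pt s x) -
  \sum_(j < n) lam j `^ (- s) * Phi j x * (lam j `^ (- s) * Phi j x))%:E.
  apply: (@cvg_trans _ ((fun m => (\sum_(j < m) lam j `^ (- s) * Phi j x * (lam j `^ (- s) * Phi j x)
    - \sum_(j < n) lam j `^ (- s) * Phi j x * (lam j `^ (- s) * Phi j x))%:E) @ \oo)); last first.
    by apply/cvg_EFin; [exact: nearW|apply: cvgB => //; exact: cvg_cst].
  apply: near_eq_cvg; exists n => // m /= nm; rewrite sumEFin; congr EFin.
  rewrite -!(big_mkord xpredT (fun j => lam j `^ (- s) * Phi j x * (lam j `^ (- s) * Phi j x))).
  rewrite (@big_cat_nat _ _ _ n 0 m)//= addrAC subrr add0r.
  by apply: eq_bigr => j _; rewrite expr2.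
by rewrite -(cvg_lim (@ereal_hausdorff R) cv2).
Qed.

Let mean_error n : (\int[P]_w \int[mu]_(x in K) ((X x w - Xn n x w) ^+ 2)%:E =
  \sum_(n <= j <oo) (lam j `^ (- (2 * s)))%:E)%E.
Proof.
rewrite -(tonelli_on mu P mK measurableT (mdiff n) (@diff_ge0 n)).
transitivity (\int[mu]_(x in K) \sum_(0 <= j <oo) T (j + n)%N x)%E.
  apply: ae_eq_integral => //.
  - exact: (measurable_tonelli1 P mK measurableT (mdiff n) (@diff_ge0 n)).
  - by apply: (@ge0_emeasurable_sum _ _ _ K (fun j => T (j + n)%N) xpredT).
  - apply: filterS (pointwise_error n) => x Hx Kx; rewrite /= Hx//.
    by rewrite (nneseries_addn n (fun i => T_ge0 i x)).
rewrite integral_nneseries// -(nneseries_addn n) => [|j]; last exact: powR_ge0.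
by apply: eq_eseriesr => j _; rewrite IT.
Qed.

Let series_finite : (\sum_(0 <= j <oo) (lam j `^ (- (2 * s)))%:E < +oo)%E.
Proof.
have [M HM] := supercritical_series eqp hK hmu hb hs.
apply: le_lt_trans (ltry M); apply: lime_le.
  by apply: is_cvg_nneseries => j _ _; exact: powR_ge0.
by apply: nearW => n; rewrite sumEFin lee_fin big_mkord.
Qed.

Let mean_error_cvg : (fun n =>
  \int[P]_w \int[mu]_(x in K) ((X x w - Xn n x w) ^+ 2)%:E)%E @ \oo --> 0%E.
Proof.
under eq_fun do rewrite mean_error.
by apply: nneseries_tail_cvg series_finite _ => j _; exact: powR_ge0.
Qed.

(** [Xn 0] is zero, so the error formula at n = 0 is the second moment of the whole field, finite by
    summability of lam_j^(-2s). *)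
Let X_L2 : {ae P, forall w, L2' (X ^~ w)}.
Proof.
pose J w := (\int[mu]_(x in K) ((X x w - Xn 0 x w) ^+ 2)%:E)%E.
have J0 w : (0 <= J w)%E by apply: integral_ge0 => x _; rewrite lee_fin sqr_ge0.
have JE w : J w = (\int[mu]_(x in K) ((X x w) ^+ 2)%:E)%E.
  by apply: eq_integral => x _; rewrite /Xn big_ord0 subr0.
have IJ : P.-integrable setT J.
  apply/integrableP; split.
    exact: (measurable_tonelli2 mu mK measurableT (mdiff 0) (@diff_ge0 0)).
  under eq_integral do rewrite gee0_abs//.
  by rewrite mean_error; exact: series_finite.
apply: filterS (integrable_ae measurableT IJ) => w /(_ I) fw; split.
  by apply/measurable_EFinP; exact: (measurable_section2 mK measurableT mXE I).
by rewrite -JE; rewrite -ge0_fin_numE.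
Qed.

Lemma integrated_field_white_noise f : test_functions p K mu Phi f ->
  measurable_fun setT (integrated_field K mu X f) /\
  {ae P, forall w, integrated_field K mu X f w = W (neg_power K mu lam Phi s f) w}.
Proof.
move=> tf; have [cf _ _] := tf.
have Lf : L2' f by exact: (within_continuous_L2 hK hmu cf).
set h := neg_power K mu lam Phi s f.
have hsum : l2_sum mu K _ h := neg_power_l2_sum s_gt0 tf.
have Lh : L2' h by have [] := hsum.
have mZ : measurable_fun setT (integrated_field K mu X f).
  apply: (measurable_Rintegral (F := fun z => f z.1 * X z.1 z.2) mu mK measurableT).
  apply: measurable_funM => //; apply: (@measurable_comp _ _ _ _ _ _ K f) => //.
  - by move=> _ [[y w] [Ky _] <-].
  - by have [] := Lf.
  - exact: measurable_funTS.
split=> //.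
pose V n w := \sum_(j < n) lam j `^ (- s) * ip (Phi j) f * W (Phi j) w.
have mV n : measurable_fun setT (V n).
  apply: measurable_sum => j; apply: measurable_funM => //.
  exact: white_noise_measurable.
have XnE n w : (fun x => Xn n x w) =
    (fun x => \sum_(j < n) lam j `^ (- s) * W (Phi j) w * Phi j x).
  by apply/funext => x; apply: eq_bigr => j _; rewrite mulrAC.
have VE n w : V n w = ip (fun x => Xn n x w) f.
  rewrite XnE (dot_partial_sum mK LPhi (fun j => lam j `^ (- s) * W (Phi j) w) n Lf).
  by apply: eq_bigr => j _; rewrite mulrAC.
have LX n w : L2' (fun x => Xn n x w).
  rewrite XnE; exact: (partial_sum_L2 mK LPhi (fun j => lam j `^ (- s) * W (Phi j) w)).
apply: (ae_eq_common_limit (V := V)) => //; first exact: white_noise_measurable.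
(* Since V n is the inner product of the n-th partial sum with f, Cauchy-Schwarz in x bounds its
   error by that of the field, uniformly in the outcome. *)
- apply: (@squeeze_cvge _ _ _ _ (fun=> 0%E) _ (fun n => (ip f f)%:E *
    \int[P]_w \int[mu]_(x in K) ((X x w - Xn n x w) ^+ 2)%:E)%E).
  + apply: nearW => n; apply/andP; split.
      by apply: integral_ge0 => w _; rewrite lee_fin sqr_ge0.
    have mJ := measurable_tonelli2 mu mK measurableT (mdiff n) (@diff_ge0 n).
    rewrite -ge0_integralZl_EFin ?dot_ge0//; last first.
      by move=> w _; apply: integral_ge0 => x _; rewrite lee_fin sqr_ge0.
    apply: ae_ge0_le_integral => //.
    * by move=> w _; rewrite lee_fin sqr_ge0.
    * by apply/measurable_EFinP/measurable_funX/measurable_funB.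
    * move=> w _; rewrite mule_ge0 ?lee_fin ?dot_ge0//.
      by apply: integral_ge0 => x _; rewrite lee_fin sqr_ge0.
    * exact: measurable_funeM.
    apply: filterS X_L2 => w Lw _.
    have LB := square_integrableB mK Lw (LX n w).
    rewrite (dotE mK LB) -EFinM lee_fin VE.
    have -> : integrated_field K mu X f w - ip (fun x => Xn n x w) f =
        ip f (fun x => X x w - Xn n x w).
      by rewrite [RHS]dotC (dotBl mK Lw (LX n w) Lf) (dotC _ _ (X ^~ w)).
    exact: (cauchy_schwarz mK).
  + exact: cvg_cst.
  + have -> : (0 = (ip f f)%:E * 0)%E by rewrite mule0.
    exact: cvgeZl mean_error_cvg.
- pose a j := lam j `^ (- s) * ip (Phi j) f.
  have -> : (fun n => \int[P]_w ((W h w - V n w) ^+ 2)%:E)%E =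
      (fun n => \int[mu]_(x in K) ((h x - \sum_(j < n) a j * Phi j x) ^+ 2)%:E)%E.
    apply/funext => n.
    rewrite (dotE mK (square_integrableB mK Lh (partial_sum_L2 mK LPhi a n))).
    apply: (white_noise_remainder a n Lh (white_noise_measurable Lh)).
    exact: nearW.
  by have [] := hsum.
Qed.

End green_field.

Lemma fgf_white_noise s (Z : (R * R -> R) -> Omega -> R) : 0 < s ->
  (forall f, test_functions p K mu Phi f -> measurable_fun setT (Z f) /\
    {ae P, forall w, Z f w = W (neg_power K mu lam Phi s f) w}) ->
  fractional_gaussian_field P p K mu lam Phi s Z.
Proof.
move=> s0 HZ; have [[gW W0] _ covW] := hW.
have Lh f : test_functions p K mu Phi f -> L2' (neg_power K mu lam Phi s f).
  by move=> /(neg_power_l2_sum s0)[].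
have mW f (tf : test_functions p K mu Phi f) := white_noise_measurable (Lh f tf).
split; first split.
- move=> n t c tD; apply: (gaussian_rv_ae (gW n _ c (fun k => Lh _ (tD k)))).
    apply: measurable_sum => k; apply: measurable_funM => //.
    by have [] := HZ _ (tD k).
  have : {ae P, forall w, forall k, Z (t k) w = W (neg_power K mu lam Phi s (t k)) w}.
    (* The finitely many exceptional null sets are merged as a countable family indexed by the
       natural numbers, vacuous from n on. *)
    have : {ae P, forall w, forall i (k : 'I_n), k = i :> nat ->
        Z (t k) w = W (neg_power K mu lam Phi s (t k)) w}.
      apply/ae_foralln => i; case: (ltnP i n) => ni; last first.
        by apply: nearW => w k ki; move: (ltn_ord k); rewrite ki ltnNge ni.
      have [_] := HZ _ (tD (Ordinal ni)); apply: filterS => w Hw k ki.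
      by rewrite (_ : k = Ordinal ni)//; exact: val_inj.
    by apply: filterS => w Hw k; exact: (Hw k k).
  by apply: filterS => w Hw; apply: eq_bigr => k _; rewrite Hw.
- move=> f tf; rewrite -(W0 _ (Lh f tf)) unlock.
  have [mZ ZE] := HZ _ tf.
  apply: ae_eq_integral => //; try exact/measurable_EFinP.
    by apply/measurable_EFinP; exact: mW.
  by apply: filterS ZE => w -> _.
- move=> f g tf tg; rewrite -(covW _ _ (Lh f tf) (Lh g tg)) unlock.
  have [mZf ZfE] := HZ _ tf; have [mZg ZgE] := HZ _ tg.
  apply: ae_eq_integral => //.
  + by apply/measurable_EFinP; exact: measurable_funM.
  + by apply/measurable_EFinP; apply: measurable_funM; exact: mW.
  + by apply: filterS2 ZfE ZgE => w /= -> -> _.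
Qed.

End white_noise_field.

Theorem proposition2p17 (R : realType) (p : 'I_3 -> R * R) (K : set (R * R))
    (mu : {measure set (R * R) -> \bar R})
    (lam : nat -> R) (Phi : nat -> R * R -> R) :
  unit_equilateral p ->
  sierpinski_gasket p K ->
  selfsimilar_measure p K mu ->
  dirichlet_eigenbasis p K mu lam Phi ->
  (forall (s : R) (pt : R -> R * R -> R * R -> R)
      (d : measure_display) (Omega : measurableType d)
      (P : probability Omega R) (W : (R * R -> R) -> Omega -> R)
      (X : R * R -> Omega -> R),
    hausdorff_dim / (2 * walk_dim) < s ->
    heat_kernel K mu lam Phi pt ->
    white_noise P K mu W ->
    green_field_version P K pt s W X ->
    fractional_gaussian_field P p K mu lam Phi s (integrated_field K mu X))
  /\
  (forall s : R, 0 <= s ->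
    (exists (d : measure_display) (Omega : measurableType d)
        (P : probability Omega R) (Y : R * R -> Omega -> R),
      [/\ gaussian_field P K Y,
          jointly_measurable K Y,
          (\int[P]_w \int[mu]_(x in K) ((Y x w) ^+ 2)%:E < +oo)%E
        & fractional_gaussian_field P p K mu lam Phi s
            (integrated_field K mu Y)]) ->
    hausdorff_dim / (2 * walk_dim) < s).
Proof.
move=> eqp hK hmu hb.
(* K is the cell of the empty word, of mass 1, and its complement is not charged; mu is therefore a
   probability. *)
have mu1 : mu setT = 1%E.
  have mK := gasket_measurable hK.
  have [muC /(_ [::])] := hmu; rewrite /= image_id expr0 => muK.
  rewrite -(setUv K); apply: etrans (measureU _ _ _ _) _ => //.
  - exact: measurableC.
  - by rewrite setICr.
  - by transitivity (1 + 0 : \bar R)%E; [congr (_ + _)%E; [exact: muK|exact: muC]|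
    rewrite adde0].
have [nu nuE] := measure_is_probability mu1; subst mu.
split=> [s pt d Omega P W X hs hpt hW hX|s s0].
  apply: (fgf_white_noise eqp hK hmu hb hW (lt_trans critical_exponent_gt0 hs)).
  by move=> f; exact: (integrated_field_white_noise eqp hK hmu hb hW hs hpt hX).
case=> d [T [P [Y [_ mY Yoo fY]]]].
exact: (fgf_density_exponent eqp hK hmu hb s0 mY Yoo fY).
Qed.
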